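(* Let $d\ge3$ and fix $x\in\mathbb{R}^d$. There exists $\kappa>0$ such that for all $n$ large enough, $$\frac1{Z_N}E\big(e^{-|R_N|};\ \mathcal{G}_{loc,x}\cap(\mathcal{R}_{\kappa,x})^c\big)\le\exp(-n^\kappa),$$ where $\mathcal{G}_{loc,x}=\{\|\ell_N-(\phi_x)^2\|_1\le n^{-1/800}\}$ and $\mathcal{R}_{\kappa,x}=\{\forall z\in B(x,\rho_d(1-n^{-\kappa}))\cap\frac1n\mathbb{Z}^d,\ \ell_N(z)>0\}$.
   Context: $(S_k)$ is the simple random walk on $\mathbb{Z}^d$ from $0$ with law $P$; $E(X;\mathcal{A})=E(X1_\mathcal{A})$. $N=n^{d+2}$, $n$ an integer. $R_N$ is the set of sites visited up to time $N$, $Z_N=E(e^{-|R_N|})$. $L_N(y)=\sum_{k=0}^{N-1}1_{\{S_k=y\}}$, $\ell_N(y)=\frac{n^d}{N}L_N(\lfloor ny\rfloor)$ for $y\in\mathbb{R}^d$, and $\|\cdot\|_1$ is the $L^1(\mathbb{R}^d)$ norm. For open $G$, $\lambda(G)$ is the principal Dirichlet eigenvalue of $-\Delta$; $\lambda_d=\lambda(B(0,1))$, $\omega_d=|B(0,1)|$, $\rho_d=(\lambda_d/(d^2\omega_d))^{1/(d+2)}$. $\phi_x$ is the nonnegative principal Dirichlet eigenfunction of $-\Delta$ in $B(x,\rho_d)$ with $\int\phi_x^2=1$, extended by $0$ outside. *)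

(* Defs.v *)
From HB Require Import structures.
From mathcomp Require Import all_boot all_order all_algebra.
From mathcomp Require Import all_classical all_reals all_analysis.
Set Implicit Arguments. Unset Strict Implicit. Unset Printing Implicit Defensive.
Import Order.TTheory GRing.Theory Num.Theory.
Import numFieldNormedType.Exports.
Local Open Scope classical_set_scope.
Local Open Scope ring_scope.

Section Defs.
Variable R : realType.

Definition enorm (d : nat) (y : 'rV[R]_d) : R := Num.sqrt (\sum_(i < d) (y 0 i) ^+ 2).

Definition eball (d : nat) (x : 'rV[R]_d) (r : R) : set 'rV[R]_d :=
  [set y | enorm (y - x) < r].

Definition unitv (d : nat) (i : 'I_d) : 'rV[R]_d := delta_mx 0 i.

(** ** Lebesgue integral on R^d of a nonnegative function, computed as the
    iterated one-dimensional Lebesgue integral (Tonelli) *)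
Fixpoint iint (d : nat) : ('rV[R]_d -> \bar R) -> \bar R :=
  match d with
  | 0 => fun f => f 0
  | k.+1 => fun f =>
      (\int[@lebesgue_measure R]_(t in [set: R])
          iint (fun v : 'rV[R]_k =>
             f (row_mx (const_mx (t : R) : 'rV[R]_1) v : 'rV[R]_k.+1)))%E
  end.

Definition omega (d : nat) : R :=
  fine (iint (fun y : 'rV[R]_d => (\1_(eball 0 1) y : R)%:E)).

Definition grad_sq (d : nat) (f : 'rV[R]_d -> R) (y : 'rV[R]_d) : R :=
  \sum_(i < d) ('D_(unitv i) f y) ^+ 2.

Definition C1c_in (d : nat) (G : set 'rV[R]_d) (f : 'rV[R]_d -> R) : Prop :=
  (forall y i, derivable f y (unitv i)) /\
  (forall i, continuous ('D_(unitv i) f)) /\ continuous f /\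
  exists K : set 'rV[R]_d, compact K /\ K `<=` G /\ (forall y, ~ K y -> f y = 0).

Definition dirichlet_eigenvalue (d : nat) (G : set 'rV[R]_d) : R :=
  inf [set q : R | exists f : 'rV[R]_d -> R, C1c_in G f /\
         (iint (fun y => ((f y) ^+ 2)%:E) != 0)%E /\
         q = fine (iint (fun y => (grad_sq f y)%:E))
             / fine (iint (fun y => ((f y) ^+ 2)%:E))].

Definition lambda_d (d : nat) : R := dirichlet_eigenvalue (eball (0 : 'rV[R]_d) 1).

Definition rho_d (d : nat) : R :=
  (lambda_d d / ((d ^ 2)%:R * omega d)) `^ (d.+2%:R)^-1.

Definition laplacian (d : nat) (f : 'rV[R]_d -> R) (y : 'rV[R]_d) : R :=
  \sum_(i < d) 'D_(unitv i) ('D_(unitv i) f) y.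

Definition principal_eigenfunction (d : nat) (x : 'rV[R]_d) (phi : 'rV[R]_d -> R) : Prop :=
  let B := eball x (rho_d d) in
  continuous phi /\
  (forall y, ~ B y -> phi y = 0) /\
  (forall y, 0 <= phi y) /\
  (forall y, B y -> forall i j,
      derivable phi y (unitv i) /\ derivable ('D_(unitv i) phi) y (unitv j)) /\
  (forall i j, {within B, continuous ('D_(unitv j) ('D_(unitv i) phi))}) /\
  (forall y, B y -> - laplacian phi y = dirichlet_eigenvalue B * phi y) /\
  iint (fun y => ((phi y) ^+ 2)%:E) = 1%E.

(** ** Simple random walk on Z^d with N steps.
    A trajectory is given by its N steps; step (i, b) is +e_i if b, -e_i otherwise.
    The law P of (S_0, ..., S_N) is the uniform measure on trajectories. *)
Definition traj (d N : nat) := {ffun 'I_N -> 'I_d * bool}.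

Definition step_vec (d : nat) (s : 'I_d * bool) : 'rV[int]_d :=
  if s.2 then delta_mx 0 s.1 else - delta_mx 0 s.1.

Definition S (d N : nat) (w : traj d N) (k : nat) : 'rV[int]_d :=
  \sum_(j < N | (j < k)%N) step_vec (w j).

Definition Exp (d N : nat) (X : traj d N -> R) : R :=
  (\sum_(w : traj d N) X w) / #|{: traj d N}|%:R.

Definition Exp_on (d N : nat) (X : traj d N -> R) (A : set (traj d N)) : R :=
  Exp (fun w => X w * \1_A w).

Definition range_size (d N : nat) (w : traj d N) : nat :=
  size (undup [seq S w k | k <- iota 0 N.+1]).

Definition Z_N (d N : nat) : R := Exp (fun w : traj d N => expR (- (range_size w)%:R)).

Definition L_N (d N : nat) (w : traj d N) (y : 'rV[int]_d) : nat :=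
  count (fun k => S w k == y) (iota 0 N).

Definition Nof (d n : nat) : nat := (n ^ (d + 2))%N.

Definition ell (d n : nat) (w : traj d (Nof d n)) (y : 'rV[R]_d) : R :=
  (n ^ d)%:R / (Nof d n)%:R * (L_N w (map_mx (fun t => Num.floor (n%:R * t)) y))%:R.

Definition G_loc (d n : nat) (phi : 'rV[R]_d -> R) : set (traj d (Nof d n)) :=
  [set w | (iint (fun y => `| ell w y - (phi y) ^+ 2 |%:E)
              <= (n%:R `^ (- (800%:R)^-1))%:E)%E].

Definition R_cover (d n : nat) (kappa : R) (x : 'rV[R]_d) : set (traj d (Nof d n)) :=
  [set w | forall z : 'rV[R]_d,
      eball x (rho_d d * (1 - n%:R `^ (- kappa))) z ->
      (exists m : 'rV[int]_d, z = (n%:R)^-1 *: map_mx (fun a : int => a%:~R) m) ->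
      0 < ell w z].

End Defs.

(* Main.v *)
Require Import Defs.
From HB Require Import structures.
From mathcomp Require Import all_boot all_order all_algebra.
From mathcomp Require Import all_classical all_reals all_analysis.
From mathcomp Require Import ring lra zify.
Import Order.TTheory GRing.Theory Num.Theory.
Import numFieldNormedType.Exports.
Local Open Scope classical_set_scope.
Local Open Scope ring_scope.

(* Suppose that a site c well inside the ball of radius rho n is not visited.
   Since phi vanishes at most linearly at the sphere, closeness of the local
   times to phi^2 forces the walk to spend a lot of time in a cube around c of
   side slightly smaller than n.  Among a geometric sequence of cubes D_i around
   c, some D_i has an unvisited part A with |A| at least 1/b times the number of
   unvisited sites of D_{i+1}, where b is a small power of n.  Filling D_{i+1}
   changes the weight exp(-|R|) by at most exp(b |A|).  On the other hand
   exp(-|R|) is the survival probability among independent obstacles, and if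
   D_{i+1} is free of obstacles then each time the walk, conditioned to survive,
   comes back to the small cube, it has a chance of order |A| / |D_i|, up to
   powers of b, of hitting A before long.  This uses a Harnack inequality for the
   survival probabilities, which follows from upper bounds for the lazy heat
   kernel and lower bounds for the kernel killed on leaving a cube.  There are so
   many returns that missing A costs a factor exp(-b^3 |A|), which beats both
   the filling and the sum over A. *)

(** One hole would be easy: about n^(d+2) units of time near it, up to powers of b, are cut into
    trials of length w^2, each finding the hole with probability about w^(-d), and w is n over a
    power of b. But the trials need a cube free of obstacles, whereas other unvisited sites may lie
    near, and opening each of them costs a factor e. Hence the choice of a scale. The largest cube
    has at most b^(d P) sites, so [d * P] scales suffice; their number does not depend on n, and
    neither does the total blow-up (128 d)^(d P). Per site of A the account is: b for filling, at
    most b for choosing A in a cube of at most e^b sites, against a gain of b^3.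

    Laziness removes parity and, once it is known how often each axis is used, makes the coordinates
    independent with binomial kernels, so explicit inequalities replace limit theorems. Survival
    decreases in time, which lets the lazy walk bound the simple one and lets the Harnack inequality
    compare equal times.

    b is the integer part of n^(1/P), with P so large that the error n^(-1/800) lies below the mass
    phi^2 gives to the small cube. *)

(** * The one-dimensional lazy kernel, through binomial coefficients *)

Section OneDim.
Variable R : realType.

(* The law at time [s] of the lazy walk on Z with steps -1, 0, 1 of
   probabilities 1/4, 1/2, 1/4, i.e. of half a simple walk run for time [2s]. *)
Definition lazyker (s : nat) (z : int) : R := 'C(2 * s, s + `|z|)%:R / 4 ^+ s.

Lemma lazyker_ge0 s z : 0 <= lazyker s z.
Proof. by rewrite /lazyker divr_ge0 ?ler0n ?exprn_ge0. Qed.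

Lemma lazykerN s z : lazyker s (- z) = lazyker s z.
Proof. by rewrite /lazyker abszN. Qed.

Lemma lazyker0 z : lazyker 0 z = (z == 0)%:R.
Proof.
rewrite /lazyker muln0 add0n expr0 divr1.
by case: (eqVneq z 0) => [->//|zn0]; rewrite bin_small // absz_gt0.
Qed.

Lemma bin_2step m k : 'C(m.+2, k.+2) = ('C(m, k) + 2 * 'C(m, k.+1) + 'C(m, k.+2))%N.
Proof. by rewrite !binS; lia. Qed.

Lemma bin_central_shift s : 'C(2 * s.+1, s) = 'C(2 * s.+1, s.+2).
Proof. by rewrite -bin_sub; [congr 'C(_, _); lia | lia]. Qed.

(** Pascal's rule applied twice, a lazy step being two half-steps of a simple walk. The origin is a
    separate case because both its neighbours have absolute value 1. *)
Lemma lazykerS s z :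
  lazyker s.+1 z = (2 * lazyker s z + lazyker s (z + 1) + lazyker s (z - 1)) / 4.
Proof.
wlog: z / exists k : nat, z = k%:Z.
  move=> H; have [k [->|->]] : exists k : nat, z = k%:Z \/ z = - k%:Z.
      by exists `|z|%N; lia.
    by apply: H; exists k.
  rewrite lazykerN H; last by exists k.
  rewrite -[in RHS]lazykerN opprK -[lazyker s (- _ + 1)]lazykerN.
  rewrite -[lazyker s (- _ - 1)]lazykerN !opprD !opprK.
  by congr (_ / _); ring.
move=> [k ->].
suff H : 'C(2 * s.+1, s.+1 + k) =
    (2 * 'C(2 * s, s + k) + 'C(2 * s, s + `|(k%:Z + 1)%R|)
     + 'C(2 * s, s + `|(k%:Z - 1)%R|))%N.
  rewrite /lazyker absz_nat H exprS natrD natrD natrM.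
  by field; rewrite expf_neq0.
rewrite (_ : 2 * s.+1 = (2 * s).+2)%N; last by lia.
rewrite (_ : `|(k%:Z + 1)%R|%N = k.+1); last by lia.
case: k => [|k].
  case: s => [|s] //.
  rewrite (_ : s.+2 + 0 = s.+2)%N ?addn0 ?addn1 // bin_2step bin_central_shift.
  by lia.
rewrite (_ : `|(k.+1%:Z - 1)%R|%N = k); last by lia.
by rewrite addnS !addSn bin_2step !addnS; lia.
Qed.

(** The ratio of neighbouring binomial coefficients. In this cross-multiplied form it also covers
    [z > s], where both sides vanish. *)
Lemma lazyker_shift s (z : nat) :
  lazyker s z.+1 * (s + z + 1)%:R = lazyker s z * (s%:R - z%:R).
Proof.
rewrite /lazyker !absz_nat.
have [zs|zs] := leqP z s; last first.
  by rewrite !bin_small ?mul0r //; lia.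
rewrite -natrB // mulrAC -natrM [RHS]mulrAC -natrM; congr (_%:R / _).
by have := mul_bin_left (2 * s) (s + z); rewrite addn1 addnS mulnC => ->; lia.
Qed.

Lemma lazykerS_le s (z : nat) : lazyker s z.+1 <= lazyker s z.
Proof.
have := lazyker_shift s z; have := lazyker_ge0 s z; have := lazyker_ge0 s z.+1.
rewrite !natrD; set a := lazyker s z.+1; set b := lazyker s z => a0 b0 H.
have z0 : 0 <= z%:R :> R by []. have s0 : 0 <= s%:R :> R by [].
have : 0 <= (b - a) * (s%:R + z%:R + 1) by nra.
by rewrite pmulr_lge0 ?subr_ge0 //; lra.
Qed.

Lemma lazyker_anti s (z z' : int) : (`|z| <= `|z'|)%N -> lazyker s z' <= lazyker s z.
Proof.
rewrite (_ : lazyker s z = lazyker s `|z|%N); last by rewrite /lazyker absz_nat.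
rewrite (_ : lazyker s z' = lazyker s `|z'|%N); last by rewrite /lazyker absz_nat.
move/subnKC <-; elim: (_ - _)%N => [|m IH]; first by rewrite addn0.
by rewrite addnS; apply: le_trans IH; exact: lazykerS_le.
Qed.

Lemma lazyker_central s :
  lazyker s.+1 0 * (2 * s%:R + 2) = lazyker s 0 * (2 * s%:R + 1).
Proof.
rewrite lazykerS add0r sub0r lazykerN.
have := lazyker_shift s 0; rewrite addn0 subr0 natrD => H.
have -> : (2 * lazyker s 0 + lazyker s 1 + lazyker s 1) / 4 * (2 * s%:R + 2)
  = lazyker s 0 * (s%:R + 1) + lazyker s 1 * (s%:R + 1) by field.
by rewrite H; ring.
Qed.

Lemma lazyker_central_anti s t : (s <= t)%N -> lazyker t 0 <= lazyker s 0.
Proof.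
move/subnKC <-; elim: (_ - _)%N => [|m IH]; first by rewrite addn0.
rewrite addnS; apply: le_trans IH.
have := lazyker_central (s + m); have := lazyker_ge0 (s + m) 0.
set a := lazyker _ 0; set b := lazyker _ 0; set r := (s + m)%:R => a0 H.
have r0 : 0 <= r by [].
have : 0 <= (a - b) * (2 * r + 2) by nra.
by rewrite pmulr_lge0 ?subr_ge0 //; lra.
Qed.

Lemma lazyker_le1 s z : lazyker s z <= 1.
Proof.
apply: le_trans (lazyker_anti s 0 z _) _ => //.
apply: le_trans (lazyker_central_anti 0 s _) _ => //.
by rewrite lazyker0.
Qed.

(** Wallis' bounds: by [lazyker_central] the left side decreases in [s] from the value 1 at 0. The
    lower bound below uses the factor 4 s, with which the product increases from 1 at [s = 1]. *)
Lemma lazyker_central_upper s : lazyker s 0 ^+ 2 * (2 * s%:R + 1) <= 1.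
Proof.
elim: s => [|s IH]; first by rewrite lazyker0 expr1n; lra.
have H := lazyker_central s; move: H IH; rewrite -[s.+1%:R]natr1.
set a := lazyker s.+1 0; set b := lazyker s 0; set r := s%:R => H IH.
have r0 : 0 <= r by [].
have e : a = b * (2 * r + 1) / (2 * r + 2) by rewrite -H mulfK //; lra.
apply: le_trans IH; rewrite e -subr_ge0.
have -> : b ^+ 2 * (2 * r + 1) - (b * (2 * r + 1) / (2 * r + 2)) ^+ 2 * (2 * (r + 1) + 1)
  = b ^+ 2 * (2 * r + 1) / (2 * r + 2) ^+ 2.
  by field; lra.
by rewrite divr_ge0 ?mulr_ge0 ?sqr_ge0 //; lra.
Qed.

Lemma lazyker_central_lower s : (0 < s)%N -> 1 <= lazyker s 0 ^+ 2 * (4 * s%:R).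
Proof.
case: s => // s _; elim: s => [|s IH].
  have := lazyker_central 0; rewrite lazyker0 eqxx mulr0 !add0r => H.
  have -> : lazyker 1 0 = 2^-1 by move: H; rewrite /=; lra.
  lra.
have H := lazyker_central s.+1; move: H IH; rewrite -[s.+2%:R]natr1.
set a := lazyker s.+2 0; set b := lazyker s.+1 0; set r := s.+1%:R => H IH.
have r0 : 1 <= r by rewrite /r -natr1 lerDr.
have e : a = b * (2 * r + 1) / (2 * r + 2) by rewrite -H mulfK //; lra.
apply: (le_trans IH); rewrite e -subr_ge0.
have -> : (b * (2 * r + 1) / (2 * r + 2)) ^+ 2 * (4 * (r + 1)) - b ^+ 2 * (4 * r)
  = b ^+ 2 / (r + 1).
  by field; lra.
by rewrite divr_ge0 ?sqr_ge0 //; lra.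
Qed.

Lemma lazyker_sq_upper t : (0 < t)%N -> lazyker (t ^ 2) 0 <= t%:R^-1.
Proof.
move=> t0; have := lazyker_central_upper (t ^ 2); have := lazyker_ge0 (t ^ 2) 0.
rewrite natrX; set a := lazyker _ _ => a0 H.
have t0' : 0 < t%:R :> R by rewrite ltr0n.
rewrite -[leRHS]mul1r ler_pdivlMr //.
rewrite -(ler_pXn2r (n := 2)) ?nnegrE ?mulr_ge0 ?(ltW t0') //.
by rewrite exprMn expr1n; nra.
Qed.

Lemma lazyker_sq_lower s t : (0 < t)%N -> (s <= t ^ 2)%N -> (2 * t%:R)^-1 <= lazyker s 0.
Proof.
move=> t0 /lazyker_central_anti; apply: le_trans.
have t0' : 0 < t%:R :> R by rewrite ltr0n.
have := @lazyker_central_lower (t ^ 2) _; rewrite sqrn_gt0 => /(_ t0) H.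
have := lazyker_ge0 (t ^ 2) 0; move: H; rewrite natrX.
set a := lazyker _ _ => H a0.
rewrite -[leLHS]mul1r ler_pdivrMr; last by lra.
rewrite -(ler_pXn2r (n := 2)) ?nnegrE ?mulr_ge0 ?(ltW t0') //.
by rewrite expr1n; apply: le_trans H _; rewrite !exprMn; nra.
Qed.

(** The ratio of neighbours is 1 - (2 z + 1) / (s + z + 1), at least 1 - (2 z + 1) / s; these
    decrements add up to z^2 / s, and (1 - m) (1 - u) >= 1 - m - u. *)
Lemma lazyker_near s (z : nat) : (0 < s)%N ->
  (1 - z%:R ^+ 2 / s%:R) * lazyker s 0 <= lazyker s z.
Proof.
move=> s0; have s0' : 0 < s%:R :> R by rewrite ltr0n.
have k0 := lazyker_ge0 s 0.
elim: z => [|z IH]; first by rewrite expr0n mul0r subr0 mul1r.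
have q0 := lazyker_ge0 s z; have q1 := lazyker_ge0 s z.+1.
have H := lazyker_shift s z.
move: H IH q0 q1; rewrite !natrD -[z.+1%:R]natr1.
set a := lazyker s z.+1; set c := lazyker s z; set k := lazyker s 0 in k0 *.
set x := z%:R; set y := s%:R in s0' * => H IH c0 a0.
have x0 : 0 <= x by rewrite /x.
have [neg|pos] := lerP (1 - (x + 1) ^+ 2 / y) 0.
  by apply: le_trans a0; nra.
have -> : a = c * (1 - (2 * x + 1) / (y + x + 1)).
  apply: (@mulIf _ (y + x + 1)); first by lra.
  by rewrite H; field; lra.
have y1 : (2 * x + 1) / (y + x + 1) <= (2 * x + 1) / y.
  by rewrite ler_pM2l ?lef_pV2 ?posrE; lra.
have e : (x + 1) ^+ 2 / y = x ^+ 2 / y + (2 * x + 1) / y by field; lra.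
set u := (2 * x + 1) / y in y1 e *; set v := (2 * x + 1) / _ in y1 *.
have v0 : 0 <= v by rewrite divr_ge0 //; lra.
rewrite e in pos *; set m := x ^+ 2 / y in IH e pos *.
have m0 : 0 <= m by rewrite divr_ge0 ?sqr_ge0 //; lra.
have : (1 - m) * k * (1 - v) <= c * (1 - v) by rewrite ler_wpM2r //; lra.
apply: le_trans; rewrite mulrAC ler_wpM2r //.
nra.
Qed.

(** A polynomial tail is enough: reflected terms only have to be at most 1/8 of the central
    value. *)
Lemma lazyker_far s (z : nat) : (0 < s)%N ->
  lazyker s z * (1 + z%:R ^+ 2 / (s + z)%:R) <= lazyker s 0.
Proof.
move=> s0; have s0' : 0 < s%:R :> R by rewrite ltr0n.
(* The denominator is frozen at the final [z], so that the induction on [y <= z] compares fractions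
   with the same [B]. *)
set B : R := (s + z)%:R.
suff H : forall y, (y <= z)%N -> lazyker s y * (1 + y%:R ^+ 2 / B) <= lazyker s 0.
  exact: H.
elim=> [|y IH] yz; first by rewrite expr0n mul0r addr0 mulr1.
apply: le_trans (IH (ltnW yz)).
have := lazyker_shift s y; rewrite !natrD -[y.+1%:R]natr1.
have B1 : s%:R + y%:R + 1 <= B by rewrite /B -natrD -(natrD _ _ 1) ler_nat; lia.
have := lazyker_ge0 s y; have := lazyker_ge0 s y.+1.
set a := lazyker s y.+1; set c := lazyker s y; move: B1 s0'.
set x := s%:R; set v := y%:R => B1 x0 a0 c0 H.
have v0 : 0 <= v by rewrite /v.
have B0 : 0 < B by lra.
have -> : a = c * ((x - v) / (x + v + 1)).
  by apply: (@mulIf _ (x + v + 1)); [lra | rewrite H; field; lra].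
rewrite -mulrA ler_wpM2l // -subr_ge0.
have -> : 1 + v ^+ 2 / B - (x - v) / (x + v + 1) * (1 + (v + 1) ^+ 2 / B)
  = ((2 * v + 1) * (B - x) + v * ((v + 1) ^+ 2 + v ^+ 2) + v ^+ 2) / (B * (x + v + 1)).
  by field; lra.
rewrite divr_ge0 //; last by nra.
have := sqr_ge0 v; have := sqr_ge0 (v + 1) => h1 h2.
have : 0 <= v * ((v + 1) ^+ 2 + v ^+ 2) by rewrite mulr_ge0 ?addr_ge0.
have : 0 <= (2 * v + 1) * (B - x) by rewrite mulr_ge0; lra.
lra.
Qed.

End OneDim.

(** * Heat kernel of the lazy walk on Z^d: free upper bound, killed lower bound *)

Section Lattice.
Variables (R : realType) (d : nat).
Hypothesis d_gt0 : (0 < d)%N.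
Notation site := 'rV[int]_d.
Implicit Types (f g : site -> R) (x y a v : site).

Definition rw_avg f x : R := (\sum_(s : 'I_d * bool) f (x + step_vec s)) / (2 * d)%:R.

Definition lazy_avg f x : R := (f x + rw_avg f x) / 2.

Definition axis_avg (i : 'I_d) f x : R :=
  (2 * f x + f (x + delta_mx 0 i) + f (x - delta_mx 0 i)) / 4.

Let d_neq0 : d%:R != 0 :> R.
Proof. by rewrite pnatr_eq0 -lt0n. Qed.

Lemma rw_avg_le f g x : (forall y, f y <= g y) -> rw_avg f x <= rw_avg g x.
Proof.
by move=> fg; rewrite /rw_avg ler_wpM2r ?invr_ge0 ?ler0n // ler_sum.
Qed.

Lemma lazy_avg_le f g x : (forall y, f y <= g y) -> lazy_avg f x <= lazy_avg g x.
Proof.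
move=> fg; rewrite /lazy_avg ler_wpM2r ?invr_ge0 ?ler0n //.
by rewrite lerD // rw_avg_le.
Qed.

Lemma rw_avgZ k f x : rw_avg (fun y => k * f y) x = k * rw_avg f x.
Proof. by rewrite /rw_avg -mulr_sumr mulrA. Qed.

Lemma rw_avgD f g x : rw_avg (fun y => f y + g y) x = rw_avg f x + rw_avg g x.
Proof. by rewrite /rw_avg big_split /= mulrDl. Qed.

Lemma rw_avg_cst k x : rw_avg (fun=> k) x = k.
Proof.
rewrite /rw_avg sumr_const card_prod card_bool card_ord -(mulr_natr k) mulnC.
by rewrite mulfK // natrM mulf_neq0 // pnatr_eq0.
Qed.

Lemma lazy_avgZ k f x : lazy_avg (fun y => k * f y) x = k * lazy_avg f x.
Proof. by rewrite /lazy_avg rw_avgZ; field. Qed.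

Lemma lazy_avgD f g x : lazy_avg (fun y => f y + g y) x = lazy_avg f x + lazy_avg g x.
Proof. by rewrite /lazy_avg rw_avgD; field. Qed.

Lemma lazy_avg_cst k x : lazy_avg (fun=> k) x = k.
Proof. by rewrite /lazy_avg rw_avg_cst; field. Qed.

Lemma rw_avgE f x :
  rw_avg f x = (\sum_(i < d) (f (x + delta_mx 0 i) + f (x - delta_mx 0 i))) / (2 * d)%:R.
Proof.
rewrite /rw_avg; congr (_ / _).
transitivity (\sum_(i < d) \sum_(b : bool) f (x + step_vec (i, b))).
  by rewrite pair_bigA; apply: eq_bigr => -[i b].
by apply: eq_bigr => i _; rewrite big_bool.
Qed.

(** A lazy step picks an axis uniformly and makes a (1/4, 1/2, 1/4) step along it. Given the axis
    counts, the kernel is therefore a product. *)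
Lemma lazy_avgE f x : lazy_avg f x = (\sum_(i < d) axis_avg i f x) / d%:R.
Proof.
rewrite /lazy_avg rw_avgE /axis_avg -[in RHS]mulr_suml.
under [in RHS]eq_bigr => i _ do rewrite -addrA.
rewrite [in RHS]big_split /= sumr_const card_ord -mulr_natr natrM.
by field.
Qed.

Definition bump_count (c : 'I_d -> nat) (i j : 'I_d) : nat := (c j + (i == j))%N.

(* The expectation of [G c], where [c] counts how often each of the [d] axes
   occurs among [T] independent uniform choices. *)
Fixpoint mcount (T : nat) (G : ('I_d -> nat) -> R) : R :=
  if T is T'.+1 then (\sum_(i < d) mcount T' (fun c => G (bump_count c i))) / d%:R
  else G (fun=> 0%N).

Lemma mcount_le T G G' :
  (forall c, (forall i, c i <= T)%N -> G c <= G' c) -> mcount T G <= mcount T G'.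
Proof.
elim: T G G' => [|T IH] G G' GG' /=; first exact: GG'.
rewrite ler_wpM2r ?invr_ge0 ?ler0n // ler_sum // => i _; apply: IH => c cT.
apply: GG' => j; rewrite /bump_count; case: eqP => _; last by rewrite addn0 leqW.
by rewrite addn1 ltnS.
Qed.

Lemma mcount_sum T (I : finType) (G : I -> ('I_d -> nat) -> R) :
  mcount T (fun c => \sum_i G i c) = \sum_i mcount T (G i).
Proof.
elim: T G => [//|T IH] G /=.
by under eq_bigr do rewrite IH; rewrite exchange_big /= mulr_suml.
Qed.

Lemma mcountZ T k G : mcount T (fun c => k * G c) = k * mcount T G.
Proof.
elim: T G => [//|T IH] G /=.
by under eq_bigr do rewrite IH; rewrite -mulr_sumr mulrA.
Qed.

Lemma mcountD T G G' : mcount T (fun c => G c + G' c) = mcount T G + mcount T G'.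
Proof.
elim: T G G' => [//|T IH] G G' /=.
by under eq_bigr do rewrite IH; rewrite big_split /= mulrDl.
Qed.

Lemma mcount_cst T k : mcount T (fun=> k) = k.
Proof.
elim: T => [//|T IH] /=.
under eq_bigr do rewrite IH.
by rewrite sumr_const card_ord -[k *+ _]mulr_natr mulfK.
Qed.

Lemma mcount_pow T i : mcount T (fun c => 2^-1 ^+ c i) = (1 - (2 * d)%:R^-1) ^+ T.
Proof.
elim: T => [|T IH] /=; first by rewrite !expr0.
have H j : mcount T (fun c => 2^-1 ^+ bump_count c j i)
    = (1 - (j == i)%:R / 2) * (1 - (2 * d)%:R^-1) ^+ T.
  rewrite -IH -mcountZ; congr mcount; apply/funext => c.
  rewrite /bump_count exprD mulrC; congr (_ * _).
  by case: eqP => _ /=; rewrite ?expr1 ?expr0; field.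
under eq_bigr do rewrite H.
rewrite -mulr_suml exprS sumrB sumr_const card_ord (bigD1 i) //= eqxx big1.
  by rewrite natrM /=; field.
by move=> j /negbTE ->; rewrite mul0r.
Qed.

(** Chernoff's bound for an axis used fewer than [s] times out of 4 d s, where 4 s is the mean: the
    probability is at most 2^s E(2^(-c)), computed by [mcount_pow]. *)
Lemma two_pow_decay s : 2 ^+ s * (1 - (2 * d)%:R^-1) ^+ (4 * d * s) <= 2^-1 ^+ s :> R.
Proof.
rewrite exprM -exprMn lerXn2r ?nnegrE ?invr_ge0 //.
  by rewrite mulr_ge0 // exprn_ge0 // subr_ge0 invf_le1 ?ltr0n ?ler1n; lia.
suff : (1 - (2 * d)%:R^-1) ^+ (4 * d) <= 4^-1 :> R by lra.
have h : 1 - (2 * d)%:R^-1 <= expR (- (2 * d)%:R^-1) :> R by exact: expR_ge1Dx.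
have : (1 - (2 * d)%:R^-1) ^+ (4 * d) <= expR (- (2 * d)%:R^-1) ^+ (4 * d) :> R.
  rewrite lerXn2r ?nnegrE ?expR_ge0 //.
  by rewrite subr_ge0 invf_le1 ?ltr0n ?ler1n; lia.
move/le_trans; apply; rewrite -expRM_natl.
have -> : (4 * d)%:R * - (2 * d)%:R^-1 = - (1 + 1) :> R by rewrite !natrM; field.
rewrite opprD expRD expRN.
have e2 : 2 <= expR 1 :> R by apply: le_trans (expR_ge1Dx _); lra.
rewrite (_ : 4^-1 = 2^-1 * 2^-1 :> R); last by field.
by apply: ler_pM; rewrite ?invr_ge0 ?expR_ge0 // lef_pV2 ?posrE ?expR_gt0.
Qed.

Definition prod_ker (h : 'I_d -> nat -> int -> R) (c : 'I_d -> nat) v : R :=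
  \prod_(j < d) h j (c j) (v 0 j).

Lemma prod_ker_axis h c v i y :
  (forall j, j != i -> y 0 j = v 0 j) ->
  prod_ker h c y = h i (c i) (y 0 i) * \prod_(j < d | j != i) h j (c j) (v 0 j).
Proof.
move=> yv; rewrite /prod_ker (bigD1 i) //=; congr (_ * _).
by apply: eq_bigr => j ji; rewrite yv.
Qed.

Lemma prod_ker_bump h c v i :
  prod_ker h (bump_count c i) v
    = h i (c i).+1 (v 0 i) * \prod_(j < d | j != i) h j (c j) (v 0 j).
Proof.
rewrite /prod_ker (bigD1 i) //= /bump_count eqxx addn1; congr (_ * _).
by apply: eq_bigr => j ji; rewrite eq_sym (negbTE ji) addn0.
Qed.

Lemma axis_avg_prod_ker h c v i :
  axis_avg i (prod_ker h c) v
    = (2 * h i (c i) (v 0 i) + h i (c i) (v 0 i + 1) + h i (c i) (v 0 i - 1)) / 4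
      * \prod_(j < d | j != i) h j (c j) (v 0 j).
Proof.
rewrite /axis_avg (@prod_ker_axis _ _ v i v) // (@prod_ker_axis _ _ v i (v + _)); last first.
  by move=> j ji; rewrite !mxE eqxx (negbTE ji) addr0.
rewrite (@prod_ker_axis _ _ v i (v - _)); last first.
  by move=> j ji; rewrite !mxE eqxx (negbTE ji) subr0.
by rewrite !mxE !eqxx /=; ring.
Qed.

Lemma axis_avg_mcount i T (G : ('I_d -> nat) -> site -> R) v :
  axis_avg i (fun x => mcount T (fun c => G c x)) v = mcount T (fun c => axis_avg i (G c) v).
Proof.
rewrite /axis_avg mulrC -[in LHS]mcountZ -!mcountD -mcountZ; congr mcount.
by apply/funext => c; rewrite mulrC.
Qed.

Lemma iter_lazy_delta T a v :
  iter T lazy_avg (fun y => (y == a)%:R) v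
    = mcount T (fun c => prod_ker (fun j s z => lazyker R s (z - a 0 j)) c v).
Proof.
elim: T v => [|T IH] v /=.
  rewrite /prod_ker; under eq_bigr do rewrite lazyker0 subr_eq0.
  have [->|va] := eqVneq v a; first by rewrite big1 // => j _; rewrite eqxx.
  have [j vj] : exists j, v 0 j != a 0 j.
    apply/existsP; apply: contra_neqT va => /existsPn H; apply/rowP => j.
    by apply/eqP; have := H j; rewrite negbK.
  by rewrite (bigD1 j) //= (negbTE vj) mul0r.
rewrite (_ : iter T _ _ = fun v => mcount T (fun c =>
  prod_ker (fun j s z => lazyker R s (z - a 0 j)) c v)); last exact/funext.
rewrite lazy_avgE; congr (_ / _); apply: eq_bigr => i _.
rewrite axis_avg_mcount; congr mcount; apply/funext => c.
rewrite axis_avg_prod_ker prod_ker_bump lazykerS; congr (_ / _ * _).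
by congr (_ + lazyker _ _ _ + lazyker _ _ _); ring.
Qed.

(** Unless some axis is used fewer than tau^2 times, each factor is at most 1 / tau. The exception
    costs at most d 2^(-tau^2), and [d <= tau] makes this at most d / tau^d. *)
Lemma lazy_kernel_upper tau a v : (d <= tau)%N ->
  iter (4 * d * tau ^ 2) lazy_avg (fun y => (y == a)%:R) v <= (d%:R + 1) / tau%:R ^+ d.
Proof.
move=> dtau; have tau0 : (0 < tau)%N by exact: leq_trans d_gt0 dtau.
have tau0' : 0 < tau%:R :> R by rewrite ltr0n.
set s0 := (tau ^ 2)%N; set T := (4 * d * s0)%N; rewrite iter_lazy_delta.
set k := lazyker R s0 0; have k0 : 0 <= k := lazyker_ge0 _ _ _.
(* The sum dominates the indicator that some count is below [s0]. *)
have H : mcount T (fun c => prod_ker (fun j s z => lazyker R s (z - a 0 j)) c v)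
   <= mcount T (fun c => k ^+ d + \sum_(j < d) 2 ^+ s0 * 2^-1 ^+ c j).
  apply: mcount_le => c _.
  have sum0 : 0 <= \sum_(j < d) 2 ^+ s0 * 2^-1 ^+ c j :> R.
    by apply: sumr_ge0 => j _; rewrite mulr_ge0 // exprn_ge0 // invr_ge0.
  have [big|/existsP [j]] := boolP [forall j, (s0 <= c j)%N].
    rewrite (@le_trans _ _ (k ^+ d)) ?lerDl //.
    rewrite /prod_ker -[d in leRHS]card_ord -prodr_const ler_prod // => j _.
    rewrite lazyker_ge0 /=; apply: le_trans (lazyker_central_anti R _ _ (forallP big j)).
    by apply: lazyker_anti.
  rewrite -ltnNge => cj.
  rewrite (@le_trans _ _ 1) //.
    rewrite /prod_ker -[leRHS](_ : \prod_(j < d) 1 = 1); last by rewrite big1.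
    by rewrite ler_prod // => l _; rewrite lazyker_ge0 lazyker_le1.
  rewrite (@le_trans _ _ (\sum_(j < d) 2 ^+ s0 * 2^-1 ^+ c j)) ?lerDr ?exprn_ge0 //.
  rewrite (bigD1 j) //= ler_wpDr //.
    by apply: sumr_ge0 => l _; rewrite mulr_ge0 // exprn_ge0 // invr_ge0.
  by rewrite -(subnK (ltnW cj)) exprD exprVn mulfK ?expf_neq0 // exprn_ege1 // ler1n.
apply: le_trans H _; rewrite mcountD mcount_cst mcount_sum.
have -> : \sum_(i < d) mcount T (fun c => 2 ^+ s0 * 2^-1 ^+ c i)
   = d%:R * (2 ^+ s0 * (1 - (2 * d)%:R^-1) ^+ T) :> R.
  under eq_bigr do rewrite mcountZ mcount_pow.
  by rewrite sumr_const card_ord mulr_natl.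
have h1 : k ^+ d <= (tau%:R ^+ d)^-1.
  by rewrite -exprVn ler_pXn2r ?nnegrE ?invr_ge0 ?ler0n // lazyker_sq_upper.
have h2 : 2^-1 ^+ s0 <= (tau%:R ^+ d)^-1 :> R.
  rewrite exprVn lef_pV2 ?posrE ?exprn_gt0 // /s0 -natrX -natrX ler_nat.
  apply: (@leq_trans (tau ^ tau)); first exact: leq_pexp2l.
  by rewrite expnS expn1 expnM leq_exp2r // ltnW // ltn_expl.
have h3 := two_pow_decay s0.
rewrite mulrDl mul1r addrC lerD // ler_wpM2l //.
exact: le_trans h3 h2.
Qed.

Definition in_cube (c : site) (r : nat) (v : site) : bool :=
  [forall i, (`|(v 0 i - c 0 i)%R| <= r)%N].

Definition killed (D : pred site) (A : (site -> R) -> site -> R) f x : R :=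
  if D x then A f x else 0.

(* The method of images: the value at [z] of the kernel from [alpha], minus its
   reflections at the walls [W] and [-W]; a subsolution of the killed equation. *)
Definition image_ker (W : nat) (alpha : int) (s : nat) (z : int) : R :=
  lazyker R s (z - alpha) - lazyker R s (z + alpha - (2 * W)%:Z)
    - lazyker R s (z + alpha + (2 * W)%:Z).

Definition image_kerp W alpha s z : R := Num.max 0 (image_ker W alpha s z).

Lemma image_kerp_ge0 W alpha s z : 0 <= image_kerp W alpha s z.
Proof. by rewrite /image_kerp le_max lexx. Qed.

Lemma image_kerp_sub W alpha s z :
  image_kerp W alpha s.+1 z <=
  (2 * image_kerp W alpha s z + image_kerp W alpha s (z + 1)
    + image_kerp W alpha s (z - 1)) / 4.
Proof.
have -> : image_kerp W alpha s.+1 z = Num.max 0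
  ((2 * image_ker W alpha s z + image_ker W alpha s (z + 1) + image_ker W alpha s (z - 1)) / 4).
  congr Num.max; rewrite /image_ker !lazykerS.
  rewrite (_ : z + 1 - alpha = z - alpha + 1); last by ring.
  rewrite (_ : z - 1 - alpha = z - alpha - 1); last by ring.
  rewrite (_ : z + 1 + alpha - (2 * W)%:Z = z + alpha - (2 * W)%:Z + 1); last by ring.
  rewrite (_ : z - 1 + alpha - (2 * W)%:Z = z + alpha - (2 * W)%:Z - 1); last by ring.
  rewrite (_ : z + 1 + alpha + (2 * W)%:Z = z + alpha + (2 * W)%:Z + 1); last by ring.
  rewrite (_ : z - 1 + alpha + (2 * W)%:Z = z + alpha + (2 * W)%:Z - 1); last by ring.
  by field.
have H (y : int) : 0 <= image_kerp W alpha s y /\ image_ker W alpha s y <= image_kerp W alpha s y.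
  by rewrite /image_kerp !le_max !lexx orbT.
have [h1 h2] := H z; have [h3 h4] := H (z + 1); have [h5 h6] := H (z - 1).
by rewrite ge_max; apply/andP; split; lra.
Qed.

(** Beyond a wall the image there is at least as near as the source, and the kernel decreases with
    distance. With two images only, the difference is nonpositive there rather than zero at the
    wall; the positive part repairs this. *)
Lemma image_kerp_out W alpha s z : (`|alpha| <= W)%N -> (W <= `|z|)%N ->
  image_kerp W alpha s z = 0.
Proof.
move=> aW Wz; apply/eqP; rewrite /image_kerp; apply/eqP/max_idPl.
rewrite /image_ker.
have n1 := lazyker_ge0 R s (z + alpha - (2 * W)%:Z).
have n2 := lazyker_ge0 R s (z + alpha + (2 * W)%:Z).
have [z0|z0] := lerP 0 z.
  have : lazyker R s (z - alpha) <= lazyker R s (z + alpha - (2 * W)%:Z).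
    by apply: lazyker_anti; lia.
  by lra.
have : lazyker R s (z - alpha) <= lazyker R s (z + alpha + (2 * W)%:Z).
  by apply: lazyker_anti; lia.
by lra.
Qed.

(** With k' the central value at time [s]: the source is within 2 w, and (2 w)^2 / s <= 1/4 gives
    3/4 k'; each image is at distance at least W, which gives at most 1/8 k'. What remains is 1/2
    k'. *)
Lemma image_kerp_lower w s t alpha z : (0 < w)%N -> (`|alpha| <= w)%N -> (`|z| <= w)%N ->
  (16 * w ^ 2 <= s)%N -> (s <= t)%N -> (t <= 64 * d * w ^ 2)%N ->
  lazyker R t 0 / 2 <= image_kerp (64 * d * w) alpha s z.
Proof.
move=> w0 aw zw ws st td; rewrite /image_kerp le_max; apply/orP; right.
have s0 : (0 < s)%N by apply: leq_trans ws; rewrite muln_gt0 /= sqrn_gt0.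
have := lazyker_central_anti R _ _ st; have := lazyker_ge0 R t 0.
set k := lazyker R t 0; set k' := lazyker R s 0 => k0 kk'.
have s0' : 0 < s%:R :> R by rewrite ltr0n.
rewrite /image_ker; set W := (64 * d * w)%N.
have near_le : 3 / 4 * k' <= lazyker R s (z - alpha).
  have := lazyker_near R s (2 * w) s0.
  rewrite -/k' => /(le_trans _) H.
  have {}H : 3 / 4 * k' <= lazyker R s (2 * w)%N.
    apply: H; rewrite ler_wpM2r //; first by lra.
    have : (2 * w)%:R ^+ 2 / s%:R <= 4^-1 :> R; last by lra.
    rewrite ler_pdivrMr // mulrC ler_pdivlMr // -natrX -natrM ler_nat.
    by apply: leq_trans ws; rewrite expnMn; lia.
  by apply: le_trans H _; apply: lazyker_anti; lia.
have far_le : lazyker R s W <= 8^-1 * k'.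
  have H := lazyker_far R s W s0; rewrite -/k' in H.
  have q0 := lazyker_ge0 R s W.
  have : 7 <= W%:R ^+ 2 / (s + W)%:R :> R.
    rewrite ler_pdivlMr ?ltr0n ?addn_gt0 ?s0 // -natrX -natrM ler_nat.
    have h1 : (s + W <= 128 * d * w ^ 2)%N.
      have : (64 * d * w <= 64 * d * w ^ 2)%N by rewrite leq_mul2l; nia.
      by rewrite /W; lia.
    have h2 : (d * w ^ 2 <= d ^ 2 * w ^ 2)%N.
      by rewrite leq_mul2r -{1}(expn1 d) leq_pexp2l ?orbT.
    by rewrite /W !expnMn; lia.
  set m := W%:R ^+ 2 / _ in H * => m7; nra.
have W2 : (2 * w <= W)%N by rewrite /W; nia.
have i1 : lazyker R s (z + alpha - (2 * W)%:Z) <= lazyker R s W by apply: lazyker_anti; lia.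
have i2 : lazyker R s (z + alpha + (2 * W)%:Z) <= lazyker R s W by apply: lazyker_anti; lia.
lra.
Qed.

(** The time is 4 d times 16 w^2, so by Chernoff's bound every axis is used at least 16 w^2 times
    with probability at least 1/2; then [image_kerp_lower] applies to each factor. *)
Lemma confined_lower (D : pred site) w c a v : (d <= w)%N ->
  (forall y, in_cube c (64 * d * w) y -> D y) -> in_cube c w a -> in_cube c w v ->
  2^-1 * (32 * d%:R * w%:R)^-1 ^+ d
    <= iter (64 * d * w ^ 2) (killed D lazy_avg) (fun y => (y == a)%:R) v.
Proof.
move=> dw bD /forallP ca /forallP cv; have w0 : (0 < w)%N by exact: leq_trans dw.
set T := (64 * d * w ^ 2)%N; set W := (64 * d * w)%N.
pose h j s z := image_kerp W (a 0 j - c 0 j) s (z - c 0 j).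
have h0 j s z : 0 <= h j s z by exact: image_kerp_ge0.
have wW : (w <= W)%N by rewrite /W; nia.
(* Comparison principle: a mixture of products of one-dimensional subsolutions, vanishing off the
   large cube, stays below the killed kernel. *)
have step : forall t y, mcount t (fun k => prod_ker h k y)
     <= iter t (killed D lazy_avg) (fun y => (y == a)%:R) y.
  elim=> [|t IH] y /=.
    have [->|ya] := eqVneq y a.
      rewrite /prod_ker -[leRHS](_ : \prod_(j < d) 1 = 1); last by rewrite big1.
      apply: ler_prod => j _; rewrite h0 /h /image_kerp ge_max ler01 /= /image_ker.
      have := lazyker_le1 R 0 (a 0 j - c 0 j - (a 0 j - c 0 j)).
      have := lazyker_ge0 R 0 (a 0 j - c 0 j + (a 0 j - c 0 j) - (2 * W)%:Z).
      have := lazyker_ge0 R 0 (a 0 j - c 0 j + (a 0 j - c 0 j) + (2 * W)%:Z).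
      lra.
    have [j yj] : exists j, y 0 j != a 0 j.
      apply/existsP; apply: contra_neqT ya => /existsPn H; apply/rowP => j.
      by apply/eqP; have := H j; rewrite negbK.
    rewrite /prod_ker (bigD1 j) //= (_ : h j 0%N (y 0 j) = 0) ?mul0r //.
    apply/max_idPl; rewrite /image_ker !lazyker0 subr_eq0.
    rewrite (_ : (y 0 j - c 0 j == a 0 j - c 0 j) = false).
      have := ler0n R (y 0 j - c 0 j + (a 0 j - c 0 j) - (2 * W)%:Z == 0).
      have := ler0n R (y 0 j - c 0 j + (a 0 j - c 0 j) + (2 * W)%:Z == 0).
      by rewrite /=; lra.
    by apply/eqP; move/eqP: yj; lia.
  rewrite /killed; case: ifPn => Dy; last first.
    have /forallPn[j jW] : ~~ in_cube c W y by apply: contra Dy => /bD.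
    have H0 k : prod_ker h k y = 0.
      rewrite /prod_ker (bigD1 j) //= /h image_kerp_out ?mul0r //.
        by apply: leq_trans (ca j) wW.
      by rewrite -ltnNge in jW; exact: ltnW.
    under eq_bigr => i _.
      rewrite (_ : (fun c0 => _) = fun=> 0); last by apply/funext => k; exact: H0.
      rewrite mcount_cst; over.
    by rewrite big1 ?mul0r.
  apply: (@le_trans _ _ (lazy_avg (fun y => mcount t (fun k => prod_ker h k y)) y)); last first.
    exact: lazy_avg_le.
  rewrite [leRHS]lazy_avgE ler_wpM2r ?invr_ge0 ?ler0n // ler_sum // => i _.
  rewrite axis_avg_mcount; apply: mcount_le => k _.
  rewrite axis_avg_prod_ker prod_ker_bump ler_wpM2r ?prodr_ge0 // /h.
  have -> : y 0 i + 1 - c 0 i = y 0 i - c 0 i + 1 by ring.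
  have -> : y 0 i - 1 - c 0 i = y 0 i - c 0 i - 1 by ring.
  exact: image_kerp_sub.
apply: le_trans (step T v).
set B := lazyker R T 0 / 2; set s0 := (16 * w ^ 2)%N.
have B0 : 0 <= B by rewrite divr_ge0 ?lazyker_ge0.
have BE : (32 * d%:R * w%:R)^-1 <= B.
  have := @lazyker_sq_lower R T (8 * d * w); rewrite !muln_gt0 d_gt0 w0 => /(_ isT).
  have TE : (T <= (8 * d * w) ^ 2)%N.
    have : (d * w ^ 2 <= d ^ 2 * w ^ 2)%N.
      by rewrite leq_mul2r -{1}(expn1 d) leq_pexp2l ?orbT.
    by rewrite /T !expnMn; lia.
  move/(_ TE); rewrite /B => H.
  rewrite (_ : _^-1 = (2 * (8 * d * w)%:R)^-1 / 2); first by rewrite ler_wpM2r.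
  by rewrite !natrM -invfM; congr (_^-1); ring.
have H : mcount T (fun k => B ^+ d * (1 - \sum_(j < d) 2 ^+ s0 * 2^-1 ^+ k j))
   <= mcount T (fun k => prod_ker h k v).
  apply: mcount_le => k kT.
  have t0 j : 0 <= 2 ^+ s0 * 2^-1 ^+ k j :> R by rewrite mulr_ge0 // exprn_ge0 // invr_ge0.
  have sum0 : 0 <= \sum_(j < d) 2 ^+ s0 * 2^-1 ^+ k j :> R by apply: sumr_ge0.
  have [big|/existsP [j]] := boolP [forall j, (s0 <= k j)%N].
    apply: (@le_trans _ _ (B ^+ d)).
      by rewrite -[leRHS]mulr1 ler_wpM2l ?exprn_ge0 // gerBl.
    rewrite /prod_ker -[d in leLHS]card_ord -prodr_const ler_prod // => j _.
    rewrite B0 /= /h image_kerp_lower //.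
    exact: (forallP big j).
  rewrite -ltnNge => kj; rewrite (@le_trans _ _ 0) //; last by rewrite prodr_ge0.
  rewrite mulr_ge0_le0 ?exprn_ge0 // subr_le0 (bigD1 j) //= ler_wpDr //.
    by apply: sumr_ge0.
  by rewrite -(subnK (ltnW kj)) exprD exprVn mulfK ?expf_neq0 // exprn_ege1 // ler1n.
apply: le_trans H; rewrite mcountZ.
rewrite (_ : (fun k => _) = fun k => 1 + (-1) * \sum_(j < d) 2 ^+ s0 * 2^-1 ^+ k j); last first.
  by apply/funext => k; rewrite mulN1r.
rewrite mcountD mcount_cst mcountZ mcount_sum mulN1r.
have -> : \sum_(i < d) mcount T (fun c => 2 ^+ s0 * 2^-1 ^+ c i)
   = d%:R * (2 ^+ s0 * (1 - (2 * d)%:R^-1) ^+ T) :> R.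
  under eq_bigr do rewrite mcountZ mcount_pow.
  by rewrite sumr_const card_ord mulr_natl.
have h3 := two_pow_decay s0; rewrite (_ : (4 * d * s0)%N = T) in h3; last by rewrite /T /s0; lia.
have h4 : d%:R * 2^-1 ^+ s0 <= 2^-1 :> R.
  rewrite exprVn ler_pdivrMr ?exprn_gt0 // mulrC ler_pdivlMr // -natrX -natrM ler_nat mulnC.
  apply: (@leq_trans (2 ^ d.+1)); first by rewrite expnS leq_mul2l /= ltnW // ltn_expl.
  by rewrite leq_exp2l // /s0; nia.
rewrite mulrC ler_pM // ?exprn_ge0 ?invr_ge0 ?mulr_ge0 //.
  by rewrite ler_pXn2r ?nnegrE ?invr_ge0 ?mulr_ge0.
have : d%:R * (2 ^+ s0 * (1 - (2 * d)%:R^-1) ^+ T) <= d%:R * 2^-1 ^+ s0 :> R by rewrite ler_wpM2l.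
by lra.
Qed.

End Lattice.

Arguments rw_avg {R d}.
Arguments lazy_avg {R d}.
Arguments axis_avg {R d}.
Arguments killed {R d}.
Arguments in_cube {d}.

(** * Cubes as duplicate-free lists *)

Section Cube.
Variable d : nat.
Notation site := 'rV[int]_d.
Implicit Types (a v c : site).

Definition cube c (r : nat) : seq site :=
  codom (fun t : {ffun 'I_d -> 'I_(2 * r).+1} => \row_i ((t i)%:Z - r%:Z + c 0 i)).

Lemma cube_uniq c r : uniq (cube c r).
Proof.
rewrite /cube /codom /image_mem map_inj_uniq ?enum_uniq // => s t /rowP st.
by apply/ffunP => i; apply/val_inj; have := st i; rewrite !mxE => /addIr/addIr [].
Qed.

Lemma mem_cube c r v : (v \in cube c r) = in_cube c r v.
Proof.
apply/codomP/forallP => [[t ->] i|H].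
  by rewrite mxE addrK; case: (t i) => m /=; lia.
exists [ffun i => inord (absz (v 0 i - c 0 i + r%:Z))]; apply/rowP => i.
have := H i; rewrite mxE ffunE; move: (v 0 i) (c 0 i) => p q h.
by rewrite inordK; lia.
Qed.

Lemma size_cube c r : size (cube c r) = ((2 * r).+1 ^ d)%N.
Proof. by rewrite size_codom card_ffun !card_ord. Qed.

Lemma in_cube_center c r : in_cube c r c.
Proof. by apply/forallP => i; rewrite subrr. Qed.

Lemma in_cube_trans c a v r s t : (r + s <= t)%N ->
  in_cube c r a -> in_cube a s v -> in_cube c t v.
Proof.
move=> rst /forallP ca /forallP av; apply/forallP => i.
by have := ca i; have := av i; lia.
Qed.

Lemma in_cube_le c v r s : (r <= s)%N -> in_cube c r v -> in_cube c s v.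
Proof. by move=> rs /forallP H; apply/forallP => i; apply: leq_trans (H i) rs. Qed.

End Cube.

Arguments cube {d}.

(** * Survival probabilities and their Harnack inequality *)

Section Survival.
Variables (R : realType) (d : nat).
Hypothesis d_gt0 : (0 < d)%N.
Notation site := 'rV[int]_d.
Implicit Types (f g : site -> R) (x y a v c : site) (D U : pred site).

Let d_neq0 : d%:R != 0 :> R.
Proof. by rewrite pnatr_eq0 -lt0n. Qed.

Lemma rw_avg_ge0 f x : (forall y, 0 <= f y) -> 0 <= rw_avg f x.
Proof. by move=> f0; rewrite /rw_avg divr_ge0 ?ler0n // sumr_ge0. Qed.

Section IterAvg.
Variable A : (site -> R) -> site -> R.
Hypothesis A_le : forall f g x, (forall y, f y <= g y) -> A f x <= A g x.
Hypothesis AD : forall f g x, A (fun y => f y + g y) x = A f x + A g x.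
Hypothesis AZ : forall k f x, A (fun y => k * f y) x = k * A f x.

Lemma iter_avg_le n f g x : (forall y, f y <= g y) -> iter n A f x <= iter n A g x.
Proof. by move=> fg; elim: n x => [|n IH] x /=; [exact: fg | exact: A_le]. Qed.

Lemma iter_avgD n f g x : iter n A (fun y => f y + g y) x = iter n A f x + iter n A g x.
Proof.
elim: n x => [//|n IH] x /=; rewrite -AD; congr (A _ x); exact/funext.
Qed.

Lemma iter_avgZ n k f x : iter n A (fun y => k * f y) x = k * iter n A f x.
Proof.
elim: n x => [//|n IH] x /=; rewrite -AZ; congr (A _ x); exact/funext.
Qed.

Lemma iter_avg_sum n (s : seq site) (F : site -> site -> R) x :
  iter n A (fun y => \sum_(v <- s) F v y) x = \sum_(v <- s) iter n A (F v) x.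
Proof.
elim: s => [|v s IH].
  rewrite big_nil -[RHS](mul0r (iter n A (fun=> 0) x)) -iter_avgZ.
  by congr (iter n A _ x); apply/funext => y; rewrite big_nil mul0r.
rewrite big_cons -IH -iter_avgD; congr (iter n A _ x).
by apply/funext => y; rewrite big_cons.
Qed.

Lemma iter_avg_ge0 n f x : (forall y, 0 <= f y) -> 0 <= iter n A f x.
Proof.
move=> f0; rewrite -(mul0r (iter n A (fun=> 0) x)) -iter_avgZ.
by apply: iter_avg_le => y; rewrite mul0r.
Qed.

Lemma sum_delta (s : seq site) f y : uniq s ->
  \sum_(v <- s) f v * (y == v)%:R = if y \in s then f y else 0.
Proof.
move=> us; case: ifPn => ys.
  rewrite (bigD1_seq y) //= eqxx mulr1 big1 ?addr0 // => v vy.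
  by rewrite eq_sym (negbTE vy) mulr0.
rewrite big_seq big1 // => v vs; case: eqP => [e|_]; last by rewrite mulr0.
by rewrite e vs in ys.
Qed.

End IterAvg.

Section Killed.
Variables (D : pred site) (A : (site -> R) -> site -> R).
Hypothesis A_le : forall f g x, (forall y, f y <= g y) -> A f x <= A g x.
Hypothesis AD : forall f g x, A (fun y => f y + g y) x = A f x + A g x.
Hypothesis AZ : forall k f x, A (fun y => k * f y) x = k * A f x.

Lemma killed_mono f g x : (forall y, f y <= g y) -> killed D A f x <= killed D A g x.
Proof. by move=> fg; rewrite /killed; case: ifP => // _; exact: A_le. Qed.

Lemma killedD f g x : killed D A (fun y => f y + g y) x = killed D A f x + killed D A g x.
Proof. by rewrite /killed; case: ifP => _; rewrite ?AD ?addr0. Qed.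

Lemma killedZ k f x : killed D A (fun y => k * f y) x = k * killed D A f x.
Proof. by rewrite /killed; case: ifP => _; rewrite ?AZ ?mulr0. Qed.
End Killed.

Variable U : pred site.

Definition surv (k : nat) : site -> R := iter k (killed U rw_avg) (fun x => (U x)%:R).

Lemma survS k x : surv k.+1 x = if U x then rw_avg (surv k) x else 0.
Proof. by []. Qed.

Lemma surv_out k x : ~~ U x -> surv k x = 0.
Proof. by case: k => [|k] /negbTE Ux; rewrite ?survS ?Ux // /surv /= Ux. Qed.

Lemma surv_ge0 k x : 0 <= surv k x.
Proof.
apply: iter_avg_ge0 => [f g y|j f y|y]; last exact: ler0n.
  by apply: killed_mono => *; exact: rw_avg_le.
by apply: killedZ => *; exact: rw_avgZ.
Qed.

Lemma surv_decr k x : surv k.+1 x <= surv k x.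
Proof.
elim: k x => [|k IH] x.
  rewrite survS /surv /=; case: (U x) => //.
  rewrite -[leRHS](rw_avg_cst R d d_gt0 1 x); apply: rw_avg_le => y.
  by rewrite /=; case: (U y).
by rewrite survS [leRHS]survS; case: (U x) => //; exact: rw_avg_le.
Qed.

Lemma surv_anti k m x : surv (k + m) x <= surv k x.
Proof.
elim: m => [|m IH]; first by rewrite addn0.
by rewrite addnS; apply: le_trans (surv_decr _ _) IH.
Qed.

(** Survival is a subsolution for the lazy walk too: staying put wastes a unit of time, and
    surviving a shorter time is likelier. *)
Lemma surv_lazy k x : surv k.+1 x <= lazy_avg (surv k) x.
Proof.
have := surv_decr k x; rewrite /lazy_avg !survS.
case: ifP => _ H; first by lra.
by rewrite divr_ge0 // addr_ge0 ?surv_ge0 // rw_avg_ge0 // => y; exact: surv_ge0.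
Qed.

Lemma killed_lazy_surv k :
  killed U lazy_avg (surv k) = fun x => 2^-1 * surv k x + 2^-1 * surv k.+1 x.
Proof.
apply/funext => x; rewrite /killed survS; case: ifPn => Ux.
  by rewrite /lazy_avg; field.
by rewrite surv_out // !mulr0 addr0.
Qed.

Let L_le f g x : (forall y, f y <= g y) -> killed U lazy_avg f x <= killed U lazy_avg g x.
Proof. by move=> fg; apply: killed_mono => // *; exact: lazy_avg_le. Qed.

Let LD f g x : killed U lazy_avg (fun y => f y + g y) x
  = killed U lazy_avg f x + killed U lazy_avg g x.
Proof. by apply: killedD => *; exact: lazy_avgD. Qed.

Let LZ k f x : killed U lazy_avg (fun y => k * f y) x = k * killed U lazy_avg f x.
Proof. by apply: killedZ => *; exact: lazy_avgZ. Qed.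

Lemma lazy_surv_le T j x : iter T (killed U lazy_avg) (surv j) x <= surv j x.
Proof.
elim: T => [//|T IH]; rewrite iterSr killed_lazy_surv; apply: le_trans IH.
by apply: iter_avg_le => // y; have := surv_decr j y; lra.
Qed.

(* The lazy walk run for time [T] makes [T/2] moves on average, so up to an
   exponentially small error it is ahead of the walk run for time [s]. *)
Lemma lazy_surv_shift T j s x :
  iter T (killed U lazy_avg) (surv j) x
    <= surv (j + s) x + 2 ^+ s * (3 / 4) ^+ T * surv j x.
Proof.
elim: T j s x => [|T IH] j s x.
  rewrite /= expr0 mulr1 -[leLHS]mul1r ler_wpDl ?surv_ge0 //.
  by rewrite ler_wpM2r ?surv_ge0 // exprn_ege1 // ler1n.
rewrite iterSr killed_lazy_surv iter_avgD // !iter_avgZ //.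
have uj := surv_ge0 j x; have ujd := surv_decr j x.
case: s => [|s].
  have := IH j 0%N x; have := IH j.+1 0%N x; rewrite !addn0 !expr0 !mul1r.
  have p0 : 0 <= (3 / 4) ^+ T :> R by rewrite exprn_ge0.
  rewrite [(3 / 4) ^+ T.+1]exprS; set p := (3 / 4) ^+ T in p0 *.
  set a := iter _ _ _ _; set b := iter _ _ _ _; move: uj ujd.
  have := lazy_surv_le T j x; have := lazy_surv_le T j.+1 x; rewrite -/a -/b.
  set u := surv j x; set u' := surv j.+1 x => h1 h2 h3 h4 h5 h6.
  have : 0 <= p * u by rewrite mulr_ge0.
  by lra.
have h1 := IH j s.+1 x; have := IH j.+1 s x; rewrite addSnnS => h2.
rewrite [(3 / 4) ^+ T.+1]exprS.
have e2 : 2 ^+ s.+1 = 2 * 2 ^+ s :> R by rewrite exprS.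
rewrite e2 in h1 *.
have p0 : 0 <= 2 ^+ s * (3 / 4) ^+ T :> R by rewrite mulr_ge0 ?exprn_ge0.
set p := 2 ^+ s in h1 h2 p0 *; set q := (3 / 4) ^+ T in h1 h2 p0 *.
have : p * q * surv j.+1 x <= p * q * surv j x by rewrite ler_wpM2l.
by lra.
Qed.

(** The right side is half the lower bound of [confined_lower], so that the error can be absorbed
    there. *)
Lemma shift_error_small w s : (d <= w)%N -> (s <= w ^ 2)%N ->
  2 ^+ s * (3 / 4) ^+ (64 * d * w ^ 2) <= 4^-1 * (32 * d%:R * w%:R)^-1 ^+ d :> R.
Proof.
move=> dw sw; have w0 : (0 < w)%N by exact: leq_trans dw.
have h1 : 2 ^+ s <= 2 ^+ (d * w ^ 2) :> R.
  by rewrite ler_weXn2l ?ler1n // (leq_trans sw) // leq_pmull.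
(* Three factors 3/4 are at most one factor 1/2, and 64 >= 3 * 21; one of the 21 pays for
   [2 ^+ s]. *)
have h2 : (3 / 4) ^+ (64 * d * w ^ 2) <= 2^-1 ^+ (21 * (d * w ^ 2)) :> R.
  apply: (@le_trans _ _ ((3 / 4) ^+ (3 * (21 * (d * w ^ 2))))).
    by rewrite ler_wiXn2l //; [lra | nia].
  by rewrite exprM lerXn2r ?nnegrE //; lra.
apply: (le_trans (ler_pM _ _ h1 h2)); rewrite ?exprn_ge0 //.
have -> : 4^-1 * (32 * d%:R * w%:R)^-1 ^+ d = ((4 * (32 * d * w) ^ d)%N%:R)^-1 :> R.
  by rewrite exprVn natrM natrX !natrM [RHS]invfM.
rewrite [2^-1 ^+ _]exprM exprVn -exprMn.
rewrite (_ : (2 * (2 ^+ 21)^-1) = (2 ^+ 20)^-1 :> R); last first.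
  by rewrite [in LHS]exprS invfM mulrA divff ?mul1r // pnatr_eq0.
rewrite exprVn lef_pV2 ?posrE ?exprn_gt0 // ?ltr0n ?muln_gt0 ?expn_gt0 ?muln_gt0 ?d_gt0 ?w0 //.
rewrite -!natrX ler_nat -expnM.
apply: (@leq_trans ((128 * w ^ 2) ^ d)).
  apply: (@leq_trans (4 ^ d * (32 * d * w) ^ d)).
    by rewrite leq_mul2r; apply/orP; right; rewrite -{1}(expn1 4) leq_pexp2l.
  by rewrite -expnMn leq_exp2r //; nia.
rewrite mulnCA [(d * _)%N]mulnC [(2 ^ _)%N]expnM leq_exp2r //.
apply: (@leq_trans (2 ^ (7 + 2 * w))).
  by rewrite expnD leq_mul2l /= mulnC expnM leq_exp2r // ltnW // ltn_expl.
by rewrite leq_exp2l //; nia.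
Qed.

(** The lazy walk from [a] reaches each [v] with probability at least 1/2 K^(-d) and then survives
    for time [j]. By then it has made [s] genuine moves up to an error 1/4 K^(-d), so the right side
    can be taken at the later time [j + s]. *)
Lemma sum_surv_le w c a j s : (d <= w)%N ->
  (forall y, in_cube c (64 * d * w) y -> U y) -> in_cube c w a -> (s <= w ^ 2)%N ->
  \sum_(v <- cube c w) surv j v <= 4 * (32 * d%:R * w%:R) ^+ d * surv (j + s) a.
Proof.
move=> dw cU ca sw; have w0 : (0 < w)%N by exact: leq_trans dw.
set T := (64 * d * w ^ 2)%N.
set K := 32 * d%:R * w%:R; have K0 : 0 < K ^+ d :> R.
  by rewrite exprn_gt0 // !mulr_gt0 // ltr0n.
set S0 := \sum_(_ <- _) _.
have h1 : 2^-1 * K^-1 ^+ d * S0 <= iter T (killed U lazy_avg) (surv j) a.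
  apply: (@le_trans _ _ (iter T (killed U lazy_avg)
      (fun y => \sum_(v <- cube c w) surv j v * (y == v)%:R) a)).
    rewrite iter_avg_sum // mulr_sumr big_seq [leRHS]big_seq ler_sum // => v.
    rewrite mem_cube => cv; rewrite iter_avgZ // mulrC ler_wpM2l ?surv_ge0 //.
    by apply: (confined_lower R d d_gt0 U w c v a).
  apply: iter_avg_le => // y; rewrite sum_delta ?cube_uniq //.
  by case: ifP => _; rewrite ?surv_ge0.
have h2 := lazy_surv_shift T j s a.
have h3 := shift_error_small w s dw sw; rewrite -/T -/K in h3.
have aS : surv j a <= S0.
  rewrite /S0 (bigD1_seq a) ?cube_uniq ?mem_cube //= lerDl sumr_ge0 // => *.
  exact: surv_ge0.
have h4 : 2 ^+ s * (3 / 4) ^+ T * surv j a <= 4^-1 * K^-1 ^+ d * S0.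
  by apply: ler_pM; rewrite ?surv_ge0 ?mulr_ge0 ?exprn_ge0.
have h5 : 4^-1 * K^-1 ^+ d * S0 <= surv (j + s) a by lra.
rewrite -ler_pdivrMl; last by rewrite mulr_gt0.
by rewrite invfM -exprVn.
Qed.

Definition sqdist x y : R := \sum_(i < d) ((y 0 i - x 0 i)%:~R) ^+ 2.

Lemma lazy_avg_sqdist x y : lazy_avg (sqdist x) y = sqdist x y + 2^-1.
Proof.
rewrite lazy_avgE //.
have H i : axis_avg i (sqdist x) y = sqdist x y + 2^-1.
  have E (z : site) : (forall j, j != i -> z 0 j = y 0 j) ->
      sqdist x z = ((z 0 i - x 0 i)%:~R) ^+ 2
        + \sum_(j < d | j != i) ((y 0 j - x 0 j)%:~R) ^+ 2.
    move=> zy; rewrite /sqdist (bigD1 i) //=; congr (_ + _).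
    by apply: eq_bigr => j ji; rewrite zy.
  rewrite /axis_avg (E y) // (E (y + _)); last first.
    by move=> j ji; rewrite !mxE eqxx (negbTE ji) addr0.
  rewrite (E (y - _)); last first.
    by move=> j ji; rewrite !mxE eqxx (negbTE ji) subr0.
  rewrite !mxE !eqxx /= !(intrD, intrB, rmorphN) /=.
  by field.
under eq_bigr do rewrite H.
by rewrite sumr_const card_ord -[_ *+ d]mulr_natr mulfK.
Qed.

Lemma lazy_avg_le_loc f g x : f x <= g x ->
  (forall s, f (x + step_vec s) <= g (x + step_vec s)) -> lazy_avg f x <= lazy_avg g x.
Proof.
move=> fg0 fg; rewrite /lazy_avg ler_wpM2r ?invr_ge0 ?ler0n //.
by rewrite lerD // /rw_avg ler_wpM2r ?invr_ge0 ?ler0n // ler_sum.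
Qed.

Lemma sqdist_ge0 x y : 0 <= sqdist x y.
Proof. by apply: sumr_ge0 => i _; exact: sqr_ge0. Qed.

Lemma step_vec_coord (s : 'I_d * bool) i : (`|(step_vec s 0%R i)%R| <= 1)%N.
Proof. by case: s => j []; rewrite /step_vec /= !mxE eqxx; case: eqP. Qed.

(** Survival is compared with the free lazy evolution of its restriction to the cube plus a
    quadratic term paying for what enters through the faces. *)
Lemma mean_value_step tau x j M : (d <= tau)%N -> 0 <= M ->
  (forall y, in_cube x (4 * d * tau) y -> surv j y <= M) ->
  surv (j + 4 * d * tau ^ 2) x
    <= (d%:R + 1) / tau%:R ^+ d * \sum_(v <- cube x (4 * d * tau)) surv j v + M / 4.
Proof.
move=> dtau M0 uM; have tau0 : (0 < tau)%N by exact: leq_trans dtau.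
set g := (4 * d * tau)%N; set t := (4 * d * tau ^ 2)%N.
have g0 : 0 < g%:R ^+ 2 :> R by rewrite exprn_gt0 // ltr0n !muln_gt0 d_gt0.
pose f0 y := if y \in cube x g then surv j y else 0.
have f00 y : 0 <= f0 y by rewrite /f0; case: ifP => _; rewrite ?surv_ge0.
have Lle f h y : (forall z, f z <= h z) -> lazy_avg f y <= lazy_avg h y.
  by move=> ?; exact: lazy_avg_le.
have LaD : forall f h y, lazy_avg (fun z => f z + h z) y = lazy_avg f y + lazy_avg h y.
  by move=> *; exact: lazy_avgD.
have LaZ : forall k f y, lazy_avg (fun z => k * f z) y = k * lazy_avg f y.
  by move=> *; exact: lazy_avgZ.
(* On a face the quadratic term is at least M. Inside, a lazy step adds 1/2 to [sqdist], less than
   the 1 by which [r] grows. *)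
have step r : forall y, in_cube x g y ->
    surv (j + r) y <= iter r lazy_avg f0 y + M / g%:R ^+ 2 * (sqdist x y + r%:R).
  elim: r => [|r IH] y xy.
    by rewrite addn0 /= /f0 mem_cube xy addr0 lerDl mulr_ge0 ?divr_ge0 ?sqdist_ge0 // ltW.
  have [/forallP inside|/existsP[i yi]] :=
      boolP [forall i, (`|(y 0 i - x 0 i)%R| < g)%N]; last first.
    have h1 : surv (j + r.+1) y <= M by apply: le_trans (surv_anti _ _ _) (uM _ xy).
    have h2 : g%:R ^+ 2 <= sqdist x y.
      rewrite /sqdist (bigD1 i) //= ler_wpDr ?sumr_ge0 // => [*|]; first exact: sqr_ge0.
      rewrite -leqNgt in yi.
      by rewrite -[leRHS]real_normK ?num_real // ler_pXn2r ?nnegrE // -intr_norm -abszE ler_nat.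
    apply: le_trans h1 _; rewrite ler_wpDl ?iter_avg_ge0 //.
    rewrite mulrAC ler_pdivlMr // ler_wpM2l // (le_trans h2) // lerDl //.
  rewrite addnS; apply: le_trans (surv_lazy _ _) _.
  apply: (@le_trans _ _ (lazy_avg (fun z => iter r lazy_avg f0 z
      + (M / g%:R ^+ 2 * sqdist x z + M / g%:R ^+ 2 * r%:R)) y)).
    apply: lazy_avg_le_loc => [|s]; rewrite -mulrDr; apply: IH => //.
    apply/forallP => i; have := inside i; have := step_vec_coord s i.
    by rewrite mxE; move: (y 0 i) (x 0 i) (step_vec s 0 i) => p q z; lia.
  rewrite LaD [X in _ + X]LaD LaZ lazy_avg_cst // lazy_avg_sqdist /= lerD2l -[r.+1%:R]natr1.
  have : 0 <= M / g%:R ^+ 2 by rewrite divr_ge0 // ltW.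
  by lra.
have := step t x (in_cube_center _ _ _); move/le_trans; apply.
have -> : sqdist x x = 0 by rewrite /sqdist big1 // => i _; rewrite subrr expr0n.
rewrite add0r lerD //.
  apply: (@le_trans _ _ (iter t lazy_avg (fun y => \sum_(v <- cube x g) surv j v * (y == v)%:R) x)).
    by apply: iter_avg_le => // y; rewrite sum_delta ?cube_uniq.
  rewrite iter_avg_sum // mulr_sumr ler_sum // => v _.
  by rewrite iter_avgZ // mulrC ler_wpM2r ?surv_ge0 // lazy_kernel_upper.
(* Here t / g^2 = 1 / (4 d), at most 1/4. *)
rewrite mulrAC -mulrA ler_wpM2l // ler_pdivrMr // -ler_pdivrMl ?invr_gt0 // invrK.
by rewrite -natrX -natrM ler_nat /t /g; nia.
Qed.

Lemma sum_surv_subset (s1 s2 : seq site) j : uniq s1 -> uniq s2 -> {subset s1 <= s2} ->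
  \sum_(v <- s1) surv j v <= \sum_(v <- s2) surv j v.
Proof.
move=> u1 u2 s12; rewrite [leRHS](bigID (mem s1)) /=.
have -> : \sum_(v <- s1) surv j v = \sum_(v <- s2 | v \in s1) surv j v.
  rewrite -[RHS]big_filter; apply: perm_big; apply: uniq_perm => // [|v].
    exact: filter_uniq.
  by rewrite mem_filter; case: (boolP (v \in s1)) => //= /s12.
by rewrite lerDl sumr_ge0 // => *; exact: surv_ge0.
Qed.

(** Each use of [mean_value_step] gives up a layer of thickness 4 d tau and divides the a priori
    bound by 4; M -> C + M / 4 stays below 2 C + 4^(-m). *)
Lemma mean_value_iter tau w J c j : (d <= tau)%N -> (J * (4 * d * tau) <= w)%N ->
  forall m, (m <= J)%N -> forall x, in_cube c (w + (J - m) * (4 * d * tau)) x ->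
  surv (j + m * (4 * d * tau ^ 2)) x
    <= (2 * ((d%:R + 1) / tau%:R ^+ d) + 4^-1 ^+ m) * \sum_(v <- cube c (2 * w)) surv j v.
Proof.
move=> dtau Jw; set g := (4 * d * tau)%N; set t := (4 * d * tau ^ 2)%N.
set C := (d%:R + 1) / tau%:R ^+ d; set S0 := \sum_(_ <- _) _.
have C0 : 0 <= C by rewrite divr_ge0 ?exprn_ge0 ?addr_ge0.
have S00 : 0 <= S0 by apply: sumr_ge0 => *; exact: surv_ge0.
elim=> [|m IH] mJ x cx.
  rewrite addn0 expr0 (@le_trans _ _ (1 * S0)) //; last first.
    by rewrite ler_wpM2r //; lra.
  rewrite mul1r /S0 (bigD1_seq x) ?cube_uniq ?mem_cube //=.
    by rewrite lerDl sumr_ge0 // => *; exact: surv_ge0.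
  by apply: in_cube_le cx; rewrite subn0 -/g; lia.
have sub y : in_cube x g y -> in_cube c (w + (J - m) * g) y.
  apply: in_cube_trans cx; rewrite (_ : J - m = (J - m.+1).+1)%N; last by lia.
  by rewrite mulSn; lia.
rewrite (_ : j + m.+1 * t = j + m * t + t)%N; last by lia.
set M := (2 * C + 4^-1 ^+ m) * S0.
have M0 : 0 <= M by rewrite mulr_ge0 // addr_ge0 ?mulr_ge0 ?exprn_ge0.
apply: le_trans (mean_value_step tau x _ M dtau M0 _) _.
  by move=> y xy; apply: IH (sub _ xy); exact: ltnW.
have h1 : \sum_(v <- cube x g) surv (j + m * t) v <= S0.
  apply: (@le_trans _ _ (\sum_(v <- cube x g) surv j v)).
    by apply: ler_sum => v _; exact: surv_anti.
  apply: sum_surv_subset; rewrite ?cube_uniq // => y; rewrite !mem_cube => /sub.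
  by apply: in_cube_le; have : ((J - m) * g <= J * g)%N; [rewrite leq_mul2r leq_subr orbT | lia].
have h2 : C * \sum_(v <- cube x g) surv (j + m * t) v <= C * S0 by rewrite ler_wpM2l.
rewrite /M exprS.
have : 0 <= C * S0 by rewrite mulr_ge0.
by rewrite -/C; set P := _ ^+ m; lra.
Qed.

(** The product of (2 (d + 1) + 1) / tau^d from the mean value bound and 4 (64 d w)^d from
    [sum_surv_le] on the doubled cube, with w = 4 d J tau. It is of order J^d, and [J] will be b. *)
Definition harnack_cst (J : nat) : R := (2 * d%:R + 3) * (4 * (256 * d%:R ^+ 2 * J%:R) ^+ d).

(** Both sides are compared with the total survival at time [k - s]: above at [x], below at [a].
    [tau ^ d <= 4 ^ J] makes the iteration error at most 1 / tau^d. *)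
Lemma harnack tau w J c k x a : (d <= tau)%N -> w = (J * (4 * d * tau))%N -> (0 < J)%N ->
  (tau ^ d <= 4 ^ J)%N -> (forall y, in_cube c (128 * d * w) y -> U y) ->
  in_cube c w x -> in_cube c w a -> (w ^ 2 <= k)%N ->
  surv k x <= harnack_cst J * surv k a.
Proof.
move=> dtau wE J0 tJ cU cx ca wk; have tau0 : (0 < tau)%N by exact: leq_trans dtau.
have tauR : 0 < tau%:R :> R by rewrite ltr0n.
set s := (J * (4 * d * tau ^ 2))%N.
have sw : (s <= w ^ 2)%N.
  have tw : (tau <= w)%N by rewrite wE !mulnA leq_pmull // !muln_gt0 J0 d_gt0.
  by rewrite (_ : s = w * tau)%N ?expnS ?expn1 ?leq_mul2l ?tw ?orbT // /s wE; lia.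
have := mean_value_iter tau w J c (k - s) dtau.
rewrite wE leqnn => /(_ isT J (leqnn _) x); rewrite -wE subnn mul0n addn0.
rewrite subnK; last exact: leq_trans wk.
move=> /(_ cx) H1.
have := sum_surv_le (2 * w) c a (k - s) s.
rewrite (_ : 64 * d * (2 * w) = 128 * d * w)%N; last by lia.
rewrite subnK; last exact: leq_trans wk.
move=> H2; have {}H2 := H2 _ cU _ _; rewrite /harnack_cst.
set S0 := \sum_(_ <- _) _ in H1 H2.
have S00 : 0 <= S0 by apply: sumr_ge0 => *; exact: surv_ge0.
have h4 : 4^-1 ^+ J <= (tau%:R ^+ d)^-1 :> R.
  by rewrite exprVn lef_pV2 ?posrE ?exprn_gt0 // -!natrX ler_nat.
apply: (le_trans H1).
apply: (@le_trans _ _ ((2 * d%:R + 3) / tau%:R ^+ d * S0)).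
  rewrite ler_wpM2r //; set z := (tau%:R ^+ d)^-1 in h4 *; lra.
apply: (@le_trans _ _ ((2 * d%:R + 3) / tau%:R ^+ d *
   (4 * (32 * d%:R * (2 * w)%:R) ^+ d * surv k a))).
  rewrite ler_wpM2l ?divr_ge0 ?exprn_ge0 ?addr_ge0 ?mulr_ge0 ?ler0n //.
  apply: H2; first by rewrite wE; nia.
  - by apply: in_cube_le ca; lia.
  - by apply: leq_trans sw _; rewrite leq_exp2r //; lia.
rewrite !mulrA ler_wpM2r ?surv_ge0 //.
rewrite -!mulrA ler_wpM2l ?addr_ge0 ?mulr_ge0 ?ler0n // mulrCA ler_wpM2l //.
rewrite mulrC -exprVn -exprMn le_eqVlt; apply/orP; left; apply/eqP; congr (_ ^+ d).
rewrite wE !natrM; field; exact: lt0r_neq0.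
Qed.

End Survival.

Arguments surv {R d}.

(** * Repeated attempts to hit a set of sites *)

Section Trial.
Variables (R : realType) (d : nat).
Hypothesis d_gt0 : (0 < d)%N.
Notation site := 'rV[int]_d.
Implicit Types (f g : site -> R) (x y a v c : site).
Variables (U : pred site) (A : seq site).

(* The probability that the walk started at [y] meets [A] at a time [< r]
   before leaving [U]. *)
Fixpoint hitp (r : nat) (y : site) : R :=
  if r is r'.+1 then
    if y \in A then 1 else if U y then rw_avg (hitp r') y else 0
  else 0.

Lemma hitp_ge0 r y : 0 <= hitp r y.
Proof.
elim: r y => [//|r IH] y /=; case: ifP => // _; case: ifP => // _.
exact: rw_avg_ge0.
Qed.

Lemma hitp_le1 r y : hitp r y <= 1.
Proof.
elim: r y => [//|r IH] y /=; case: ifP => // _; case: ifP => // _.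
by rewrite -[leRHS](rw_avg_cst R d d_gt0 1 y); exact: rw_avg_le.
Qed.

Lemma hitpS_ge r y : hitp r y <= hitp r.+1 y.
Proof.
elim: r y => [|r IH] y; first exact: hitp_ge0.
rewrite [leRHS]/= [leLHS]/=; case: ifP => // _; case: ifP => // _.
exact: rw_avg_le.
Qed.

(** After [r] lazy steps the walk has made at most [r] moves. Being at different sites of [A] at one
    fixed time are disjoint events, so the hitting probability gains the full factor |A|. *)
Lemma lazy_le_hitp r y : 
  iter r (killed U lazy_avg) (fun y => (y \in A)%:R) y <= hitp r.+1 y.
Proof.
elim: r y => [|r IH] y.
  by rewrite /=; case: ifP => // _; case: ifP => // _; exact: rw_avg_ge0.
rewrite iterS; apply: (@le_trans _ _ (killed U lazy_avg (hitp r.+1) y)).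
  by apply: killed_mono => // *; exact: lazy_avg_le.
have h1 := hitpS_ge r.+1 y; have h2 := hitp_le1 r.+1 y.
have h3 := hitp_ge0 r.+2 y; rewrite /killed /lazy_avg; case: ifPn => // Uy.
have e : hitp r.+2 y = if y \in A then 1 else rw_avg (hitp r.+1) y by rewrite /= Uy.
rewrite e in h1 h3 *; case: ifP h1 h3 => yA h1 _; last by lra.
have : rw_avg (hitp r.+1) y <= 1; last by lra.
rewrite -[leRHS](rw_avg_cst R d d_gt0 1 y); apply: rw_avg_le => z.
exact: hitp_le1.
Qed.

Definition avoiding : pred site := fun y => U y && (y \notin A).

(** Decomposition at the first visit to [A]: what is left to survive is at most [j + T], hence has
    probability at least [mu]. *)
Lemma surv_gap T j mu : 0 <= mu -> (forall a, a \in A -> mu <= surv U (j + T) a) ->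
  forall r, (r <= T)%N -> forall y,
  iter r (killed avoiding rw_avg) (surv U j) y + mu * hitp r y <= surv U (j + r) y.
Proof.
move=> mu0 Amu; elim=> [|r IH] rT y; first by rewrite addn0 /= mulr0 addr0.
rewrite iterS /= /killed /avoiding; have [yA|yA] := boolP (y \in A).
  rewrite andbF add0r mulr1; apply: le_trans (Amu _ yA) _.
  by rewrite -(subnKC rT) addnA; exact: surv_anti.
rewrite andbT addnS survS; case: ifP => Uy; last by rewrite mulr0 addr0.
rewrite -rw_avgZ -rw_avgD; apply: rw_avg_le => z; apply: IH; exact: ltnW.
Qed.

(** The successor is there because [hitp r] only counts times below [r]. *)
Definition trial_time (w : nat) : nat := (64 * d * w ^ 2).+1.

Definition hit_rate (w J : nat) : R :=
  (size A)%:R * (2^-1 * (32 * d%:R * w%:R)^-1 ^+ d) / harnack_cst R d J.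

Lemma harnack_cst_gt0 J : (0 < J)%N -> 0 < harnack_cst R d J.
Proof.
move=> J0; have d0 : 0 < d%:R :> R by rewrite ltr0n.
have J0' : 0 < J%:R :> R by rewrite ltr0n.
have h1 : 0 < 256 * d%:R ^+ 2 * J%:R :> R by rewrite !mulr_gt0 ?exprn_gt0.
have h2 : 0 < (256 * d%:R ^+ 2 * J%:R) ^+ d :> R by rewrite exprn_gt0.
by rewrite /harnack_cst !mulr_gt0 //; lra.
Qed.

(** Harnack bounds survival from any point of [A] below by that from [x] over the constant, so a hit
    removes a definite share of the survival probability. *)
Lemma trial tau w J c k x : (d <= tau)%N -> w = (J * (4 * d * tau))%N -> (0 < J)%N ->
  (tau ^ d <= 4 ^ J)%N -> (forall y, in_cube c (128 * d * w) y -> U y) ->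
  uniq A -> {subset A <= cube c w} ->
  in_cube c w x -> (trial_time w <= k)%N ->
  iter (trial_time w) (killed avoiding rw_avg) (surv U (k - trial_time w)) x
    <= (1 - hit_rate w J) * surv U k x.
Proof.
move=> dtau wE J0 tJ cU uA Aw cx Tk; set T := trial_time w.
have H0 := harnack_cst_gt0 J J0; set hc := harnack_cst R d J in H0.
have dw : (d <= w)%N.
  by apply: leq_trans dtau _; rewrite wE !mulnA leq_pmull // !muln_gt0 J0 d_gt0.
set mu := surv U k x / hc.
have mu0 : 0 <= mu by rewrite divr_ge0 ?(ltW H0) // surv_ge0.
have wk : (w ^ 2 <= k)%N by apply: leq_trans Tk; rewrite /trial_time; nia.
have := surv_gap T (k - T) mu mu0; rewrite subnK // => H.
have {}H := H _ T (leqnn _) x; rewrite subnK // in H.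
have Ha : forall a, a \in A -> mu <= surv U k a.
  move=> a /Aw; rewrite mem_cube => ca; rewrite /mu ler_pdivrMr // mulrC.
  exact: (@harnack R d d_gt0 U tau w J c).
have {}H := H Ha.
have low : (size A)%:R * (2^-1 * (32 * d%:R * w%:R)^-1 ^+ d) <= hitp T x.
  apply: le_trans (lazy_le_hitp _ x).
  apply: (@le_trans _ _ (iter (64 * d * w ^ 2) (killed U lazy_avg)
      (fun y => \sum_(v <- A) 1 * (y == v)%:R) x)); last first.
    apply: iter_avg_le => [f g y fg|y].
      by apply: killed_mono => // *; exact: lazy_avg_le.
    by rewrite (sum_delta R d A (fun=> 1)) //; case: ifP.
  rewrite iter_avg_sum.
  - rewrite -sum1_size natr_sum mulr_suml big_seq [leRHS]big_seq ler_sum // => v vA.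
    rewrite mul1r; under [X in iter _ _ X]eq_fun do rewrite mul1r.
    apply: (confined_lower R d d_gt0 U w c v x) => //; last by rewrite -mem_cube Aw.
    by move=> y cy; apply: cU; apply: in_cube_le cy; lia.
  - by move=> f g y; apply: killedD => *; exact: lazy_avgD.
  - by move=> k' f y; apply: killedZ => *; exact: lazy_avgZ.
have : mu * ((size A)%:R * (2^-1 * (32 * d%:R * w%:R)^-1 ^+ d)) <= mu * hitp T x.
  by rewrite ler_wpM2l.
rewrite (_ : mu * _ = hit_rate w J * surv U k x); last first.
  by rewrite /hit_rate /mu -/hc; ring.
by lra.
Qed.

Variable Q : pred site.

(* The probability that the walk from [x] stays in [U] up to time [k], and
   before time [k] avoids [A] and spends at least [V] units of time in [Q]. *)
Fixpoint visitp (k V : nat) (x : site) : R :=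
  if k is k'.+1 then
    if avoiding x then rw_avg (visitp k' (V - Q x)) x else 0
  else ((U x) && (V == 0%N))%:R.

Lemma visitp_le_surv k V x : visitp k V x <= surv U k x.
Proof.
elim: k V x => [|k IH] V x.
  by rewrite /surv /=; case: (U x); case: eqP.
rewrite survS /= /avoiding; case: ifPn => [/andP[-> _]|_]; first exact: rw_avg_le.
by case: ifP => // _; apply: rw_avg_ge0 => y; exact: surv_ge0.
Qed.

Lemma visitp_anti k V V' x : (V <= V')%N -> visitp k V' x <= visitp k V x.
Proof.
elim: k V V' x => [|k IH] V V' x VV' /=.
  rewrite ler_nat; case: (U x) => //=; case: (eqVneq V' 0%N) => //= e.
  by rewrite e leqn0 in VV'; rewrite VV'.
by case: ifP => // _; apply: rw_avg_le => y; apply: IH; lia.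
Qed.

Lemma visitp_eq0 k V x : (k < V)%N -> visitp k V x = 0.
Proof.
elim: k V x => [|k IH] V x kV /=; first by case: V kV => // V _; rewrite andbF.
case: ifP => // _; rewrite -[RHS](rw_avg_cst R d d_gt0 0 x).
congr rw_avg; apply/funext => y; apply: IH; case: (Q x) => /=; lia.
Qed.

Lemma visitp_iter T k V x :
  visitp (T + k) V x <= iter T (killed avoiding rw_avg) (visitp k (V - T)) x.
Proof.
elim: T V x => [|T IH] V x; first by rewrite subn0.
rewrite addSn /= /killed; case: ifP => // _; apply: rw_avg_le => y.
apply: le_trans (visitp_anti _ (V - 1) _ _ _) _; first by case: (Q x) => /=; lia.
apply: le_trans (IH _ _) _; rewrite -subnDA add1n; exact: lexx.
Qed.

Lemma visitp_decay T q : (0 < T)%N ->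
  (forall k x, Q x -> (T <= k)%N ->
     iter T (killed avoiding rw_avg) (surv U (k - T)) x <= expR (- q) * surv U k x) ->
  forall k j V x, (j.+1 * T <= V)%N ->
  visitp k V x <= expR (- (j%:R * q)) * surv U k x.
Proof.
move=> T0 trialT; elim/ltn_ind => k IH [|j] V x jV.
  by rewrite mul0r oppr0 expR0 mul1r visitp_le_surv.
have VT : (T <= V)%N by apply: leq_trans jV; rewrite mulSn leq_addr.
have [Qx|Qx] := boolP (Q x); last first.
  case: k IH => [|k] IH.
    rewrite visitp_eq0; last by apply: leq_trans VT.
    by rewrite mulr_ge0 ?expR_ge0 ?surv_ge0.
  rewrite survS /= /avoiding; case: (boolP (U x)) => [Ux|_] /=; last by rewrite mulr0.
  case: ifP => _; last first.
    by rewrite mulr_ge0 ?expR_ge0 ?rw_avg_ge0 // => y; exact: surv_ge0.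
  rewrite -rw_avgZ; apply: rw_avg_le => y; apply: IH => //.
  by rewrite (negbTE Qx) subn0.
have [kT|Tk] := ltnP k T.
  rewrite visitp_eq0; last exact: leq_trans VT.
  by rewrite mulr_ge0 ?expR_ge0 ?surv_ge0.
rewrite -{1}(subnKC Tk); apply: le_trans (visitp_iter _ _ _ _) _.
have Kle f g y : (forall z, f z <= g z) ->
    killed avoiding rw_avg f y <= killed avoiding rw_avg g y.
  by move=> fg; apply: killed_mono => // *; exact: rw_avg_le.
have KZ k' f y : killed avoiding rw_avg (fun z => k' * f z) y
    = k' * killed avoiding rw_avg f y.
  by apply: killedZ => *; exact: rw_avgZ.
apply: (@le_trans _ _ (iter T (killed avoiding rw_avg)
    (fun y => expR (- (j%:R * q)) * surv U (k - T) y) x)).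
  apply: iter_avg_le => // y; apply: IH; first by lia.
  by rewrite mulSn in jV; lia.
rewrite iter_avgZ // -natr1 mulrDl mul1r opprD expRD -mulrA.
by rewrite ler_wpM2l ?expR_ge0 // trialT.
Qed.

End Trial.

Arguments visitp {R d}.
Arguments avoiding {d}.

(** * From uniform trajectories to recursions, and the obstacle representation *)

Section Trajectories.
Variables (R : realType) (d : nat).
Hypothesis d_gt0 : (0 < d)%N.
Notation site := 'rV[int]_d.

Definition traj_cons {N} (s : 'I_d * bool) (w : traj d N) : traj d N.+1 :=
  [ffun i => if unlift ord0 i is Some j then w j else s].

Lemma S_0 N (w : traj d N) : S w 0 = 0.
Proof. by rewrite /S big1. Qed.

Lemma S_cons N s (w : traj d N) k : S (traj_cons s w) k.+1 = step_vec s + S w k.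
Proof.
rewrite /S big_mkcond big_ord_recl /= ffunE unlift_none; congr (_ + _).
rewrite [RHS]big_mkcond; apply: eq_bigr => i _.
by rewrite /bump /= add1n ltnS ffunE liftK.
Qed.

Lemma Exp_cons N (X : traj d N.+1 -> R) :
  Exp X = (\sum_s Exp (fun w => X (traj_cons s w))) / (2 * d)%:R.
Proof.
rewrite /Exp -mulr_suml -mulrA -invfM -natrM; congr (_ / _%:R); last first.
  by rewrite !card_ffun !card_ord card_prod card_ord card_bool expnS mulnC [(d * 2)%N]mulnC.
rewrite pair_bigA /=.
rewrite (reindex (fun p : ('I_d * bool) * traj d N => traj_cons p.1 p.2)) //=.
exists (fun w => (w ord0, [ffun j => w (lift ord0 j)])) => [[s w] _|w _] /=.
  rewrite ffunE unlift_none; congr pair; apply/ffunP => j.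
  by rewrite !ffunE liftK.
apply/ffunP => i; rewrite ffunE; case: unliftP => [j ->|->] //.
by rewrite ffunE.
Qed.

Lemma Exp_nil (X : traj d 0 -> R) w : Exp X = X w.
Proof.
rewrite /Exp card_ffun !card_ord expn0 divr1 (big_pred1 w) // => w'.
by apply/esym/eqP/ffunP => -[].
Qed.

Lemma Exp_le N (X Y : traj d N -> R) : (forall w, X w <= Y w) -> Exp X <= Exp Y.
Proof. by move=> XY; rewrite /Exp ler_wpM2r ?invr_ge0 ?ler0n // ler_sum. Qed.

Lemma ExpZ N k (X : traj d N -> R) : Exp (fun w => k * X w) = k * Exp X.
Proof. by rewrite /Exp -mulr_sumr mulrA. Qed.

Lemma Exp_sum N (I : finType) (X : I -> traj d N -> R) :
  Exp (fun w => \sum_i X i w) = \sum_i Exp (X i).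
Proof. by rewrite /Exp exchange_big mulr_suml. Qed.

Lemma Exp_sum_seq N (T : Type) (r : seq T) (X : T -> traj d N -> R) :
  Exp (fun w => \sum_(i <- r) X i w) = \sum_(i <- r) Exp (X i).
Proof. by rewrite /Exp exchange_big mulr_suml. Qed.

Definition positions {N} (w : traj d N) (n : nat) : seq site := [seq S w k | k <- iota 0 n].

Definition shifted_positions {N} (w : traj d N) (x : site) n := [seq x + y | y <- positions w n].

Lemma shifted_positions_cons N s (w : traj d N) x n :
  shifted_positions (traj_cons s w) x n.+1
    = x :: shifted_positions w (x + step_vec s) n.
Proof.
rewrite /shifted_positions /positions -!map_comp /= S_0 addr0; congr (_ :: _).
rewrite (iotaDl 1 0 n) -map_comp; apply: eq_map => k /=.
by rewrite S_cons addrA.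
Qed.

Lemma shifted_positions0 N (w : traj d N) n : shifted_positions w 0 n = positions w n.
Proof. by rewrite /shifted_positions (eq_map (fun y => add0r y)) map_id. Qed.

(** The time ranges differ: [U] is tested up to time N, as [R_N] contains [S_N]; [A] and [Q] only
    before N, as in [L_N]. *)
Definition visit_event (U : pred site) (A : seq site) (Q : pred site) {N} V x
    (w : traj d N) : bool :=
  [&& all U (shifted_positions w x N.+1),
      all (fun y => y \notin A) (shifted_positions w x N) &
      (V <= count Q (shifted_positions w x N))%N].

Lemma Exp_visit_event U A Q N V x :
  Exp (fun w : traj d N => (visit_event U A Q V x w)%:R) = visitp U A Q N V x :> R.
Proof.
elim: N V x => [|N IH] V x.
  rewrite (Exp_nil _ [ffun i => (Ordinal d_gt0, true)]) /visit_event.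
  by rewrite /shifted_positions /positions /= S_0 addr0 andbT leqn0.
rewrite Exp_cons /= /avoiding; case: ifPn => xU; last first.
  rewrite big1 ?mul0r // => s _; rewrite -[RHS](mul0r (Exp (fun _ : traj d N => 0))) -ExpZ.
  congr Exp; apply/funext => w; rewrite mul0r /visit_event !shifted_positions_cons /=.
  by move: xU; case: (U x) => //=; case: (x \in A) => //=; rewrite andbF.
rewrite /rw_avg; congr (_ / _); apply: eq_bigr => s _; rewrite -IH.
congr Exp; apply/funext => w; rewrite /visit_event !shifted_positions_cons /=.
move/andP: xU => [-> ->] /=; congr (nat_of_bool [&& _, _ & _])%:R.
by rewrite leq_subLR.
Qed.

Lemma visitp_surv (U Q : pred site) N x : visitp U [::] Q N 0 x = surv U N x :> R.
Proof.
elim: N x => [|N IH] x; first by rewrite /surv /= andbT.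
by rewrite survS /= /avoiding andbT; case: ifP => // _; congr rw_avg; apply/funext.
Qed.

Lemma Exp_surv (U : pred site) N :
  Exp (fun w : traj d N => (all U (positions w N.+1))%:R) = surv U N 0 :> R.
Proof.
rewrite -(visitp_surv U pred0) -Exp_visit_event; congr Exp; apply/funext => w.
rewrite /visit_event !shifted_positions0 leq0n andbT.
by rewrite (_ : all _ (positions w N) = true) ?andbT //; apply/allP.
Qed.

Lemma range_sizeE N (w : traj d N) : range_size w = size (undup (positions w N.+1)).
Proof. by []. Qed.

Lemma L_NE N (w : traj d N) y : L_N w y = count_mem y (positions w N).
Proof. by rewrite /L_N /positions count_map. Qed.

Lemma positions_cube N (w : traj d N) n : (n <= N.+1)%N -> {subset positions w n <= cube 0 N}.
Proof.
move=> nN y /mapP[k]; rewrite mem_iota add0n => /andP[_ kn] ->.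
have kN : (k <= N)%N by rewrite -ltnS; exact: leq_trans nN.
rewrite mem_cube; apply/forallP => i; rewrite !mxE subr0.
apply: leq_trans kN; elim: k {kn} => [|k IH].
  by rewrite S_0 mxE.
suff : (`|(S w k.+1 0%R i)%R| <= (`|(S w k 0%R i)%R|).+1)%N.
  by move=> /leq_trans; apply.
have [kN|Nk] := ltnP k N.
  have -> : S w k.+1 = S w k + step_vec (w (Ordinal kN)).
    rewrite /S (bigD1 (Ordinal kN)) //= addrC; congr (_ + _).
    apply: eq_bigl => j; rewrite ltnS ltn_neqAle andbC; congr (_ && _).
  have := step_vec_coord d (w (Ordinal kN)) i; rewrite mxE.
  by move: (S w k 0 i) (step_vec _ 0 i) => p q; lia.
have -> : S w k.+1 = S w k.
  rewrite /S; apply: eq_bigl => j; have := ltn_ord j; lia.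
exact: leqnSn.
Qed.

(* Site percolation: [p ^ |W|] is the probability that a set [W] is open when
   the sites are open independently with probability [p]. *)
Lemma sum_percolation (I : finType) (p : R) (W : {set I}) :
  \sum_(J : {set I}) (\prod_i (if i \in J then p else 1 - p)) * (W \subset J)%:R
    = p ^+ #|W|.
Proof.
transitivity (\prod_(i : I) (p + if i \in W then 0 else 1 - p)); last first.
  rewrite (bigID (mem W)) /= [X in _ * X]big1 => [|i /negbTE ->]; last by ring.
  rewrite mulr1 -prodr_const; apply: eq_bigr => i ->; exact: addr0.
rewrite bigA_distr; apply: eq_bigr => J _.
have [WJ|/subsetPn[i iW iJ]] := boolP (W \subset J); last first.
  by rewrite mulr0 (bigD1 i) //= (negbTE iJ) iW mul0r.
rewrite mulr1; apply: eq_bigr => i _; case: ifP => // iJ; case: ifP => // iW.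
by rewrite (fintype.subsetP WJ) in iJ.
Qed.

Section Obstacles.
Variable Omega : seq site.

Definition open_sites (J : {set seq_sub Omega}) : pred site :=
  fun y => [exists i in J, ssval i == y].

Definition open_weight (J : {set seq_sub Omega}) : R :=
  \prod_i (if i \in J then expR (-1) else 1 - expR (-1)).

Lemma open_weight_ge0 J : 0 <= open_weight J.
Proof.
by apply: prodr_ge0 => i _; case: ifP => _; rewrite ?expR_ge0 // subr_ge0 -expR0 ler_expR.
Qed.

Lemma expR_size_open (s : seq site) : {subset s <= Omega} ->
  expR (- (size (undup s))%:R)
    = \sum_(J : {set seq_sub Omega}) open_weight J * (all (open_sites J) s)%:R.
Proof.
move=> sO; set W := [set i : seq_sub Omega | ssval i \in s]%SET.
have -> : size (undup s) = #|W|.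
  rewrite cardE -(size_map (@ssval _ Omega)); apply/perm_size/uniq_perm.
  - exact: undup_uniq.
  - by rewrite map_inj_uniq ?enum_uniq //; exact: val_inj.
  move=> y; rewrite mem_undup; apply/idP/mapP => [ys|[i]].
    by exists (SeqSub (sO _ ys)) => //; rewrite mem_enum inE.
  by rewrite mem_enum inE => ? ->.
rewrite -mulrN1 expRM_natl -sum_percolation; apply: eq_bigr => J _.
congr (_ * (nat_of_bool _)%:R); apply/fintype.subsetP/allP => [WJ y ys|H i].
  apply/existsP; exists (SeqSub (sO _ ys)); rewrite eqxx andbT.
  by apply: WJ; rewrite inE.
by rewrite inE => /H /existsP[j /andP[jJ /eqP/val_inj <-]].
Qed.

End Obstacles.

(* Opening the sites outside the obstacles turns the weight [exp (- |R|)] into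
   survival, for which the walk is Markovian. *)
Lemma Exp_range_le N (D : seq site) (F : traj d N -> bool) (delta : R) : 0 <= delta ->
  (forall U : pred site, all U D ->
    Exp (fun w : traj d N => (all U (positions w N.+1) && F w)%:R) <= delta * surv U N 0) ->
  Exp (fun w : traj d N => expR (- (size (undup (positions w N.+1 ++ D)))%:R) * (F w)%:R)
    <= delta * Z_N R d N.
Proof.
(* A finite set containing [D] and all sites within reach, so that percolation is a finite sum. *)
move=> delta0 H; set Omega := cube (0 : site) N ++ D.
have posO (w : traj d N) : {subset positions w N.+1 <= Omega}.
  by move=> y /positions_cube yc; rewrite mem_cat yc.
have posDO (w : traj d N) : {subset positions w N.+1 ++ D <= Omega}.
  move=> y; rewrite mem_cat => /orP[/posO//|yD].
  by rewrite mem_cat yD orbT.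
rewrite /Z_N.
rewrite (_ : (fun w : traj d N => expR (- (range_size w)%:R)) = fun w =>
  \sum_(J : {set seq_sub Omega}) open_weight Omega J *
     (all (open_sites Omega J) (positions w N.+1))%:R); last first.
  by apply/funext => w; rewrite range_sizeE (expR_size_open Omega) //.
rewrite (_ : (fun w : traj d N => _ * (F w)%:R) = fun w =>
  \sum_(J : {set seq_sub Omega}) open_weight Omega J *
     ((all (open_sites Omega J) D)%:R *
      (all (open_sites Omega J) (positions w N.+1) && F w)%:R)); last first.
  apply/funext => w; rewrite (expR_size_open Omega) // mulr_suml; apply: eq_bigr => J _.
  by rewrite -mulrA -!natrM !mulnb all_cat andbAC andbC andbA.
rewrite !Exp_sum mulr_sumr ler_sum // => J _; rewrite !ExpZ [leRHS]mulrCA.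
rewrite ler_wpM2l ?open_weight_ge0 // Exp_surv.
case: (boolP (all _ D)) => [aD|_]; first by rewrite mul1r; exact: H.
by rewrite mul0r mulr_ge0 // surv_ge0.
Qed.

End Trajectories.

Arguments positions {d N}.
Arguments shifted_positions {d N}.

(** * Choice of the scale and union bound *)

Section Uncovered.
Variables (R : realType) (d : nat).
Hypothesis d_gt0 : (0 < d)%N.
Notation site := 'rV[int]_d.

Lemma fill_bound N c w tau J (A : seq site) M V j : (d <= tau)%N ->
  w = (J * (4 * d * tau))%N -> (0 < J)%N -> (tau ^ d <= 4 ^ J)%N ->
  uniq A -> {subset A <= cube c w} -> (M <= w)%N -> (j.+1 * trial_time d w <= V)%N ->
  Exp (fun s : traj d N =>
      expR (- (size (undup (positions s N.+1 ++ cube c (128 * d * w))))%:R) *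
      (all (fun y => y \notin A) (positions s N)
        && (V <= count (in_cube c M) (positions s N))%N)%:R)
    <= expR (- (j%:R * hit_rate R d A w J)) * Z_N R d N.
Proof.
move=> dtau wE J0 tJ uA Aw Mw jV; apply: Exp_range_le; rewrite ?expR_ge0 //.
move=> U /allP UD.
have -> : (fun s : traj d N => (all U (positions s N.+1) &&
    (all (fun y => y \notin A) (positions s N)
      && (V <= count (in_cube c M) (positions s N))%N))%:R)
  = fun s => (visit_event d U A (in_cube c M) V 0 s)%:R :> R.
  by apply/funext => s; rewrite /visit_event !shifted_positions0.
rewrite Exp_visit_event //; apply: (visitp_decay R d d_gt0 U A _ (trial_time d w)) => //.
move=> k x Mx Tk.
apply: le_trans (trial R d d_gt0 U A tau w J c k x dtau wE J0 tJ _ uA Aw _ Tk) _.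
- by move=> y cy; apply: UD; rewrite mem_cube.
- exact: in_cube_le Mx.
by rewrite ler_wpM2r ?surv_ge0 //; exact: expR_ge1Dx.
Qed.

Lemma Exp_sum_cond N (I : finType) (P : pred I) (X : I -> traj d N -> R) :
  Exp (fun w => \sum_(i | P i) X i w) = \sum_(i | P i) Exp (X i).
Proof. by rewrite /Exp exchange_big mulr_suml. Qed.

(** [S_N] may still lie in it, so the count in [range_size_vacant] is only an inequality. *)
Definition vacant {N} (s : traj d N) c r : seq site :=
  [seq y <- cube c r | y \notin positions s N].

Lemma range_size_vacant N (s : traj d N) c r :
  (size (undup (positions s N.+1 ++ cube c r)) <= range_size s + size (vacant s c r))%N.
Proof.
rewrite range_sizeE -size_cat; apply: uniq_leq_size; first exact: undup_uniq.
move=> y; rewrite mem_undup !mem_cat mem_undup mem_filter => /orP[->//|yc].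
have [yp|yp] := boolP (y \in positions s N); last by rewrite yc orbT.
have -> // : y \in positions s N.+1.
case/mapP: yp => k; rewrite mem_iota add0n => /andP[_ kN] ->.
by apply/mapP; exists k => //; rewrite mem_iota /= add0n ltnS ltnW.
Qed.

Lemma growth_pigeonhole (f : nat -> nat) b n : (0 < n)%N -> (0 < f 0)%N -> (f n <= b ^ n)%N ->
  exists2 i, (i < n)%N & (f i.+1 <= b * f i)%N.
Proof.
move=> n0 f0 fn; apply: contrapT => H.
have {}H i : (i < n)%N -> (b * f i < f i.+1)%N.
  by move=> ni; rewrite ltnNge; apply/negP => fi; apply: H; exists i.
suff Hi i : (i < n)%N -> (b ^ i.+1 < f i.+1)%N.
  by case: n n0 fn H Hi => // n _ fn _ Hi; have := Hi n (leqnn _); rewrite ltnNge fn.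
elim: i => [|i IH] ni.
  by apply: leq_ltn_trans (H 0 ni); rewrite expn1 leq_pmulr.
apply: leq_ltn_trans (H _ ni); rewrite expnS leq_mul2l ltnW ?orbT // IH //.
exact: ltnW.
Qed.

(** Half of the gain pays for the entropy: one factor z comes out since the sets are nonempty, and
    the rest sums to (1 + z)^|I| <= e. *)
Lemma sum_pow_card (I : finType) (z : R) : 0 <= z -> #|I|%:R * z <= 1 ->
  \sum_(J : {set I} | J != finset.set0) (z ^+ 2) ^+ #|J| <= expR 1 * z.
Proof.
move=> z0 Iz; have z1 : (0 < #|I|)%N -> z <= 1.
  move=> I0; apply: le_trans Iz; rewrite ler_peMl // ler1n //.
apply: (@le_trans _ _ (z * \sum_(J : {set I}) z ^+ #|J|)).
  rewrite mulr_sumr [leRHS](bigID (fun J => J != finset.set0)) /=.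
  rewrite ler_wpDr ?sumr_ge0 // => [*|]; first by rewrite mulr_ge0 ?exprn_ge0.
  apply: ler_sum => J J0; rewrite -exprM mulnC -exprS.
  have c0 : (0 < #|J|)%N by rewrite card_gt0.
  have I0 : (0 < #|I|)%N by apply: leq_trans c0 (max_card _).
  by rewrite ler_wiXn2l ?z1 //; lia.
have -> : \sum_(J : {set I}) z ^+ #|J| = (z + 1) ^+ #|I|.
  transitivity (\prod_(i : I) (z + 1)); last by rewrite prodr_const.
  rewrite bigA_distr; apply: eq_bigr => J _.
  by rewrite -prodr_const big_mkcond.
rewrite mulrC ler_wpM2r //.
apply: (@le_trans _ _ (expR z ^+ #|I|)).
  by rewrite lerXn2r ?nnegrE ?expR_ge0 ?addr_ge0 // addrC expR_ge1Dx.
by rewrite -expRM_natl ler_expR.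
Qed.

(* The unvisited part of some cube in the sequence occupies at least a fraction
   [1 / b] of the unvisited part of the next one; the walk pays for missing it
   while filling the next one costs at most [exp (b * size)]. *)
Lemma uncovered_bound N (c : site) M b V J I theta : (0 < J)%N -> (0 < I)%N ->
  let w i := ((128 * d) ^ i * M)%N in
  (forall i, (i < I)%N -> exists tau,
     [/\ (d <= tau)%N, w i = (J * (4 * d * tau))%N & (tau ^ d <= 4 ^ J)%N]) ->
  (forall i, (i < I)%N -> exists j, (j.+1 * trial_time d (w i) <= V)%N /\
     theta <= j%:R * ((2^-1 * (32 * d%:R * (w i)%:R)^-1 ^+ d) / harnack_cst R d J)) ->
  ((2 * w I).+1 ^ d <= b ^ I)%N ->
  ((2 * w I).+1 ^ d)%N%:R * expR (- ((theta - b%:R) / 2)) <= 1 ->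
  Exp (fun s : traj d N => expR (- (range_size s)%:R) *
      ((c \notin positions s N) && (V <= count (in_cube c M) (positions s N))%N)%:R)
    <= I%:R * (expR 1 * expR (- ((theta - b%:R) / 2))) * Z_N R d N.
Proof.
move=> J0 I0 w wtau wj wI wexp.
set z := expR _ in wexp *; have z0 : 0 <= z by exact: expR_ge0.
have ZN0 : 0 <= Z_N R d N.
  by rewrite /Z_N /Exp divr_ge0 ?ler0n // sumr_ge0 // => *; exact: expR_ge0.
have MwI i : (M <= w i)%N by rewrite /w leq_pmull // expn_gt0 muln_gt0 d_gt0.
have wle i : (i <= I)%N -> (w i <= w I)%N.
  by move=> iI; rewrite /w leq_mul2r leq_pexp2l ?orbT // muln_gt0 d_gt0.
have wS i : w i.+1 = (128 * d * w i)%N by rewrite /w expnS mulnA.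
pose DJ i (B : {set seq_sub (cube c (w i))}) : seq site :=
  [seq y <- cube c (w i) | open_sites d (cube c (w i)) B y].
have sizeDJ i B : size (DJ i B) = #|B|.
  rewrite cardE -(size_map (@ssval _ (cube c (w i)))); apply/perm_size/uniq_perm.
  - by rewrite filter_uniq // cube_uniq.
  - by rewrite map_inj_uniq ?enum_uniq //; exact: val_inj.
  move=> y; rewrite mem_filter; apply/andP/mapP => [[/existsP[k /andP[kB /eqP <-]] _]|[k]].
    by exists k => //; rewrite mem_enum.
  rewrite mem_enum => kB ->; split; last exact: ssvalP.
  by apply/existsP; exists k; rewrite kB eqxx.
pose W i B (s : traj d N) : R :=
  expR (- (size (undup (positions s N.+1 ++ cube c (128 * d * w i))))%:R) *
      (all (fun y => y \notin DJ i B) (positions s N)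
        && (V <= count (in_cube c M) (positions s N))%N)%:R.
(* For each trajectory the term of the scale found by the pigeonhole and of its own vacant set
   already dominates. *)
have pathwise (s : traj d N) : expR (- (range_size s)%:R) *
      ((c \notin positions s N) && (V <= count (in_cube c M) (positions s N))%N)%:R
   <= \sum_(i < I) \sum_(B : {set seq_sub (cube c (w i))} | B != finset.set0)
        expR (b%:R * #|B|%:R) * W i B s.
  have W0 i (B : {set seq_sub (cube c (w i))}) : 0 <= expR (b%:R * #|B|%:R) * W i B s.
    by rewrite /W !mulr_ge0 ?expR_ge0.
  have [/andP[cs Vs]|_] := boolP (_ && _); last first.
    by rewrite mulr0; apply: sumr_ge0 => i _; apply: sumr_ge0.
  rewrite mulr1.
  have vac0 i : (0 < size (vacant s c (w i)))%N.
    by rewrite -has_predT; apply/hasP; exists c; rewrite // mem_filter cs mem_cube in_cube_center.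
  have vacI : (size (vacant s c (w I)) <= b ^ I)%N.
    apply: leq_trans wI; rewrite -(size_cube _ c) size_filter; exact: count_size.
  have [i iI Hi] := growth_pigeonhole (fun k => size (vacant s c (w k))) b I I0 (vac0 0%N) vacI.
  pose B := [set k : seq_sub (cube c (w i)) | ssval k \notin positions s N]%SET.
  have DB : DJ i B = vacant s c (w i).
    apply: eq_in_filter => y yc; apply/existsP/idP => [[k /andP[]]|ys].
      by rewrite finset.in_set => ks /eqP <-.
    by exists (SeqSub yc); rewrite finset.in_set /= ys eqxx.
  have cB : #|B| = size (vacant s c (w i)) by rewrite -sizeDJ DB.
  have B0 : B != finset.set0 by rewrite -card_gt0 cB.
  rewrite (bigD1 (Ordinal iI)) //= ler_wpDr //.
    by apply: sumr_ge0 => k _; apply: sumr_ge0.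
  rewrite (bigD1 B) //= ler_wpDr //; first exact: sumr_ge0.
  have -> : W i B s = expR (- (size (undup (positions s N.+1 ++ cube c (w i.+1))))%:R).
    rewrite /W Vs andbT (_ : all _ _ = true) ?mulr1; last first.
      by apply/allP => y ys; rewrite DB mem_filter ys.
    by rewrite wS.
  rewrite -expRD ler_expR.
  have h1 : (size (undup (positions s N.+1 ++ cube c (w i.+1)))
      <= range_size s + b * #|B|)%N.
    apply: leq_trans (range_size_vacant N s c (w i.+1)) _.
    by rewrite leq_add2l cB.
  move: h1; rewrite -(ler_nat R) natrD natrM; lra.
apply: le_trans (Exp_le _ _ _ _ _ pathwise) _.
rewrite Exp_sum.
have term (i : 'I_I) : Exp (fun s => \sum_(B : {set seq_sub (cube c (w i))} | B != finset.set0)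
    expR (b%:R * #|B|%:R) * W i B s) <= expR 1 * z * Z_N R d N.
  rewrite Exp_sum_cond.
  have [tau [dtau wE tJ]] := wtau i (ltn_ord i).
  have [j [jV jtheta]] := wj i (ltn_ord i).
  (* The filling cost b and the gain [theta] leave exp(-(theta - b)), that is z^2, per site. *)
  have Bterm (B : {set seq_sub (cube c (w i))}) :
      Exp (fun s => expR (b%:R * #|B|%:R) * W i B s) <= (z ^+ 2) ^+ #|B| * Z_N R d N.
    have uD : uniq (DJ i B) by rewrite filter_uniq // cube_uniq.
    have sD : {subset DJ i B <= cube c (w i)} by move=> y; rewrite mem_filter => /andP[].
    rewrite ExpZ.
    have H := fill_bound N c (w i) tau J (DJ i B) M V j dtau wE J0 tJ uD sD (MwI i) jV.
    have := ler_wpM2l (expR_ge0 (b%:R * #|B|%:R)) H; move/le_trans; apply.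
    rewrite mulrA ler_wpM2r // -expRD -!expRM_natl ler_expR.
    rewrite /hit_rate sizeDJ.
    have : #|B|%:R * theta <= #|B|%:R * (j%:R *
        ((2^-1 * (32 * d%:R * (w i)%:R)^-1 ^+ d) / harnack_cst R d J)) by rewrite ler_wpM2l.
    set u := harnack_cst _ _ _; set v := _ ^+ d; set B' := #|B|%:R.
    by lra.
  apply: (@le_trans _ _ (\sum_(B : {set seq_sub (cube c (w i))} | B != finset.set0)
      (z ^+ 2) ^+ #|B| * Z_N R d N)); first exact: ler_sum.
  rewrite -mulr_suml ler_wpM2r // sum_pow_card //.
  rewrite card_seq_sub ?cube_uniq // size_cube; apply: le_trans wexp.
  by rewrite ler_wpM2r // ler_nat leq_exp2r // ltnS leq_mul2l /= wle // ltnW.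
apply: (@le_trans _ _ (\sum_(i < I) expR 1 * z * Z_N R d N)); first exact: ler_sum.
by rewrite sumr_const card_ord -[X in X <= _]mulr_natl mulrA.
Qed.

End Uncovered.

(** * Second derivatives along coordinate lines *)

Section SecondDerivative.
Variable R : realType.

(** As g vanishes at the minimum 0, a negative derivative would make g negative just to the right,
    and the mean value theorem would make G drop below G 0. *)
Lemma second_derivative_at_min (G g : R -> R) (delta : R) : 0 < delta ->
  (forall t : R, `|t| < delta -> is_derive t 1 G (g t)) -> derivable g 0 1 ->
  (forall t : R, `|t| < delta -> G 0 <= G t) -> 0 <= 'D_1 g 0.
Proof.
move=> d0 dG dG' Gmin; rewrite leNgt; apply/negP => s0.
set s := 'D_1 g 0 in s0.
have inI t : t \in `](- delta), delta[%R -> `|t| < delta by rewrite in_itv /= ltr_norml.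
have G'0 : g 0 = 0.
  have ab : - delta <= delta by lra.
  have c0 : 0 \in `](- delta), delta[%R by rewrite in_itv /=; lra.
  have min0 t : t \in `](- delta), delta[%R -> G 0 <= G t by move=> /inI; exact: Gmin.
  have der t : t \in `](- delta), delta[%R -> derivable G t 1 by move=> /inI/dG[].
  have [_ G0] := derive1_at_min ab der c0 min0.
  have d00 : `|0 : R| < delta by rewrite normr0.
  by have [_ e] := dG 0 d00; rewrite -e.
have : (fun h : R => h^-1 *: ((g \o shift 0) (h *: 1) - g 0)) @ 0^' --> s by [].
move=> /cvgrPdist_lt /(_ (- s / 2)); rewrite divr_gt0 ?oppr_gt0 // => /(_ isT).
rewrite /prop_near1 /= /nbhs /= /dnbhs /within /= => /nbhs_ballP[eta /= eta0 Heta].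
pose t := Num.min eta delta / 2.
have mp : 0 < Num.min eta delta by rewrite lt_min eta0 d0.
have t0 : 0 < t by rewrite divr_gt0.
have te : t < eta.
  have : Num.min eta delta <= eta by rewrite ge_min lexx.
  by rewrite /t; lra.
have td : t < delta.
  have : Num.min eta delta <= delta by rewrite ge_min lexx orbT.
  by rewrite /t; lra.
have neg c : 0 < c -> c < eta -> g c < 0.
  move=> c0 ce; have := Heta c; rewrite /ball /= sub0r normrN gtr0_norm // => /(_ ce).
  rewrite gt_eqF // => /(_ isT); rewrite G'0 subr0 addr0.
  rewrite [c *: 1]mulr1 => H.
  have /ltr_normlP[H2 _] := H.
  have : c^-1 * g c < 0.
    by rewrite /GRing.scale /= in H2; lra.
  by rewrite pmulr_rlt0 // invr_gt0.
have dGt y : y \in `]0, t[%R -> is_derive y 1 G (g y).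
  rewrite in_itv /= => /andP[y0 yt]; apply: dG.
  by rewrite gtr0_norm //; lra.
have cGt : {within `[0, t], continuous G}.
  apply: derivable_within_continuous => y; rewrite in_itv /= => /andP[y0 yt].
  by have [|] := dG y; rewrite ?ger0_norm //; lra.
have [c] := MVT t0 dGt cGt.
rewrite in_itv /= subr0 => /andP[c0 ct] E.
have := Gmin t; rewrite gtr0_norm // => /(_ td).
have : g c * t < 0 by rewrite nmulr_rlt0 // neg //; lra.
by lra.
Qed.

(** On a coordinate line the barrier has this form, which differentiation preserves; its derivatives
    become computations in [{poly R}]. *)
Definition poly_exp (p q : {poly R}) : R -> R := fun t => p.[t] * expR q.[t].

Lemma is_derive_poly_exp (p q : {poly R}) (t : R) :
  is_derive t 1 (poly_exp p q) (poly_exp (p^`() + p * q^`()) q t).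
Proof.
have h1 : is_derive t (1 : R) (horner p) p^`().[t] by exact: is_derive_poly.
have h2 : is_derive t (1 : R) (expR \o horner q) (expR q.[t] * q^`().[t]).
  by apply: is_derive1_comp; exact: is_derive_poly.
have := is_deriveM h1 h2; rewrite /poly_exp => H.
apply: is_derive_eq; rewrite /= hornerD hornerM /GRing.scale /=; ring.
Qed.

Lemma derive_poly_exp (p q : {poly R}) :
  'D_1 (poly_exp p q) = poly_exp (p^`() + p * q^`()) q.
Proof. by apply/funext => t; have [_ ->] := is_derive_poly_exp p q t. Qed.

Lemma derive_poly_exp_at (p q : {poly R}) t :
  'D_1 (poly_exp p q) t = poly_exp (p^`() + p * q^`()) q t.
Proof. by have [_ ->] := is_derive_poly_exp p q t. Qed.

Lemma derive2_poly_expZ k (p q : {poly R}) t :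
  'D_1 ('D_1 (poly_exp (k *: p) q)) t = k * 'D_1 ('D_1 (poly_exp p q)) t.
Proof.
have E (u : {poly R}) : (k *: u)^`() + (k *: u) * q^`() = k *: (u^`() + u * q^`()).
  by rewrite derivZ scalerDr scalerAl.
by rewrite !derive_poly_exp !derive_poly_exp_at !E /poly_exp hornerZ mulrA.
Qed.

Lemma derivable_poly_exp (p q : {poly R}) t : derivable (poly_exp p q) t 1.
Proof. by have [] := is_derive_poly_exp p q t. Qed.

Section Line.
Variables (d : nat) (f : 'rV[R]_d -> R) (z v : 'rV[R]_d) (t : R).

Let line_quotient :
  (fun h : R => h^-1 *: (((fun h => f (h *: v + z)) \o shift t) (h *: 1) - f (t *: v + z)))
  = (fun h : R => h^-1 *: ((f \o shift (t *: v + z)) (h *: v) - f (t *: v + z))).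
Proof.
apply/funext => h /=; congr (_ *: (f _ - _)).
by rewrite [_%:A]mulr1 scalerDl addrA.
Qed.

Lemma line_derivable :
  derivable (fun h : R => f (h *: v + z)) t 1 = derivable f (t *: v + z) v.
Proof. by rewrite /derivable line_quotient. Qed.

Lemma line_derive : 'D_1 (fun h : R => f (h *: v + z)) t = 'D_v f (t *: v + z).
Proof. by rewrite /derive line_quotient. Qed.
End Line.

End SecondDerivative.

(** * Linear lower bound for the eigenfunction near the sphere *)

Section LowerBound.
Variables (R : realType) (d : nat).
Notation vec := 'rV[R]_d.
Implicit Types (x y z : vec).

Definition rsq y : R := \sum_(i < d) (y 0 i) ^+ 2.

Lemma rsq_ge0 y : 0 <= rsq y.
Proof. by apply: sumr_ge0 => i _; exact: sqr_ge0. Qed.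

Lemma enorm_lt y r : 0 < r -> (enorm y < r) = (rsq y < r ^+ 2).
Proof.
move=> r0; rewrite /enorm -(ltr_pXn2r (n := 2)) ?nnegrE ?sqrtr_ge0 ?(ltW r0) //.
by rewrite sqr_sqrtr // rsq_ge0.
Qed.

Lemma rsq_line y i (t : R) : rsq (t *: delta_mx 0 i + y) = t ^+ 2 + 2 * t * y 0 i + rsq y.
Proof.
rewrite /rsq (bigD1 i) //= [in RHS](bigD1 i) //= !mxE !eqxx /=.
rewrite (eq_bigr (fun j => (y 0 j) ^+ 2)); first by ring.
by move=> j /negbTE ji; rewrite !mxE eqxx ji mulr0 add0r.
Qed.

Lemma rsq_polar y z : 2 * \sum_(i < d) y 0 i * z 0 i = rsq y + rsq z - rsq (y - z).
Proof.
rewrite /rsq -big_split -sumrB mulr_sumr; apply: eq_bigr => i _ /=.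
by rewrite !mxE; ring.
Qed.

Lemma rsqD_le y z : rsq (y + z) <= 2 * (rsq y + rsq z).
Proof.
rewrite /rsq -big_split mulr_sumr ler_sum // => i _ /=; rewrite mxE -subr_ge0.
rewrite (_ : _ - _ = (y 0 i - z 0 i) ^+ 2); first exact: sqr_ge0.
by ring.
Qed.

Lemma continuous_rsq x : continuous (fun y => rsq (y - x)).
Proof.
have contc i : continuous (fun y : vec => (y - x) 0 i).
  move=> y; rewrite (_ : (fun y => _) = fun y : vec => y 0 i - x 0 i).
    exact: (cvgB (@coord_continuous R 1 d 0 i y) (cvg_cst _)).
  by apply/funext => z; rewrite !mxE.
have contS (s : seq 'I_d) : continuous (fun y : vec => \sum_(i <- s) ((y - x) 0 i) ^+ 2).
  elim: s => [|i s IH].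
    have -> : (fun y : vec => \sum_(i <- [::]) ((y - x) 0 i) ^+ 2) = cst 0.
      by apply/funext => z; rewrite big_nil.
    exact: cst_continuous.
  have -> : (fun y : vec => \sum_(j <- i :: s) ((y - x) 0 j) ^+ 2) = fun y : vec =>
      ((y - x) 0 i) * ((y - x) 0 i) + \sum_(j <- s) ((y - x) 0 j) ^+ 2.
    by apply/funext => z; rewrite big_cons.
  move=> y; apply: (cvgD _ (IH y)); exact: (cvgM (contc i y) (contc i y)).
exact: contS.
Qed.

Lemma iint_ge0 n (f : 'rV[R]_n -> \bar R) : (forall y : 'rV[R]_n, 0 <= f y)%E -> (0 <= iint f)%E.
Proof.
elim: n f => [|n IH] f f0 /=; first exact: f0.
by apply: integral_ge0 => t _; apply: IH.
Qed.

Lemma iint_eq0 n : iint (fun _ : 'rV[R]_n => 0%E) = 0%E.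
Proof.
elim: n => [//|n IH] /=; under eq_integral do rewrite IH.
by rewrite integral0.
Qed.

Lemma dirichlet_eigenvalue_ge0 (G : set vec) : 0 <= dirichlet_eigenvalue G.
Proof.
rewrite /dirichlet_eigenvalue; set A := [set q | _].
(* The infimum of the empty set is 0 by convention. *)
have [->|A0] := eqVneq A set0; first by rewrite inf0.
apply: lb_le_inf; first exact/set0P.
move=> q [f [_ [_ ->]]]; apply: divr_ge0; apply: fine_ge0; apply: iint_ge0 => y.
  by rewrite lee_fin sumr_ge0 // => i _; exact: sqr_ge0.
by rewrite lee_fin sqr_ge0.
Qed.

Lemma compact_rball x (r : R) : compact [set y : vec | rsq (y - x) <= r ^+ 2].
Proof.
have Mnco : compact [set v : vec |
    forall i, v ord0 i \in `[x 0 i - `|r|, x 0 i + `|r|]].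
  apply: (@rV_compact _ _ (fun i => `[x 0 i - `|r|, x 0 i + `|r|]%classic)).
  by move=> i; apply: segment_compact.
apply: (subclosed_compact _ Mnco).
  rewrite (_ : mkset _ = (fun y => rsq (y - x)) @^-1` [set t | t <= r ^+ 2]) //.
  by apply: closed_comp (@closed_le R (r ^+ 2)) => y _; exact: continuous_rsq.
move=> y /= yr i; rewrite in_itv /=.
have : `|y 0 i - x 0 i| <= `|r|.
  rewrite -(ler_pXn2r (n := 2)) ?nnegrE // !real_normK ?num_real //.
  apply: le_trans yr; rewrite /rsq (bigD1 i) //= !mxE lerDl sumr_ge0 // => *.
  exact: sqr_ge0.
by rewrite ler_norml => /andP[]; move: `|r| => r'; rewrite /=; lra.
Qed.

(** Hopf's barrier, its exponential centred at a point [y0] where phi is positive, so that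
    subharmonicity may fail only where phi is bounded below. *)
Definition barrier x y0 (rho a : R) y : R :=
  (rho ^+ 2 - rsq (y - x)) * expR (- a * rsq (y - y0)).

Definition barrier_line_factor (A p : R) : {poly R} := A%:P - (2 * p) *: 'X - 'X^2.

Definition barrier_line_exponent (a B q : R) : {poly R} :=
  (- a) *: (B%:P + (2 * q) *: 'X + 'X^2).

Lemma barrier_line x y0 rho a k z i t : k * barrier x y0 rho a (t *: delta_mx 0 i + z)
  = poly_exp R (k *: barrier_line_factor (rho ^+ 2 - rsq (z - x)) ((z - x) 0 i))
      (barrier_line_exponent a (rsq (z - y0)) ((z - y0) 0 i)) t.
Proof.
rewrite /barrier -!addrA !rsq_line /poly_exp /barrier_line_factor /barrier_line_exponent.
rewrite hornerZ mulrA; congr (_ * _ * expR _); rewrite !hornerE /=; ring.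
Qed.

Lemma barrier_line_second (A p a B q : R) :
  'D_1 ('D_1 (poly_exp R (barrier_line_factor A p) (barrier_line_exponent a B q))) 0
    = expR (- a * B) * (- 2 - 2 * a * A + 8 * a * (p * q) + 4 * a ^+ 2 * q ^+ 2 * A).
Proof.
rewrite derive_poly_exp derive_poly_exp_at /poly_exp /barrier_line_factor /barrier_line_exponent.
rewrite !poly.derivE !hornerE [RHS]mulrC; congr (_ * expR _).
  by rewrite /=; ring.
by rewrite /=; ring.
Qed.

Lemma rball_line z x i (rho : R) : rsq (z - x) < rho ^+ 2 ->
  exists2 delta, 0 < delta & forall t : R, `|t| < delta ->
    rsq (t *: delta_mx 0 i + z - x) < rho ^+ 2.
Proof.
move=> zr; set p := (z - x) 0 i; set gap := rho ^+ 2 - rsq (z - x).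
have g0 : 0 < gap by rewrite subr_gt0.
have p1 : 0 < 1 + 2 * `|p| by have := normr_ge0 p; lra.
exists (Num.min 1 (gap / (1 + 2 * `|p|))); first by rewrite lt_min ltr01 divr_gt0.
move=> t; rewrite lt_min => /andP[t1]; rewrite ltr_pdivlMr // => tg.
rewrite -addrA rsq_line -/p.
have h1 : t ^+ 2 <= `|t|.
  by rewrite -real_normK ?num_real // expr2 ler_piMr // ltW.
have h2 : t * p <= `|t| * `|p| by rewrite -normrM ler_norm.
by rewrite /gap in tg; lra.
Qed.

(* The barrier vanishes on the sphere and is strictly subharmonic away from
   [y0], so the minimum principle keeps the superharmonic [phi] above it. *)
Lemma eigenfunction_lower x (phi : vec -> R) : principal_eigenfunction x phi ->
  0 < rho_d R d /\ exists2 c0, 0 < c0 &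
    forall y, c0 * (rho_d R d ^+ 2 - rsq (y - x)) <= phi y.
Proof.
set rho := rho_d R d => -[cphi [phi_out [phi_ge0 [dphi [_ [eqphi intphi]]]]]].
(* From the normalisation. As phi vanishes off the ball, this point also gives [0 < rho]. *)
have [y0 phiy0] : exists y0, phi y0 != 0.
  apply: contrapT => /forallNP H.
  have : iint (fun y : vec => (phi y ^+ 2)%:E) = 0%E.
    rewrite -(iint_eq0 d); congr iint; apply/funext => y.
    by have /negP := H y; rewrite negbK => /eqP ->; rewrite expr0n.
  by rewrite intphi => /eqP; rewrite onee_eq0.
have phi0 : 0 < phi y0 by rewrite lt_neqAle eq_sym phiy0 phi_ge0.
have By0 : eball x rho y0.
  by apply: contrapT => /phi_out e; rewrite e eqxx in phiy0.
have rho0 : 0 < rho by apply: le_lt_trans By0; exact: sqrtr_ge0.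
split=> //.
have BE y : eball x rho y <-> rsq (y - x) < rho ^+ 2.
  by rewrite /eball /= enorm_lt.
have /nbhs_ballP[r /= r0 Hr] : nbhs y0 [set y | phi y0 / 2 < phi y].
  have /cvgrPdist_lt /(_ (phi y0 / 2)) := cphi y0.
  rewrite divr_gt0 // => /(_ isT); apply: filterS => y /= /ltr_normlP[_ ?]; lra.
have near_y0 y : rsq (y - y0) < r ^+ 2 -> phi y0 / 2 < phi y.
  move=> yr; apply: Hr; split=> // i j; rewrite (ord1 i) /ball /= distrC.
  rewrite -(ltr_pXn2r (n := 2)) ?nnegrE ?(ltW r0) // real_normK ?num_real //.
  apply: le_lt_trans yr; rewrite /rsq (bigD1 j) //= !mxE lerDl sumr_ge0 // => *.
  exact: sqr_ge0.
have /BE By0' := By0; set eta2 := rsq (y0 - x) in By0'.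
have gap0 : 0 < rho ^+ 2 - eta2 by rewrite subr_gt0.
have r20 : 0 < r ^+ 2 by rewrite exprn_gt0.
pose a := (2 * d%:R + 4) / r ^+ 2 + (2 * d%:R + 1) / (rho ^+ 2 - eta2).
have d0 : 0 <= d%:R :> R by [].
have a1 : 2 * d%:R + 4 <= a * r ^+ 2.
  rewrite /a [leRHS]mulrDl (divfK (lt0r_neq0 r20)) lerDl mulr_ge0 ?(ltW r20) //.
  by rewrite divr_ge0 ?(ltW gap0) //; lra.
have a2 : 2 * d%:R + 1 <= a * (rho ^+ 2 - eta2).
  rewrite /a [leRHS]mulrDl (divfK (lt0r_neq0 gap0)) lerDr mulr_ge0 ?(ltW gap0) //.
  by rewrite divr_ge0 ?(ltW r20) //; lra.
have a0 : 0 < a by rewrite addr_gt0 // divr_gt0 //; lra.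
have rho20 : 0 < rho ^+ 2 by rewrite exprn_gt0.
(* The barrier is at most rho^2 in the ball, so [eps] times it stays below phi near [y0]. *)
pose eps := phi y0 / (2 * rho ^+ 2).
have eps0 : 0 < eps by rewrite divr_gt0 // mulr_gt0.
pose g y := phi y - eps * barrier x y0 rho a y.
have cbar : continuous (barrier x y0 rho a).
  move=> y; apply: (@continuousM _ _ (fun y => rho ^+ 2 - rsq (y - x))
      (fun y => expR (- a * rsq (y - y0)))).
    exact: (@continuousB _ _ _ (cst (rho ^+ 2)) (fun y => rsq (y - x)) y
      (@cst_continuous _ _ _ _) (continuous_rsq x y)).
  apply: (@continuous_comp _ _ _ (fun y => - a * rsq (y - y0)) expR); last exact: continuous_expR.
  exact: (@continuousM _ _ (cst (- a)) (fun y => rsq (y - y0)) y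
    (@cst_continuous _ _ _ _) (continuous_rsq y0 y)).
have cg : continuous g.
  move=> y; apply: (@continuousB _ _ _ phi (fun y => eps * barrier x y0 rho a y)).
    exact: cphi.
  exact: (@continuousM _ _ (cst eps) (barrier x y0 rho a) y (@cst_continuous _ _ _ _) (cbar y)).
have [z zB zmin] : exists2 z, z \in [set y : vec | rsq (y - x) <= rho ^+ 2] &
    forall y, y \in [set y : vec | rsq (y - x) <= rho ^+ 2] -> g z <= g y.
  apply: EVT_min_rV; [|exact: compact_rball|exact: continuous_subspaceT].
  by exists y0 => /=; exact: ltW.
rewrite inE /= in zB.
suff gz : 0 <= g z.
  exists (eps * expR (- a * (4 * rho ^+ 2))); first by rewrite mulr_gt0 // expR_gt0.
  move=> y; have [yB|yB] := lerP (rsq (y - x)) (rho ^+ 2); last first.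
    apply: le_trans (phi_ge0 y).
    apply: mulr_ge0_le0; first by rewrite mulr_ge0 ?expR_ge0 ?(ltW eps0).
    by rewrite subr_le0 ltW.
  have := zmin y; rewrite inE /= => /(_ yB) => gy.
  have {gy} : eps * barrier x y0 rho a y <= phi y by rewrite -subr_ge0; apply: le_trans gz gy.
  apply: le_trans; rewrite -mulrA ler_wpM2l ?(ltW eps0) // /barrier mulrC.
  rewrite ler_wpM2l ?subr_ge0 // ler_expR !mulNr lerN2 ler_wpM2l ?(ltW a0) //.
  have -> : y - y0 = (y - x) + (x - y0) by rewrite addrA subrK.
  apply: le_trans (rsqD_le _ _) _.
  have -> : rsq (x - y0) = eta2 by rewrite /eta2 /rsq; apply: eq_bigr => i _; rewrite !mxE; ring.
  by lra.
rewrite leNgt; apply/negP => gz.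
set A := rho ^+ 2 - rsq (z - x); set B := rsq (z - y0).
have A0 : 0 <= A by rewrite subr_ge0.
have zin : rsq (z - x) < rho ^+ 2.
  rewrite lt_neqAle zB andbT; apply: contraTneq gz => e.
  by rewrite -leNgt /g /barrier e subrr mul0r mulr0 subr0.
have rB : r ^+ 2 <= B.
  rewrite leNgt; apply/negP => /near_y0 pz.
  have : eps * barrier x y0 rho a z <= phi y0 / 2.
    have : barrier x y0 rho a z <= rho ^+ 2.
      rewrite /barrier -[leRHS]mulr1; apply: ler_pM; rewrite ?expR_ge0 //.
        by rewrite lerBlDr lerDl rsq_ge0.
      rewrite -[leRHS]expR0 ler_expR mulNr oppr_le0 mulr_ge0 ?(ltW a0) //.
      exact: rsq_ge0.
    move=> /(ler_wpM2l (ltW eps0)) /le_trans; apply.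
    rewrite (_ : eps * rho ^+ 2 = phi y0 / 2) // /eps; field.
    by rewrite lt0r_neq0.
  by rewrite /g in gz; lra.
have second i : eps * (expR (- a * B) * (- 2 - 2 * a * A
    + 8 * a * ((z - x) 0 i * (z - y0) 0 i) + 4 * a ^+ 2 * ((z - y0) 0 i) ^+ 2 * A))
    <= 'D_(unitv R i) ('D_(unitv R i) phi) z.
  have [delta dl0 Hdelta] := rball_line z x i rho zin.
  set P := barrier_line_factor A ((z - x) 0 i).
  set Q := barrier_line_exponent a B ((z - y0) 0 i).
  pose Phi t := phi (t *: unitv R i + z).
  have PhiD t : `|t| < delta -> derivable Phi t 1.
    by move=> /Hdelta /BE Bt; rewrite line_derivable; have [] := dphi _ Bt i i.
  have PhiE : 'D_1 Phi = fun t => 'D_(unitv R i) phi (t *: unitv R i + z).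
    by apply/funext => t; rewrite line_derive.
  have zline : 0 *: unitv R i + z = z by rewrite scale0r add0r.
  have /BE Bz := zin.
  have PhiD2 : derivable ('D_1 Phi) 0 1.
    by rewrite PhiE (line_derivable R d ('D_(unitv R i) phi)) zline; have [] := dphi _ Bz i i.
  have PhiE2 : 'D_1 ('D_1 Phi) 0 = 'D_(unitv R i) ('D_(unitv R i) phi) z.
    by rewrite PhiE (line_derive R d ('D_(unitv R i) phi)) zline.
  pose H := poly_exp R (eps *: P) Q.
  have HD t : derivable H t 1 by exact: derivable_poly_exp.
  have H'D t : derivable ('D_1 H) t 1.
    by rewrite /H derive_poly_exp; exact: derivable_poly_exp.
  have GD (t : R) : `|t| < delta -> is_derive t 1 (Phi - H) (('D_1 Phi - 'D_1 H) t).
    move=> td; exact: (DeriveDef (derivableB (PhiD t td) (HD t)) (deriveB (PhiD t td) (HD t))).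
  have gE t : (Phi - H) t = g (t *: unitv R i + z).
    by rewrite /g barrier_line.
  have dG : derivable ('D_1 Phi - 'D_1 H) 0 1 := derivableB PhiD2 (H'D 0).
  have min0 t : `|t| < delta -> (Phi - H) 0 <= (Phi - H) t.
    move=> td; have Bt := ltW (Hdelta t td); rewrite !gE zline; apply: zmin.
    by rewrite inE.
  have := second_derivative_at_min R _ _ delta dl0 GD dG min0.
  by rewrite (deriveB PhiD2 (H'D 0)) PhiE2 /H derive2_poly_expZ barrier_line_second subr_ge0.
have lam0 : 0 <= dirichlet_eigenvalue (eball x rho) by exact: dirichlet_eigenvalue_ge0.
have : laplacian phi z <= 0.
  have /BE Bz := zin; have := eqphi z Bz.
  have : 0 <= dirichlet_eigenvalue (eball x rho) * phi z by rewrite mulr_ge0.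
  by lra.
apply/negP; rewrite -ltNge.
(* By polarisation the sum over the axes is a A (4 a B - 2 d - 4) + 4 a B + 4 a (rho^2 - eta2) - 2
   d. The choice of [a] makes the first term nonnegative and the rest positive. *)
apply: lt_le_trans (ler_sum _ (fun i _ => second i)).
rewrite -mulr_sumr mulr_gt0 // -mulr_sumr mulr_gt0 ?expR_gt0 //.
have polar := rsq_polar (z - x) (z - y0); set pq := \sum_i _ in polar.
have E1 : (z - x) - (z - y0) = y0 - x by rewrite opprB addrC addrA subrK.
rewrite E1 -/B -/eta2 in polar.
have -> : \sum_(i < d) (- 2 - 2 * a * A + 8 * a * ((z - x) 0 i * (z - y0) 0 i)
    + 4 * a ^+ 2 * ((z - y0) 0 i) ^+ 2 * A)
  = d%:R * (- 2 - 2 * a * A) + 8 * a * pq + 4 * a ^+ 2 * B * A.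
  have -> : d%:R * (- 2 - 2 * a * A) = \sum_(i < d) (- 2 - 2 * a * A).
    by rewrite sumr_const card_ord mulr_natl.
  rewrite /pq /B /rsq !mulr_sumr mulr_suml -!big_split /=.
  by apply: eq_bigr => i _; ring.
have aB : 2 * d%:R + 4 <= a * B by apply: le_trans a1 _; rewrite ler_wpM2l // ltW.
have : 0 <= a * A * (4 * (a * B) - 2 * d%:R - 4).
  by rewrite mulr_ge0 ?mulr_ge0 ?(ltW a0) //; lra.
have zxE : rsq (z - x) = rho ^+ 2 - A by rewrite /A; ring.
rewrite zxE in polar.
have -> : 8 * a * pq = 4 * a * (rho ^+ 2 - A + B - eta2) by rewrite -polar; ring.
lra.
Qed.

End LowerBound.

(** * From the L^1 distance to time spent in a cube *)

Section IteratedIntegral.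
Variable R : realType.

(** The integral is a supremum over simple functions below the integrand, so no measurability is
    asked; the inner integrals of [iint] would otherwise need it at every level. *)
Lemma integral_ge0_mono (f g : R -> \bar R) :
  (forall t, 0 <= f t)%E -> (forall t, f t <= g t)%E ->
  (\int[@lebesgue_measure R]_(t in [set: R]) f t
    <= \int[@lebesgue_measure R]_(t in [set: R]) g t)%E.
Proof.
move=> f0 fg; have g0 t : (0 <= g t)%E by exact: le_trans (f0 t) (fg t).
rewrite !ge0_integralTE //; apply: le_ereal_sup => _ [h hf <-].
by exists h => // t; exact: le_trans (hf t) (fg t).
Qed.

Lemma floor_cell (n : nat) (k : int) : (0 < n)%N ->
  [set t : R | Num.floor (n%:R * t) = k] = [set` `[k%:~R / n%:R, (k + 1)%:~R / n%:R[].
Proof.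
move=> n0; have n0' : 0 < n%:R :> R by rewrite ltr0n.
apply/seteqP; split=> t /=; rewrite in_itv /= ler_pdivrMr // ltr_pdivlMr // ![t * _]mulrC.
  by move=> <-; rewrite ge_floor lt_succ_floor.
by move=> H; exact: floor_def.
Qed.

Lemma integral_floor_lower (n m : nat) (o : int) (H : int -> R) (g : R -> \bar R) : (0 < n)%N ->
  (forall k, 0 <= H k) -> (forall t, (H (Num.floor (n%:R * t)%R))%:E <= g t)%E ->
  ((n%:R^-1 * \sum_(k < m) H (k%:Z + o))%:E
     <= \int[@lebesgue_measure R]_(t in [set: R]) g t)%E.
Proof.
move=> n0 H0 Hg; have n0' : 0 < n%:R :> R by rewrite ltr0n.
pose I k := [set t : R | Num.floor (n%:R * t) = k].
have mI k : measurable (I k) by rewrite /I floor_cell //; exact: measurable_itv.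
have muI k : @lebesgue_measure R (I k) = (n%:R^-1)%:E.
  rewrite /I floor_cell // lebesgue_measure_itv /= lte_fin.
  rewrite ltr_pM2r ?invr_gt0 // ltr_int ltrDl ltr01 -EFinB -mulrBl -intrB.
  by rewrite addrAC subrr add0r mul1r.
pose term (k : 'I_m) : R -> \bar R :=
  fun t => ((H (k%:Z + o))%:E * (\1_(I (k%:Z + o)) t)%:E)%E.
pose h t := (\sum_(k <- index_enum 'I_m) term k t)%E.
have t0 (k : 'I_m) t : (0 <= term k t)%E.
  by rewrite /term -EFinM lee_fin mulr_ge0.
have hg t : (h t <= g t)%E.
  apply: le_trans (Hg t); rewrite /h; rewrite /term; under eq_bigr do rewrite -EFinM.
  rewrite sumEFin lee_fin.
  have [[k ktE]|no] := pselect (exists k : 'I_m, k%:Z + o = Num.floor (n%:R * t)).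
    rewrite (bigD1 k) //= big1 => [|j jk].
      by rewrite addr0 indicE mem_set ?mulr1 ?ktE.
    rewrite indicE memNset ?mulr0 //= /I /= => e.
    by move/eqP: jk; apply; apply/val_inj; move: ktE; rewrite e => /addIr [].
  rewrite big1 // => k _; rewrite indicE memNset ?mulr0 // /I /= => e.
  by apply: no; exists k.
apply: le_trans (integral_ge0_mono h g _ hg); last by move=> t; apply: sume_ge0.
rewrite /h ge0_integral_sum //; last first.
  move=> k; apply: measurable_funeM; apply/measurable_realfun.measurable_EFinP.
  by apply: measurable_realfun.measurable_indic; exact (mI _).
rewrite mulr_sumr -sumEFin; apply: lee_sum => k _.
rewrite /term ge0_integralZl_EFin //; last first.
  apply/measurable_realfun.measurable_EFinP.
  by apply: measurable_realfun.measurable_indic; exact (mI _).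
have -> : (\int[@lebesgue_measure R]_(t in [set: R]) (\1_(I (k%:Z + o)) t)%:E = n%:R^-1%:E)%E.
  by rewrite integral_indic ?setIT //; [exact (muI _) | exact (mI _)].
by rewrite -EFinM mulrC.
Qed.

Definition scaled_floor (n : nat) d (y : 'rV[R]_d) : 'rV[int]_d :=
  map_mx (fun t => Num.floor (n%:R * t)) y.

Lemma iint_floor_lower (n m : nat) d (o : 'rV[int]_d) (F : 'rV[int]_d -> R)
    (f : 'rV[R]_d -> \bar R) : (0 < n)%N -> (forall v, 0 <= F v) ->
  (forall y, (F (scaled_floor n d y))%:E <= f y)%E ->
  (((n%:R^-1) ^+ d * \sum_(t : {ffun 'I_d -> 'I_m}) F (\row_i ((t i)%:Z + o 0 i)))%:E
    <= iint f)%E.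
Proof.
move=> n0; elim: d o F f => [|d IH] o F f F0 Ff /=.
  rewrite expr0 mul1r; apply: le_trans (Ff 0); rewrite lee_fin.
  have E (t : {ffun 'I_0 -> 'I_m}) : \row_i ((t i)%:Z + o 0 i) = scaled_floor n 0 0.
    by apply/rowP => -[].
  under eq_bigr do rewrite E.
  by rewrite sumr_const card_ffun !card_ord expn0.
pose o' : 'rV[int]_d := \row_j o 0 (lift ord0 j).
pose H (k : int) : R := (n%:R^-1) ^+ d * \sum_(t : {ffun 'I_d -> 'I_m})
   F (row_mx (const_mx k : 'rV_1) (\row_i ((t i)%:Z + o' 0 i)) : 'rV_d.+1).
have -> : (n%:R^-1) ^+ d.+1 * \sum_(t : {ffun 'I_d.+1 -> 'I_m}) F (\row_i ((t i)%:Z + o 0 i))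
    = n%:R^-1 * \sum_(k < m) H (k%:Z + o 0 ord0) :> R.
  rewrite exprS -mulrA -mulr_sumr; congr (_ * (_ * _)); rewrite pair_bigA /=.
  rewrite (reindex (fun p : 'I_m * {ffun 'I_d -> 'I_m} =>
      [ffun i => if unlift ord0 i is Some j then p.2 j else p.1] : {ffun 'I_d.+1 -> 'I_m})) /=.
    apply: eq_bigr => -[k t] _ /=; congr F; apply/rowP => i; rewrite !mxE ffunE.
    case: splitP => j ij; rewrite !mxE.
      have -> : i = ord0 by apply/val_inj; rewrite /= ij (ord1 j).
      by rewrite unlift_none.
    have -> : i = lift ord0 j by apply/val_inj; rewrite /= ij.
    by rewrite liftK.
  exists (fun t => (t ord0, [ffun j => t (lift ord0 j)])) => [[k t] _|t _] /=.
    rewrite ffunE unlift_none; congr pair; apply/ffunP => j.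
    by rewrite !ffunE liftK.
  apply/ffunP => i; rewrite ffunE; case: unliftP => [j ->|->] //.
  by rewrite ffunE.
apply: integral_floor_lower => // [k|t].
  by rewrite mulr_ge0 ?exprn_ge0 ?invr_ge0 ?ler0n // sumr_ge0.
apply: (IH o' (fun v => F (row_mx (const_mx _ : 'rV_1) v : 'rV_d.+1))) => // y.
apply: le_trans (Ff _); rewrite lee_fin le_eqVlt; apply/orP; left; apply/eqP; congr F.
by apply/rowP => i; rewrite !mxE; case: splitP => j _; rewrite !mxE.
Qed.

Lemma iint_floor_lower_cube (n r : nat) d (c : 'rV[int]_d) (F : 'rV[int]_d -> R)
    (f : 'rV[R]_d -> \bar R) : (0 < n)%N -> (forall v, 0 <= F v) ->
  (forall y, (F (scaled_floor n d y))%:E <= f y)%E ->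
  (((n%:R^-1) ^+ d * \sum_(v <- cube c r) F v)%:E <= iint f)%E.
Proof.
move=> n0 F0 Ff.
apply: le_trans (iint_floor_lower n (2 * r).+1 d (\row_i (c 0 i - r%:Z)) F f n0 F0 Ff).
rewrite lee_fin le_eqVlt; apply/orP; left; apply/eqP; congr (_ * _).
rewrite /cube /codom /image_mem big_map big_enum /=; apply: eq_bigr => t _.
by congr F; apply/rowP => i; rewrite !mxE; ring.
Qed.

Lemma iint_abs_diff_lower (n r : nat) d (c : 'rV[int]_d) (G : 'rV[int]_d -> R)
    (f : 'rV[R]_d -> R) (m : R) : (0 < n)%N ->
  (forall y, in_cube c r (scaled_floor n d y) -> m <= f y) ->
  (((n%:R^-1) ^+ d * \sum_(v <- cube c r) (m - G v))%:E
    <= iint (fun y => `|G (scaled_floor n d y) - f y|%:E))%E.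
Proof.
move=> n0 mf.
(* The positive part gives a nonnegative step function below the integrand; the sum of m - G is
   smaller still. *)
pose F v := if in_cube c r v then Num.max 0 (m - G v) else 0.
have F0 v : 0 <= F v by rewrite /F; case: ifP => // _; rewrite le_max lexx.
apply: le_trans (iint_floor_lower_cube n r d c F _ n0 F0 _) => [|y].
  rewrite lee_fin ler_wpM2l ?exprn_ge0 ?invr_ge0 ?ler0n // big_seq [leRHS]big_seq.
  by apply: ler_sum => v; rewrite mem_cube /F => ->; rewrite le_max lexx orbT.
rewrite lee_fin /F; case: ifP => // /mf my; rewrite ge_max normr_ge0 /=.
by rewrite distrC; apply: le_trans (ler_norm _); rewrite lerB.
Qed.

Lemma sum_L_N d N (w : traj d N) c r :
  (\sum_(v <- cube c r) L_N w v = count (in_cube c r) (positions w N))%N.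
Proof.
under eq_bigr do rewrite L_NE.
elim: (positions w N) => [|y s IH] /=; first by rewrite big1.
rewrite big_split /= IH; congr (_ + _)%N.
have [cy|cy] := boolP (in_cube c r y); last first.
  rewrite big_seq big1 // => v; rewrite mem_cube; case: eqP => // <-.
  by rewrite (negbTE cy).
rewrite (bigD1_seq y) ?cube_uniq ?mem_cube //= eqxx big1 // => v.
by rewrite eq_sym => /negbTE ->.
Qed.

(* The cells of the cube contribute at least [m - ell] each to the L1 distance,
   so a small distance forces the walk to spend much time in the cube. *)
Lemma G_loc_local_time d (n r : nat) (c : 'rV[int]_d) (phi : 'rV[R]_d -> R) (m : R)
    (w : traj d (Nof d n)) : (0 < n)%N ->
  (forall y, in_cube c r (scaled_floor n d y) -> m <= phi y ^+ 2) ->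
  G_loc (n:=n) phi w ->
  (Nof d n)%:R * ((n%:R^-1) ^+ d * ((2 * r).+1 ^ d)%:R * m - n%:R `^ (- (800%:R)^-1))
    <= (count (in_cube c r) (positions w (Nof d n)))%:R.
Proof.
move=> n0 mphi; rewrite /G_loc /= => Hloc.
set N := Nof d n in w Hloc *.
have n0' : 0 < n%:R :> R by rewrite ltr0n.
have N0 : 0 < N%:R :> R by rewrite ltr0n expn_gt0 n0.
pose G v : R := (n ^ d)%:R / N%:R * (L_N w v)%:R.
have := iint_abs_diff_lower n r d c G (fun y => phi y ^+ 2) m n0 mphi.
move=> /le_trans /(_ Hloc); rewrite lee_fin sumrB big_const_seq count_predT iter_addr_0.
rewrite size_cube -mulr_sumr -natr_sum sum_L_N -[m *+ _]mulr_natr mulrBr.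
set V := (count _ _)%:R; set K := ((2 * r).+1 ^ d)%:R; set nk := _ `^ _.
have -> : n%:R^-1 ^+ d * ((n ^ d)%:R / N%:R * V) = N%:R^-1 * V.
  by rewrite natrX exprVn mulrA mulrA mulVf ?mul1r // expf_neq0 // gt_eqF.
move=> H.
have : N%:R * (n%:R^-1 ^+ d * (m * K) - nk) <= N%:R * (N%:R^-1 * V).
  by rewrite ler_wpM2l ?(ltW N0) //; lra.
by rewrite mulVKf ?gt_eqF // (mulrC m) mulrA.
Qed.

End IteratedIntegral.

(** * Growth comparisons and the number of trials *)

Section Scales.
Variables (R : realType) (d : nat).
Hypothesis d_gt0 : (0 < d)%N.

Lemma nat_above (A : R) : exists B : nat, forall b, (B <= b)%N -> A <= b%:R.
Proof.
exists (Num.truncn `|A|).+1 => b Bb; apply: le_trans (ler_norm A) _.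
apply/ltW/(lt_le_trans (truncnS_gt _)); by rewrite ler_nat.
Qed.

Lemma exp_beats_poly (A : R) (k : nat) :
  exists B : nat, forall b, (B <= b)%N -> A * b%:R ^+ k <= expR b%:R.
Proof.
have [B HB] := nat_above (`|A| * k.+1%:R ^+ k.+1).
exists B => b /HB Ab; set x := b%:R in Ab *.
have x0 : 0 <= x by exact: ler0n.
have k0 : 0 < k.+1%:R ^+ k.+1 :> R by rewrite exprn_gt0.
apply: (@le_trans _ _ ((x / k.+1%:R) ^+ k.+1)).
  rewrite expr_div_n ler_pdivlMr // [x ^+ k.+1]exprS.
  apply: (@le_trans _ _ (`|A| * x ^+ k * k.+1%:R ^+ k.+1)).
    by rewrite ler_wpM2r ?(ltW k0) // ler_wpM2r ?exprn_ge0 // ler_norm.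
  by rewrite mulrAC ler_wpM2r ?exprn_ge0.
have -> : expR x = expR (x / k.+1%:R) ^+ k.+1 by rewrite -expRM_natl mulrC divfK.
rewrite lerXn2r ?nnegrE ?expR_ge0 ?divr_ge0 //.
by apply: le_trans (expR_ge1Dx _); rewrite lerDr.
Qed.

Lemma expR1_le4 : expR 1 <= 4 :> R.
Proof.
have h : 2^-1 <= expR (- 2^-1) :> R by apply: le_trans (expR_ge1Dx _); lra.
have -> : expR 1 = (expR (- 2^-1) ^+ 2)^-1 :> R.
  by rewrite -expRM_natl -expRN; congr expR; field.
rewrite (_ : 4 = ((2^-1) ^+ 2)^-1 :> R); last by field.
by rewrite lef_pV2 ?posrE ?exprn_gt0 ?expR_gt0 // lerXn2r ?nnegrE ?expR_ge0.
Qed.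

Lemma root_between (P n : nat) : (0 < P)%N -> exists b, (b ^ P <= n < b.+1 ^ P)%N.
Proof.
move=> P0; have ex0 : exists b, (b ^ P <= n)%N by exists 0%N; rewrite exp0n.
have bnd b : (b ^ P <= n)%N -> (b <= n)%N.
  apply: leq_trans; case: b => // b; rewrite -{1}(expn1 b.+1) leq_pexp2l //.
case: (ex_maxnP ex0 bnd) => b bn bmax; exists b; rewrite bn /= ltnNge.
by apply/negP => /bmax; rewrite ltnn.
Qed.

Lemma powR_root_le (x : R) (n m k : nat) : (0 < m)%N -> 0 <= x ->
  n%:R <= x ^+ m -> n%:R `^ (m%:R^-1) <= x.
Proof.
move=> m0 x0 nx; have m0' : m%:R != 0 :> R by rewrite pnatr_eq0 -lt0n.
have -> : x = (x ^+ m) `^ (m%:R^-1).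
  by rewrite -powR_mulrn // -powRrM mulfV // powRr1.
by rewrite ge0_ler_powR // ?nnegrE ?exprn_ge0 // invr_ge0.
Qed.

Lemma powR_root_ge (x : R) (n m : nat) : (0 < m)%N -> 0 <= x ->
  x ^+ m <= n%:R -> x <= n%:R `^ (m%:R^-1).
Proof.
move=> m0 x0 nx; have m0' : m%:R != 0 :> R by rewrite pnatr_eq0 -lt0n.
have -> : x = (x ^+ m) `^ (m%:R^-1).
  by rewrite -powR_mulrn // -powRrM mulfV // powRr1.
by rewrite ge0_ler_powR // ?nnegrE ?exprn_ge0 // invr_ge0.
Qed.

Lemma trial_surplus (D c3 b w n C : R) : 0 <= D -> 1 <= b -> 0 <= w -> 0 <= n -> 0 <= C ->
  w * b ^+ (d + 3) <= C * n -> 2 * D * C ^+ (d + 2) <= b * c3 ->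
  2 * D * w ^+ (d + 2) * b ^+ (d + 3) <= c3 * n ^+ (d + 2) / b ^+ (d * (d + 3) + 2).
Proof.
move=> D0 b1 w0 n0 C0 wn h2; have bpos : 0 < b by lra.
rewrite ler_pdivlMr ?exprn_gt0 //.
have h1 : w ^+ (d + 2) * b ^+ ((d + 3) * (d + 2)) <= C ^+ (d + 2) * n ^+ (d + 2).
  by rewrite exprM -!exprMn lerXn2r ?nnegrE ?mulr_ge0 ?exprn_ge0 ?(ltW bpos).
have h3 : 2 * D * (w ^+ (d + 2) * b ^+ ((d + 3) * (d + 2))) <= b * c3 * n ^+ (d + 2).
  apply: (@le_trans _ _ (2 * D * (C ^+ (d + 2) * n ^+ (d + 2)))).
    by rewrite ler_wpM2l // mulr_ge0.
  by rewrite mulrA ler_wpM2r ?exprn_ge0.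
rewrite -(ler_pM2l bpos) [leRHS]mulrA; apply: le_trans h3.
have -> : ((d + 3) * (d + 2) = d.+1 + (d + 3) + (d * (d + 3) + 2))%N by lia.
rewrite (exprD b (d.+1 + _)) (exprD b d.+1) exprS.
have bd : 1 <= b ^+ d by rewrite exprn_ege1.
set X := w ^+ (d + 2); set Y := b ^+ (d + 3); set Z := b ^+ (d * (d + 3) + 2).
have Q0 : 0 <= D * (X * (b * (Y * Z))).
  by rewrite !mulr_ge0 ?exprn_ge0 // ltW.
have := ler_wpM2l Q0 bd; lra.
Qed.

Lemma trial_count_abs (E a32 c4 b w r : R) (T V : nat) : 1 <= E -> 1 <= a32 -> 1 <= c4 ->
  1 <= b -> 1 <= w -> (0 < T)%N -> T%:R <= E * w ^+ 2 ->
  2 * (4 * E * (a32 * c4)) * w ^+ (d + 2) * b ^+ (d + 3) <= r -> r - 1 <= V%:R ->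
  exists j : nat, (j.+1 * T <= V)%N /\
    b ^+ 3 <= j%:R * ((2^-1 * (a32 * w ^+ d)^-1) / (c4 * b ^+ d)).
Proof.
move=> E1 a1 c1 b1 w1 T0 TR key Vr.
have T1 : 1 <= T%:R :> R by rewrite ler1n.
have w2 : 0 <= w ^+ 2 by rewrite exprn_ge0 //; lra.
have wd : 1 <= w ^+ d by rewrite exprn_ege1.
have bd : 1 <= b ^+ d by rewrite exprn_ege1.
have bd3 : 1 <= b ^+ (d + 3) by rewrite exprn_ege1.
have ac1 : 1 * 1 <= a32 * c4 by apply: ler_pM; lra.
have r6 : 8 * T%:R <= r.
  apply: le_trans key; rewrite exprD.
  have m1 : 1 * 1 <= (a32 * c4) * (w ^+ d * b ^+ (d + 3)).
    by apply: ler_pM; rewrite // ?mulr1 //; rewrite -[leLHS]mulr1; apply: ler_pM.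
  have : E * w ^+ 2 * (1 * 1) <= E * w ^+ 2 * ((a32 * c4) * (w ^+ d * b ^+ (d + 3))).
    by rewrite ler_wpM2l // mulr_ge0 //; lra.
  lra.
have VT : (T <= V)%N by rewrite -(ler_nat R); lra.
have q0 : (0 < V %/ T)%N by rewrite divn_gt0.
(* One trial is given up for [j.+1]. The loss is harmless, as r >= 8 T yields r <= 2 j T. *)
exists (V %/ T).-1; split; first by rewrite prednK // leq_trunc_div.
set j := (V %/ T).-1.
have jT : r <= 2 * j%:R * T%:R.
  have : (V < j.+2 * T)%N by rewrite /j prednK // ltn_ceil.
  by rewrite -(ltr_nat R) natrM -[j.+2%:R]natr1 -[j.+1%:R]natr1; lra.
have jj : 0 <= j%:R :> R by exact: ler0n.
have W0 : 0 < a32 * w ^+ d by rewrite mulr_gt0 //; lra.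
have cb : 0 < c4 * b ^+ d by rewrite mulr_gt0 //; lra.
rewrite -invfM -invfM ler_pdivlMr; last by rewrite mulr_gt0 // mulr_gt0.
have TW : 0 < E * w ^+ 2 by rewrite mulr_gt0 ?exprn_gt0 //; lra.
rewrite -(ler_pM2l TW).
have : 2 * j%:R * T%:R <= 2 * j%:R * (E * w ^+ 2) by rewrite ler_wpM2l // mulr_ge0.
move/(le_trans jT)/(le_trans key); rewrite !exprD.
have : 0 <= E * w ^+ 2 * (a32 * w ^+ d * (c4 * b ^+ d)) * b ^+ 3.
  by rewrite !mulr_ge0 ?(ltW W0) ?(ltW cb) ?exprn_ge0 //; lra.
by move: (w ^+ d) (w ^+ 2) (b ^+ d) (b ^+ 3) => *; lra.
Qed.

(* [V] is of order [n ^ (d + 2) / b ^ (d p + 2)] and the side of the cubes at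
   most of order [n / b ^ p]; the choice [p = d + 3] leaves a surplus
   [b ^ (d + 1)] in the number of trials. *)
Lemma trial_count (c3 : R) (C : nat) : 0 < c3 ->
  exists B : nat, forall b n w V : nat, (B <= b)%N -> (0 < b)%N -> (0 < w)%N ->
    (w * b ^ (d + 3) <= C * n)%N ->
    c3 * n%:R ^+ (d + 2) / b%:R ^+ (d * (d + 3) + 2) - 1 <= V%:R ->
    exists j : nat, (j.+1 * trial_time d w <= V)%N /\
      b%:R ^+ 3 <= j%:R * ((2^-1 * (32 * d%:R * w%:R)^-1 ^+ d) / harnack_cst R d b).
Proof.
move=> c30.
have ge1 k m : (0 < k)%N -> (0 < m)%N -> 1 <= k%:R * m%:R :> R.
  by move=> k0 m0; rewrite -natrM ler1n muln_gt0 k0.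
have d1 : 1 <= d%:R :> R by rewrite ler1n.
have [E [E1 EE]] : exists E : R, 1 <= E /\ E = 65 * d%:R by exists (65 * d%:R); rewrite ge1.
have [a32 [a1 aE]] : exists a : R, 1 <= a /\ a = (32 * d%:R) ^+ d.
  by exists ((32 * d%:R) ^+ d); rewrite exprn_ege1 // ge1.
have [c4 [c1 cE]] : exists c : R, 1 <= c /\ c = (2 * d%:R + 3) * (4 * (256 * d%:R ^+ 2) ^+ d).
  exists ((2 * d%:R + 3) * (4 * (256 * d%:R ^+ 2) ^+ d)); split => //.
  have : 1 <= (256 * d%:R ^+ 2) ^+ d :> R.
    by rewrite exprn_ege1 // -natrX ge1 // expn_gt0 d_gt0.
  move: (_ ^+ d) => z z1; rewrite -[leLHS]mulr1; apply: ler_pM; lra.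
have D0 : 0 <= 4 * E * (a32 * c4) by rewrite !mulr_ge0 //; lra.
have [B HB] := nat_above (2 * (4 * E * (a32 * c4)) * C%:R ^+ (d + 2) / c3).
exists B => b n w V Bb b0 w0 wn Vr.
have b1 : 1 <= b%:R :> R by rewrite ler1n.
have w1 : 1 <= w%:R :> R by rewrite ler1n.
have wnR : w%:R * b%:R ^+ (d + 3) <= C%:R * n%:R :> R.
  by rewrite -natrX -!natrM ler_nat.
have HBb : 2 * (4 * E * (a32 * c4)) * C%:R ^+ (d + 2) <= b%:R * c3.
  by rewrite -ler_pdivrMr //; exact: HB.
have key := trial_surplus _ c3 b%:R w%:R n%:R C%:R D0 b1
  (ler0n _ _) (ler0n _ _) (ler0n _ _) wnR HBb.
have TR : (trial_time d w)%:R <= E * w%:R ^+ 2.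
  rewrite EE -natrX -!natrM ler_nat /trial_time.
  have : (0 < d * w ^ 2)%N by rewrite muln_gt0 d_gt0 expn_gt0 w0.
  by rewrite -!mulnA; move: (d * w ^ 2)%N => m m0; rewrite -addn1 (mulnDl 64 1) leq_add2l mul1n.
have [j [jV jb]] := trial_count_abs E a32 c4 _ _ _ _ _ E1 a1 c1 b1 w1 (ltn0Sn _) TR key Vr.
exists j; split => //; apply: le_trans jb _; rewrite le_eqVlt; apply/orP; left; apply/eqP.
rewrite exprVn [(_ * w%:R) ^+ d]exprMn -aE; congr (_ * (_ / _)).
by rewrite /harnack_cst cE [(_ * b%:R) ^+ d]exprMn !mulrA.
Qed.

End Scales.

(** * Size of phi on the cells around a grid point *)

Section Cells.
Variables (R : realType) (d : nat).
Notation vec := 'rV[R]_d.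

Lemma coord_le_rsq (u : vec) (r : R) i : 0 <= r -> rsq R d u <= r ^+ 2 -> `|u 0 i| <= r.
Proof.
move=> r0 ur; rewrite -(ler_pXn2r (n := 2)) ?nnegrE // real_normK ?num_real //.
by apply: le_trans ur; rewrite /rsq (bigD1 i) //= lerDl sumr_ge0 // => *; exact: sqr_ge0.
Qed.

Lemma rsqD_sup (u v : vec) (r delta : R) : 0 <= r -> 0 <= delta -> rsq R d u <= r ^+ 2 ->
  (forall i, `|v 0 i| <= delta) ->
  rsq R d (u + v) <= rsq R d u + d%:R * (2 * r * delta + delta ^+ 2).
Proof.
move=> r0 delta0 ur vdelta; rewrite mulr_natl -[X in _ *+ X]card_ord -sumr_const /rsq -big_split.
apply: ler_sum => i _ /=; rewrite mxE sqrrD -addrA lerD2l lerD //.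
  rewrite -[leLHS]mulr_natl -mulrA ler_wpM2l //; apply: le_trans (ler_norm _) _.
  by rewrite normrM ler_pM // coord_le_rsq.
by rewrite -real_normK ?num_real // lerXn2r ?nnegrE.
Qed.

Definition grid_point (n : nat) (c : 'rV[int]_d) : vec :=
  n%:R^-1 *: map_mx (fun a : int => a%:~R) c.

Lemma scaled_floor_grid n c : (0 < n)%N -> scaled_floor R n d (grid_point n c) = c.
Proof.
move=> n0; apply/rowP => i; rewrite !mxE mulrA mulfV ?mul1r ?intrKfloor //.
by rewrite pnatr_eq0 -lt0n.
Qed.

(** The extra 1 is the rounding error of the floor. *)
Lemma cell_close n c M (y : vec) i : (0 < n)%N ->
  in_cube c M (scaled_floor R n d y) -> `|(y - grid_point n c) 0 i| <= (M.+1)%:R / n%:R.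
Proof.
move=> n0 /forallP /(_ i); rewrite !mxE => H.
have n0' : 0 < n%:R :> R by rewrite ltr0n.
have fl := ge_floor (n%:R * y 0 i); have fu := lt_succ_floor (n%:R * y 0 i).
set f := Num.floor _ in H fl fu.
have H1 : `|(f - c 0 i)%:~R| <= M%:R :> R by rewrite -intr_norm -abszE ler_nat.
rewrite ler_pdivlMr // -[X in `|_| * X]gtr0_norm // -normrM mulrBl mulrAC mulVf ?gt_eqF // mul1r.
rewrite -natr1; move: H1; rewrite intrB !ler_norml intrD in fu *.
by move=> /andP[h1 h2]; apply/andP; split; lra.
Qed.

(** At the grid point rho^2 minus the squared distance is at least rho^2 eta >= rho^2 / (2 b).
    Moving by A / b^2 changes it by O(1 / b^2), so half is left for large b, and phi is at least of
    order 1 / b. *)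
Lemma phi_on_cells (x : vec) (phi : vec -> R) : principal_eigenfunction x phi ->
  exists2 c2 : R, 0 < c2 & forall A : R, exists B : nat, forall (b n M : nat) (c : 'rV[int]_d),
    (B <= b)%N -> (0 < b)%N -> (0 < n)%N -> (M.+1)%:R / n%:R <= A / b%:R ^+ 2 ->
    forall eta, eta <= 1 -> b.+1%:R^-1 <= eta ->
    eball x (rho_d R d * (1 - eta)) (grid_point n c) ->
    forall y, in_cube c M (scaled_floor R n d y) -> c2 / b%:R ^+ 2 <= phi y ^+ 2.
Proof.
move=> hphi; have [rho0 [c0 c00 phic]] := eigenfunction_lower R d x phi hphi.
set rho := rho_d R d in rho0 phic *.
have rho20 : 0 < rho ^+ 2 by rewrite exprn_gt0.
exists ((c0 * rho ^+ 2 / 4) ^+ 2); first by rewrite exprn_gt0 // divr_gt0 // mulr_gt0.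
move=> A0; pose A := `|A0|.
have A_ge0 : 0 <= A by exact: normr_ge0.
have [B HB] := nat_above R (4 * (d%:R * (2 * rho * A + A ^+ 2)) / rho ^+ 2).
exists B => b n M c Bb b0 n0 small eta eta1 etab cball y yc.
have b1 : 1 <= b%:R :> R by rewrite ler1n.
set delta := A / b%:R ^+ 2.
have b2 : 1 <= b%:R ^+ 2 :> R by rewrite exprn_ege1.
have delta0 : 0 <= delta by rewrite divr_ge0 //; lra.
have close i : `|(y - grid_point n c) 0 i| <= delta.
  apply: le_trans (cell_close n c M y i n0 yc) _; apply: le_trans small _.
  by rewrite ler_wpM2r ?invr_ge0 ?exprn_ge0 // ler_norm.
have eta0 : 0 < eta by apply: lt_le_trans etab; rewrite invr_gt0.
have eta_lt1 : 0 < 1 - eta.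
  rewrite subr_gt0 lt_neqAle eta1 andbT; apply: contraTneq cball => ->.
  by rewrite subrr mulr0 -leNgt sqrtr_ge0.
have cball' : rsq R d (grid_point n c - x) < (rho * (1 - eta)) ^+ 2.
  by move: cball; rewrite /eball /= enorm_lt // mulr_gt0.
have e1 : (rho * (1 - eta)) ^+ 2 <= rho ^+ 2 * (1 - eta).
  rewrite exprMn ler_wpM2l ?(ltW rho20) // expr2 ler_piMl ?(ltW eta_lt1) //; lra.
have cr : rsq R d (grid_point n c - x) <= rho ^+ 2.
  apply: le_trans (ltW cball') _; apply: le_trans e1 _.
  by rewrite ler_piMr ?(ltW rho20) //; lra.
have := rsqD_sup _ _ rho delta (ltW rho0) delta0 cr close.
have -> : grid_point n c - x + (y - grid_point n c) = y - x.
  by rewrite addrC addrA subrK.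
move=> yx.
have etab2 : (2 * b%:R)^-1 <= eta.
  apply: le_trans etab; rewrite lef_pV2 ?posrE //; first by rewrite -natr1; lra.
  by lra.
have d_delta : d%:R * (2 * rho * delta + delta ^+ 2) <= rho ^+ 2 / (4 * b%:R).
  have h1 : delta ^+ 2 <= A ^+ 2 / b%:R ^+ 2.
    rewrite /delta expr_div_n ler_wpM2l ?exprn_ge0 // lef_pV2 ?posrE ?exprn_gt0 //; try lra.
    by rewrite expr2 ler_peMl //; lra.
  have h2 : d%:R * (2 * rho * delta + delta ^+ 2) <= d%:R * (2 * rho * A + A ^+ 2) / b%:R ^+ 2.
    rewrite -[leRHS]mulrA ler_wpM2l // [leRHS]mulrDl; apply: lerD => //.
    by rewrite /delta mulrA.
  apply: le_trans h2 _; rewrite ler_pdivrMr; last by lra.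
  have := HB b Bb; rewrite ler_pdivrMr // => h3.
  rewrite (_ : rho ^+ 2 / (4 * b%:R) * b%:R ^+ 2 = b%:R * rho ^+ 2 / 4); last first.
    by field; lra.
  by lra.
have gap : rho ^+ 2 / (4 * b%:R) <= rho ^+ 2 - rsq R d (y - x).
  have h3 : rho ^+ 2 * (2 * b%:R)^-1 <= rho ^+ 2 * eta by rewrite ler_wpM2l ?(ltW rho20).
  have h4 : rho ^+ 2 * (2 * b%:R)^-1 = rho ^+ 2 / (4 * b%:R) + rho ^+ 2 / (4 * b%:R).
    by field; lra.
  lra.
have low : c0 * rho ^+ 2 / 4 / b%:R <= phi y.
  apply: le_trans (phic y).
  rewrite (_ : c0 * rho ^+ 2 / 4 / b%:R = c0 * (rho ^+ 2 / (4 * b%:R))); last by field; lra.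
  by rewrite ler_wpM2l // ltW.
have low0 : 0 <= c0 * rho ^+ 2 / 4 / b%:R.
  by rewrite divr_ge0 // divr_ge0 // mulr_ge0 ?(ltW c00) ?(ltW rho20).
by rewrite -expr_div_n lerXn2r ?nnegrE // (le_trans low0 low).
Qed.

End Cells.

(** * Choice of the parameters and conclusion *)

Section Assembly.
Variables (R : realType) (d : nat).
Hypothesis d_gt0 : (0 < d)%N.

(** With J = b, tau is (128 d)^i b^(P - (d + 4)), at least b since d + 5 <= P. Up to a constant the
    largest cube has side b^(P - (d + 3)), less than b^P, whence [d * P] scales. *)
Lemma scales (P : nat) : (d + 5 <= P)%N ->
  exists B : nat, forall b : nat, (B <= b)%N ->
  let M := (4 * d * b ^ (P - (d + 3)))%N in
  let w i := ((128 * d) ^ i * M)%N in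
  [/\ (3 <= b)%N,
      forall i, (i < d * P)%N -> exists tau,
        [/\ (d <= tau)%N, w i = (b * (4 * d * tau))%N & (tau ^ d <= 4 ^ b)%N],
      ((2 * w (d * P)%N).+1 ^ d <= b ^ (d * P))%N &
      (b ^ (d * P))%N%:R <= expR b%:R :> R].
Proof.
move=> dP; set L := (128 * d)%N; set C := (L ^ (d * P))%N.
have L0 : (0 < L)%N by rewrite muln_gt0.
have [B1 HB1] := exp_beats_poly R (C%:R ^+ d) (P * d).
have [B2 HB2] := exp_beats_poly R 1 (d * P).
exists (3 + d + B1 + B2 + (8 * d * C).+1)%N => b Bb M w.
have b3 : (3 <= b)%N by apply: leq_trans Bb; rewrite -!addnA leq_addr.
have db : (d <= b)%N by lia.
have B1b : (B1 <= b)%N by lia.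
have B2b : (B2 <= b)%N by lia.
have Cb : ((8 * d * C).+1 <= b)%N by apply: leq_trans Bb; rewrite leq_addl.
have b0 : (0 < b)%N by exact: leq_trans b3.
split=> //.
- move=> i iI; exists (L ^ i * b ^ (P - (d + 4)))%N.
  have e1 : (P - (d + 3) = (P - (d + 4)).+1)%N by lia.
  split.
  + apply: leq_trans db _; apply: (@leq_trans (b ^ (P - (d + 4)))).
      by rewrite -{1}(expn1 b) leq_pexp2l //; lia.
    by rewrite leq_pmull // expn_gt0 L0.
  + rewrite /w /M e1 expnS; move: (L ^ i)%N (b ^ _)%N => u v.
    by rewrite !mulnA; congr (_ * _)%N; rewrite -!mulnA; lia.
  rewrite -(ler_nat R) !natrX; apply: (@le_trans _ _ (expR b%:R)); last first.
    rewrite -[b%:R]mulr1 expRM_natl lerXn2r ?nnegrE ?expR_ge0 //.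
    exact: expR1_le4.
  apply: le_trans (HB1 b B1b); rewrite -!natrX -natrM ler_nat expnM -expnMn leq_exp2r //.
  apply: leq_mul; first by rewrite leq_pexp2l // ltnW.
  by rewrite leq_pexp2l // leq_subr.
- rewrite [(d * P)%N in leqRHS]mulnC expnM leq_exp2r //.
  have e2 : (P = (P - (d + 3)) + (d + 3))%N by lia.
  rewrite [in leqRHS]e2 expnD /w -/C /M.
  have v0 : (0 < b ^ (P - (d + 3)))%N by rewrite expn_gt0 b0.
  move: (b ^ (P - (d + 3)))%N v0 => v v0.
  have bb : (b <= b ^ (d + 3))%N by rewrite -{1}(expn1 b) leq_pexp2l //; lia.
  apply: (@leq_trans (v * b)); last by rewrite leq_mul2l bb orbT.
  apply: (@leq_trans (v * (8 * d * C).+1)); last by rewrite leq_mul2l Cb orbT.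
  rewrite mulnS; move: (C) => C'; nia.
- by rewrite natrX -[leLHS]mul1r; exact: HB2.
Qed.

Lemma Z_N_gt0 N : 0 < Z_N R d N.
Proof.
have c0 : (0 < #|{: traj d N}|)%N.
  by rewrite card_ffun card_prod card_bool !card_ord expn_gt0 muln_gt0 d_gt0.
rewrite /Z_N /Exp divr_gt0 ?ltr0n //.
have /card_gt0P[w _] := c0.
rewrite (bigD1 w) //= ltr_wpDr ?expR_gt0 // sumr_ge0 // => *; exact: expR_ge0.
Qed.

(** The volume of the cube times phi^2 is at least c2 / (q b^(d (d + 3) + 2)), where q = 2^(P d)
    comes from n <= (2 b)^P. The error n^(-1/800) is one power of b smaller, so half of this absorbs
    it. *)
Lemma local_time_scale (P b n : nat) (c2 : R) : (0 < b)%N -> (d + 5 <= P)%N ->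
  P = (800 * (d * (d + 3) + 3))%N -> (b ^ P <= n)%N -> (n <= (2 * b) ^ P)%N ->
  0 < c2 -> 2 * 2 ^+ (P * d) / c2 <= b%:R ->
  c2 / (2 * 2 ^+ (P * d)) * n%:R ^+ (d + 2) / b%:R ^+ (d * (d + 3) + 2)
  <= (Nof d n)%:R * (n%:R^-1 ^+ d * ((2 * (4 * d * b ^ (P - (d + 3)))).+1 ^ d)%:R
       * (c2 / b%:R ^+ 2) - n%:R `^ (- (800%:R)^-1)).
Proof.
move=> b0 dP PE bn nb c20 bc.
have n0 : (0 < n)%N by apply: leq_trans bn; rewrite expn_gt0 b0.
have nR : 0 < n%:R :> R by rewrite ltr0n.
have bR : 0 < b%:R :> R by rewrite ltr0n.
set M := (4 * d * _)%N; set q := 2 ^+ (P * d) in bc *.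
have q0 : 0 < q by rewrite exprn_gt0.
rewrite /Nof natrX mulrAC [leLHS]mulrC ler_wpM2l ?exprn_ge0 //.
have h1 : (b%:R ^+ (d * (d + 3) + 3))^-1 >= n%:R `^ (- (800%:R)^-1) :> R.
  rewrite powRN lef_pV2 ?posrE ?powR_gt0 ?exprn_gt0 //.
  apply: powR_root_ge => //.
  by rewrite -exprM -natrX ler_nat mulnC -PE.
have h2 : (q * b%:R ^+ (d * (d + 3)))^-1 <= n%:R^-1 ^+ d * ((2 * M).+1 ^ d)%:R.
  rewrite natrX -exprMn /q (mulnC d) !exprM -exprMn -exprVn.
  rewrite lerXn2r ?nnegrE ?invr_ge0 ?mulr_ge0 ?invr_ge0 ?exprn_ge0 //.
  rewrite [leRHS]mulrC -[leLHS]mul1r ler_pdivrMr ?mulr_gt0 ?exprn_gt0 //.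
  rewrite mulrAC ler_pdivlMr // mul1r -!natrX -!natrM ler_nat; apply: leq_trans nb _.
  have e2 : (P = (P - (d + 3)) + (d + 3))%N by lia.
  rewrite expnMn {2}e2 expnD /M.
  move: (b ^ (P - _))%N (b ^ (d + 3))%N (2 ^ P)%N => u v s.
  have : (u <= (2 * (4 * d * u)).+1)%N by nia.
  by move=> us; rewrite mulnCA leq_mul.
have h3 : (c2 / b%:R ^+ 2) * (q * b%:R ^+ (d * (d + 3)))^-1
    <= n%:R^-1 ^+ d * ((2 * M).+1 ^ d)%:R * (c2 / b%:R ^+ 2).
  by rewrite [leRHS]mulrC ler_wpM2l // divr_ge0 ?exprn_ge0 // ltW.
have h4 : (b%:R ^+ (d * (d + 3) + 3))^-1 <= c2 / (2 * q) / b%:R ^+ (d * (d + 3) + 2).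
  rewrite addn3 -addn2 exprS invfM ler_wpM2r ?invr_ge0 ?exprn_ge0 //.
  by rewrite -[leRHS]invrK lef_pV2 ?posrE ?invr_gt0 ?divr_gt0 ?mulr_gt0 // invf_div.
have h5 : (c2 / b%:R ^+ 2) * (q * b%:R ^+ (d * (d + 3)))^-1
    = 2 * (c2 / (2 * q) / b%:R ^+ (d * (d + 3) + 2)).
  rewrite exprD; field; rewrite !expf_neq0 ?gt_eqF //.
by move: h1 h3 h4 h5; lra.
Qed.

End Assembly.

Theorem theorem8p1 (R : realType) (d : nat) (hd : (3 <= d)%N) (x : 'rV[R]_d)
    (phi : 'rV[R]_d -> R) (hphi : principal_eigenfunction x phi) :
  exists kappa : R, 0 < kappa /\
    exists n0 : nat, forall n : nat, (n0 <= n)%N ->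
      (Z_N R d (Nof d n))^-1 *
        Exp_on (fun w => expR (- (range_size w)%:R))
               (G_loc (n:=n) phi `&` ~` R_cover (n:=n) kappa x)
      <= expR (- (n%:R `^ kappa)).
Proof.
have d0 : (0 < d)%N by exact: leq_trans hd.
have [P PE] : exists P, P = (800 * (d * (d + 3) + 3))%N by eexists.
have dP : (d + 5 <= P)%N by rewrite PE; nia.
have P0 : (0 < P)%N by rewrite (leq_trans _ dP) // addnS.
exists P%:R^-1; split; first by rewrite invr_gt0 ltr0n.
have [rho0 _] := eigenfunction_lower R d x phi hphi.
have [c2 c20 phi_cells] := phi_on_cells R d x phi hphi.
have [B1 HB1] := phi_cells (8 * d%:R).
have [B2 HB2] := scales R d d0 P dP.
pose c3 := c2 / (2 * 2 ^+ (P * d)).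
have c30 : 0 < c3 by rewrite divr_gt0 // mulr_gt0 // exprn_gt0.
pose I := (d * P)%N.
have [B3 HB3] := trial_count R d d0 c3 ((128 * d) ^ I * (4 * d)) c30.
have [B4 HB4] := nat_above R (2 * 2 ^+ (P * d) / c2).
have [K0 HK0] : exists K0 : nat, forall i, `|x 0 i| + rho_d R d <= K0%:R.
  have [K HK] := nat_above R (\sum_(i < d) `|x 0 i| + rho_d R d).
  exists K => i; apply: le_trans (HK K (leqnn _)).
  by rewrite lerD2r (bigD1 i) //= lerDl sumr_ge0.
(* The polynomial factor of the final union bound over [c], with the number of scales; [expR 2]
   provides the spare 1 that turns exp(-b) into exp(-(b + 1)), where n^kappa <= b + 1. *)
have [B5 HB5] := exp_beats_poly R (((2 * K0).+1%:R * 2 ^+ P) ^+ d * I%:R * expR 2) (P * d).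
pose B := (B1 + B2 + B3 + B4 + B5 + 1)%N.
exists (B.+1 ^ P)%N => n nB.
have [b /andP[bn nb]] := root_between P n P0.
have Bb : (B <= b)%N.
  rewrite -ltnS -(ltn_exp2r _ _ P0); apply: leq_ltn_trans nb.
  by apply: leq_trans nB; rewrite leq_exp2r.
have [B1b B2b B3b B4b B5b] : [/\ (B1 <= b)%N, (B2 <= b)%N, (B3 <= b)%N, (B4 <= b)%N & (B5 <= b)%N].
  by rewrite /B in Bb; split; lia.
have {HB2} := HB2 b B2b; set M := (4 * d * b ^ (P - (d + 3)))%N.
cbv zeta; set w := fun i => ((128 * d) ^ i * M)%N => -[b3 wtau wI bI].
have b0 : (0 < b)%N by exact: leq_trans b3.
have n0 : (0 < n)%N by apply: leq_trans bn; rewrite expn_gt0 b0.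
have M0 : (0 < M)%N by rewrite muln_gt0 muln_gt0 d0 expn_gt0 b0.
have nR : 0 < n%:R :> R by rewrite ltr0n.
have bR : 0 < b%:R :> R by rewrite ltr0n.
have n2b : (n <= (2 * b) ^ P)%N.
  apply: (leq_trans (ltnW nb)); rewrite leq_exp2r //; lia.
have bP : (b ^ P = b ^ (P - (d + 3)) * b ^ (d + 3))%N by rewrite -expnD subnK //; lia.
set N := Nof d n.
pose r := c3 * n%:R ^+ (d + 2) / b%:R ^+ (d * (d + 3) + 2).
have r0 : 0 <= r by rewrite divr_ge0 ?mulr_ge0 ?exprn_ge0 // ltW.
pose V := Num.truncn r.
have Vr : r - 1 <= V%:R.
  by have := truncnS_gt r; rewrite -natr1 -/V; lra.
have VR : V%:R <= r by rewrite truncn_le.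
have kap : n%:R `^ (P%:R^-1) <= b.+1%:R :> R.
  by apply: powR_root_le => //; rewrite -natrX ler_nat ltnW.
have kap1 : 1 <= n%:R `^ (P%:R^-1) :> R.
  by apply: powR_root_ge => //; rewrite expr1n ler1n.
have local c : eball x (rho_d R d * (1 - n%:R `^ (- P%:R^-1))) (grid_point R d n c) ->
    forall s : traj d N, G_loc (n:=n) phi s -> (V <= count (in_cube c M) (positions s N))%N.
  move=> cball s Gs; rewrite -(ler_nat R); apply: (le_trans VR).
  apply: le_trans (G_loc_local_time R d n M c phi (c2 / b%:R ^+ 2) s n0 _ Gs).
    exact: local_time_scale (HB4 b B4b).
  apply: (HB1 b n M c B1b b0 n0 _ (n%:R `^ (- P%:R^-1))) => //.
  - rewrite ler_pdivrMr // mulrAC ler_pdivlMr ?exprn_gt0 // -natrX -!natrM ler_nat.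
    have b2 : (b ^ 2 <= b ^ (d + 3))%N by rewrite leq_pexp2l // (leq_trans _ (leq_addl d 3)).
    apply: (@leq_trans (8 * d * b ^ P)); last by rewrite leq_mul2l bn orbT.
    rewrite bP mulnA leq_mul //.
    have v0 : (0 < b ^ (P - (d + 3)))%N by rewrite expn_gt0 b0.
    by rewrite /M (mulnDl 4 4 d) mulnDl -addn1 leq_add2l !muln_gt0 d0 v0.
  - by rewrite powRN invf_le1 // (lt_le_trans ltr01).
  - by rewrite powRN lef_pV2 ?posrE // (lt_le_trans ltr01).
pose X c (s : traj d N) : R := expR (- (range_size s)%:R) *
      ((c \notin positions s N) && (V <= count (in_cube c M) (positions s N))%N)%:R.
have cover (s : traj d N) :
    expR (- (range_size s)%:R) * \1_(G_loc (n:=n) phi `&` ~` R_cover (n:=n) P%:R^-1 x) s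
    <= \sum_(c <- cube 0 (n * K0)) X c s.
  have X0 c : 0 <= X c s by rewrite mulr_ge0 ?expR_ge0.
  rewrite indicE; have [|_] := boolP (s \in _); last by rewrite mulr0 sumr_ge0.
  (* A failure of covering names an unvisited grid point [c] of the smaller ball; closeness to phi^2
     then gives the time [V] around it. *)
  rewrite inE mulr1 => -[Gs /existsNP[z /not_implyP[zball /not_implyP[[c zc] ez]]]].
  have zE : z = grid_point R d n c by [].
  have cs : c \notin positions s N.
    apply/count_memPn; rewrite -L_NE; apply/eqP; rewrite -leqn0 leqNgt.
    apply/negP => L0; apply: ez; rewrite /ell mulr_gt0 //.
      by rewrite divr_gt0 // ltr0n expn_gt0 n0.
    by rewrite ltr0n -/(scaled_floor R n d z) zE scaled_floor_grid.
  have cc : c \in cube 0 (n * K0).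
    rewrite mem_cube; apply/forallP => i; rewrite mxE subr0.
    rewrite -(ler_nat R) natrM natr_absz intr_norm.
    have zi : `|(z - x) 0 i| <= rho_d R d.
      apply: coord_le_rsq; first exact: ltW.
      have eta0 : 0 < 1 - n%:R `^ (- P%:R^-1) :> R.
        rewrite -(pmulr_rgt0 _ rho0); apply: le_lt_trans zball; exact: sqrtr_ge0.
      have := zball; rewrite /eball /= enorm_lt ?mulr_gt0 // => /ltW /le_trans; apply.
      have eta1 : 1 - n%:R `^ (- P%:R^-1) <= 1 :> R by rewrite gerBl powR_ge0.
      have eta2 : (1 - n%:R `^ (- P%:R^-1)) ^+ 2 <= 1 :> R.
        by rewrite expr2 -[leRHS]mulr1; apply: ler_pM; rewrite ?(ltW eta0).
      by rewrite exprMn ler_piMr ?sqr_ge0.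
    have ci : (c 0 i)%:~R = n%:R * z 0 i.
      by rewrite zE !mxE mulrA mulfV ?mul1r // gt_eqF.
    rewrite ci normrM gtr0_norm // ler_wpM2l ?(ltW nR) //.
    apply: le_trans (HK0 i); rewrite -[z 0 i](subrK (x 0 i)).
    apply: le_trans (ler_normD _ _) _; rewrite addrC lerD2l.
    by move: zi; rewrite !mxE.
  have cb : eball x (rho_d R d * (1 - n%:R `^ (- P%:R^-1))) (grid_point R d n c) by rewrite -zE.
  rewrite (bigD1_seq c) ?cube_uniq //= ler_wpDr ?sumr_ge0 //.
  by rewrite /X cs local // mulr1.
have ZN0 := Z_N_gt0 R d d0 N.
set theta := b%:R ^+ 3 : R.
have b3R : 3 <= b%:R :> R by rewrite ler_nat.
(* Of these 2 b, one b pays for the polynomial number of centres and the other is the final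
   bound. *)
have th : 2 * b%:R <= (theta - b%:R) / 2.
  have : 9 * b%:R <= theta.
    by rewrite /theta exprSr ler_wpM2r ?(ltW bR) // expr2; nra.
  lra.
have Xbound c : Exp (X c) <= I%:R * (expR 1 * expR (- (2 * b%:R))) * Z_N R d N.
  apply: le_trans (uncovered_bound R d d0 N c M b V b I theta b0 _ wtau _ wI _) _.
  - by rewrite muln_gt0 d0.
  - move=> i iI; apply: (HB3 b n (w i) V B3b b0) => //.
      by rewrite /w muln_gt0 M0 andbT expn_gt0 muln_gt0 d0.
    rewrite /w /M -!mulnA -bP !mulnA leq_mul // leq_mul2r; apply/orP; right.
    by rewrite leq_mul2r leq_pexp2l ?orbT ?muln_gt0 // ltnW.
  - apply: (@le_trans _ _ (expR b%:R * expR (- (2 * b%:R)))).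
      apply: ler_pM; rewrite ?expR_ge0 //.
        by apply: le_trans bI; rewrite ler_nat.
      by rewrite ler_expR lerN2.
    by rewrite -expRD -[leRHS]expR0 ler_expR; lra.
  by rewrite ler_wpM2r ?(ltW ZN0) // ler_wpM2l // ler_wpM2l ?expR_ge0 // ler_expR lerN2.
rewrite mulrC ler_pdivrMr //; apply: le_trans (Exp_le _ _ _ _ _ cover) _.
rewrite Exp_sum_seq; apply: le_trans (ler_sum _ (fun c _ => Xbound c)) _.
rewrite big_const_seq count_predT iter_addr_0 size_cube -[leLHS]mulr_natl [leLHS]mulrA.
rewrite ler_wpM2r ?(ltW ZN0) //.
apply: (@le_trans _ _ (expR (- b.+1%:R))); last by rewrite ler_expR lerN2.
have size_le : ((2 * (n * K0)).+1 ^ d)%N%:R <= ((2 * K0).+1%:R * 2 ^+ P) ^+ d * b%:R ^+ (P * d) :> R.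
  rewrite exprM -exprMn -!natrX -!natrM -natrX ler_nat leq_exp2r //.
  apply: (@leq_trans ((2 * K0).+1 * n)).
    have -> : (2 * (n * K0)).+1 = (1 + 2 * K0 * n)%N by rewrite add1n (mulnC n) mulnA.
    by rewrite [leqRHS]mulSn leq_add2r.
  by rewrite -mulnA leq_mul2l /= -expnMn.
have := HB5 b B5b; set A := (_ * _) ^+ d in size_le *; set bp := _ ^+ (P * d) in size_le *.
move=> HA.
have I0 : 0 <= I%:R * (expR 1 * expR (- (2 * b%:R))) :> R by rewrite !mulr_ge0 ?expR_ge0.
apply: (le_trans (ler_wpM2r I0 size_le)).
have -> : A * bp * (I%:R * (expR 1 * expR (- (2 * b%:R))))
   = A * I%:R * expR 2 * bp * expR (- (2 * b%:R) - 1).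
  have -> : expR 2 = expR 1 * expR 1 :> R by rewrite -expRD; congr expR; ring.
  have := expRxMexpNx_1 (1 : R); rewrite expRD => e1.
  have -> : A * I%:R * (expR 1 * expR 1) * bp * (expR (- (2 * b%:R)) * expR (-1))
    = A * I%:R * expR 1 * bp * expR (- (2 * b%:R)) * (expR 1 * expR (-1)) by ring.
  by rewrite e1; ring.
apply: (@le_trans _ _ (expR b%:R * expR (- (2 * b%:R) - 1))).
  by rewrite ler_wpM2r ?expR_ge0.
by rewrite -expRD ler_expR -natr1; lra.
Qed.
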